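(* Let $p$ be a prime with $p \equiv 1 \pmod{24}$, let $b,c$ be positive integers with $p=b^{2}+bc+c^{2}$, let $m\geq 2$ be an integer, and let $\mathcal Q$ be a finite directly regular $4$-polytope of type $\{\{6,3\}_{(m,0)},\{3,4\}\}$ such that $p(p^{2}-1)$ does not divide $|\Gamma(\mathcal{Q})|$. Then there exists a chiral $4$-polytope, whose automorphism group is isomorphic to $L_{2}(p)\times \Gamma^{+}(\mathcal{Q})$, of type $\{\{6,3\}_{(m,0)},\{3,4\}\}$ if $p\mid m$, and of type $\{\{6,3\}_{(mb,mc)},\{3,4\}\}$ if $p\nmid m$. Its facets are regular in the first case and chiral in the second case.
   Context: An abstract $n$-polytope is a ranked poset (ranks $-1,\dots,n$) with a least and a greatest face, all flags of size $n+2$, strongly flag-connected, and satisfying the diamond condition; $\Gamma(\mathcal P)$ is its automorphism group. $\mathcal P$ is regular if $\Gamma(\mathcal P)$ is flag-transitive, and chiral if $\Gamma(\mathcal P)$ has exactly two flag orbits with adjacent flags always in distinct orbits. For regular $\mathcal P$, $\Gamma(\mathcal P)$ is generated by involutions $\rho_0,\dots,\rho_{n-1}$; the rotation subgroup $\Gamma^+(\mathcal P)$ is generated by $\sigma_i=\rho_{i-1}\rho_i$, has index at most $2$, and $\mathcal P$ is directly regular if the index is $2$. A polytope is of type $\{\mathcal P_1,\mathcal P_2\}$ if its facets are isomorphic to $\mathcal P_1$ and its vertex-figures to $\mathcal P_2$. $\{3,4\}$ is the octahedron; $\{6,3\}_{(b,c)}$ denotes the toroidal map obtained from the hexagonal tessellation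 of the plane by factoring out the translation lattice generated by the vector $(b,c)$ (in hexagonal-lattice coordinates) and its image under rotation by $60^\circ$; it is regular if $bc=0$ or $b=c$ and chiral otherwise. $L_2(p)=PSL_2(p)$. *)

(* Defs.v *)
From HB Require Import structures.
From mathcomp Require Import all_boot all_order all_algebra all_fingroup all_solvable.
From mathcomp Require Import generic_quotient boolp.
From mathcomp Require Import zify.

Set Implicit Arguments.
Unset Strict Implicit.
Unset Printing Implicit Defensive.

Import Order.TTheory GRing.Theory.

Local Open Scope order_scope.
Local Open Scope quotient_scope.

(* Abstract polytopes are represented by their (finite) face posets. *)

Section Polytopes.
Variables (d : Order.disp_t) (P : finPOrderType d).
Implicit Types (x y F G : P) (C Phi Psi : {set P}) (n : nat).

Definition chain C := [forall x in C, forall y in C, (x <= y) || (y <= x)].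

Definition flags : {set {set P}} := [set Phi | maxset chain Phi].

(* One less than the length of a longest chain strictly below F. When all flags
   have n + 2 faces, this is the rank function of P, with range -1, ..., n. *)
Definition rank F : int :=
  ((\max_(C : {set P} | chain C && [forall x in C, (x < F)%O]) #|C|)%N%:Z - 1)%R.

Definition adjacent : rel {set P} := fun Phi Psi =>
  [&& Phi \in flags, Psi \in flags, #|Phi :\: Psi| == 1%N & #|Psi :\: Phi| == 1%N].

Definition i_adjacent (i : nat) : rel {set P} := fun Phi Psi =>
  adjacent Phi Psi && [forall x in Phi :\: Psi, rank x == i%:Z%R].

Definition strongly_flag_connected :=
  forall Phi Psi, Phi \in flags -> Psi \in flags ->
  connect [rel A B | [&& adjacent A B, Phi :&: Psi \subset A
                                     & Phi :&: Psi \subset B]] Phi Psi.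

Definition diamond_condition :=
  forall F G, F < G -> rank G = (rank F + 2)%R ->
  #|[set x | F < x < G]| = 2%N.

Definition polytope n :=
  [/\ (exists F, forall x, F <= x) /\ (exists F, forall x, x <= F),
      forall Phi, Phi \in flags -> #|Phi| = n.+2,
      strongly_flag_connected
    & diamond_condition].

Definition autgroup : {set {perm P}} :=
  [set s : {perm P} | [forall x, forall y, (s x <= s y) == (x <= y)]].

Lemma autgroup_group_set : group_set autgroup.
Proof.
apply/group_setP; split=> [|s t].
  by rewrite inE; apply/forallP=> x; apply/forallP=> y; rewrite !perm1.
rewrite !inE => /forallP Hs /forallP Ht.
apply/forallP=> x; apply/forallP=> y; rewrite !permM.
by rewrite (eqP (forallP (Ht _) _)) (eqP (forallP (Hs _) _)).
Qed.
Canonical autgroup_group := Group autgroup_group_set.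

Definition regular n :=
  polytope n /\ [transitive autgroup, on flags | 'P^*].

Definition chiral n :=
  [/\ polytope n,
      #|orbit 'P^* autgroup @: flags| = 2%N
    & forall Phi Psi, adjacent Phi Psi ->
      orbit 'P^* autgroup Phi != orbit 'P^* autgroup Psi].

(* The automorphism taking the base flag Phi to the i-adjacent flag; in a
   regular polytope it exists, and it is unique as automorphisms act freely on
   flags. *)
Definition rho Phi (i : nat) : {perm P} :=
  odflt 1%g [pick s in autgroup | i_adjacent i Phi (s @: Phi)].

Definition sigma Phi (i : nat) : {perm P} := (rho Phi i.-1 * rho Phi i)%g.

Definition rotgroup n Phi : {group {perm P}} :=
  <<[set sigma Phi i | i : 'I_n & (0 < i)%N]>>%G.

Definition directly_regular n Phi :=
  regular n /\ #|autgroup : rotgroup n Phi|%g = 2%N.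

End Polytopes.

Section Sections.
Variables (d : Order.disp_t) (P : finPOrderType d).

Definition facet_section (F : P) := {x : P | x <= F}.
Definition vertex_figure (V : P) := {x : P | V <= x}.

HB.instance Definition _ F := SubFinite.on (facet_section F).
HB.instance Definition _ F :=
  [SubChoice_isSubPOrder of facet_section F by <: with d].
HB.instance Definition _ V := SubFinite.on (vertex_figure V).
HB.instance Definition _ V :=
  [SubChoice_isSubPOrder of vertex_figure V by <: with d].
End Sections.

Definition poset_iso (d1 d2 : Order.disp_t)
    (P1 : porderType d1) (P2 : porderType d2) :=
  exists2 f : P1 -> P2, bijective f & {mono f : x y / x <= y}.

Definition of_type n (d d1 d2 : Order.disp_t) (P : finPOrderType d)
    (P1 : porderType d1) (P2 : porderType d2) :=
  (forall F : P, rank F = (n%:Z - 1)%R -> poset_iso (facet_section F) P1) /\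
  (forall V : P, rank V = 0%R -> poset_iso (vertex_figure V) P2).

Definition regular_facets n (d : Order.disp_t) (P : finPOrderType d) :=
  forall F : P, rank F = (n%:Z - 1)%R -> regular (facet_section F) n.-1.

Definition chiral_facets n (d : Order.disp_t) (P : finPOrderType d) :=
  forall F : P, rank F = (n%:Z - 1)%R -> chiral (facet_section F) n.-1.

(* The octahedron with vertices +-e_1, +-e_2, +-e_3: a proper face is the convex
   hull of the s_i e_i over some set of indices i, so it is a partial sign
   vector; Some of the empty one is the least face and None is the greatest. *)
Definition octahedron := option {ffun 'I_3 -> option bool}.
HB.instance Definition _ := Finite.on octahedron.

Definition octahedron_le (x y : octahedron) :=
  match x, y with
  | _, None => true
  | None, Some _ => false
  | Some s, Some t => [forall i, (s i == None) || (s i == t i)]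
  end.

Fact octahedron_le_refl : reflexive octahedron_le.
Proof. by case=> //= s; apply/forallP=> i; rewrite eqxx orbT. Qed.
Fact octahedron_le_anti : antisymmetric octahedron_le.
Proof.
case=> [s|] [t|] //= /andP[/forallP st /forallP ts]; congr Some.
apply/ffunP=> i; move: (st i) (ts i).
by case: (s i) (t i) => [[]|] [[]|].
Qed.
Fact octahedron_le_trans : transitive octahedron_le.
Proof.
case=> [t|] [s|] [u|] //= /forallP st /forallP tu; apply/forallP=> i.
by move: (st i) (tu i); case: (s i) (t i) (u i) => [[]|] [[]|] [[]|].
Qed.
Fact octahedron_display : Order.disp_t. Proof. exact: Order.Disp tt tt. Qed.
HB.instance Definition _ := Order.Le_isPOrder.Build octahedron_display octahedron
  octahedron_le_refl octahedron_le_anti octahedron_le_trans.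

Section HexagonalTessellation.
Local Open Scope ring_scope.

(* (k, l) stands for the vector k + l zeta of the hexagonal lattice, where
   zeta is a primitive sixth root of unity, so that zeta ^+ 2 = zeta - 1. *)
Definition hexlattice := (int * int)%type.
Definition rot60 (v : hexlattice) : hexlattice := (- v.2, v.1 + v.2).
Definition zeta (k : nat) : hexlattice := iter k rot60 (1, 0).

(* The hexagonal tessellation with one hexagon centred at each lattice point.
   An edge is named by one of the two hexagons containing it and a direction,
   a vertex by one of the three hexagons containing it and a direction. *)
Inductive hexface :=
  | HexLeast
  | HexVertex of bool & hexlattice
  | HexEdge of 'I_3 & hexlattice
  | Hexagon of hexlattice
  | HexGreatest.

Definition hexface_enc (x : hexface) :
    bool + (bool * hexlattice + ('I_3 * hexlattice + hexlattice)) :=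
  match x with
  | HexLeast => inl false
  | HexVertex u a => inr (inl (u, a))
  | HexEdge k a => inr (inr (inl (k, a)))
  | Hexagon a => inr (inr (inr a))
  | HexGreatest => inl true
  end.
Definition hexface_dec
    (x : bool + (bool * hexlattice + ('I_3 * hexlattice + hexlattice))) :=
  match x with
  | inl u => if u then HexGreatest else HexLeast
  | inr (inl (u, a)) => HexVertex u a
  | inr (inr (inl (k, a))) => HexEdge k a
  | inr (inr (inr a)) => Hexagon a
  end.
Fact hexface_encK : cancel hexface_enc hexface_dec. Proof. by case. Qed.
HB.instance Definition _ := Countable.copy hexface (can_type hexface_encK).

(* The centres of the hexagons containing a face other than HexLeast; they
   determine the face, and incidence is reverse inclusion. *)
Definition hexagons_at (x : hexface) : seq hexlattice :=
  match x with
  | HexVertex u a => [:: a; a + zeta u; a + zeta u.+1]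
  | HexEdge k a => [:: a; a + zeta k]
  | Hexagon a => [:: a]
  | HexLeast | HexGreatest => [::]
  end.

Definition hexface_le (x y : hexface) :=
  (x == HexLeast) ||
  (y != HexLeast) && all [in hexagons_at x] (hexagons_at y).

Definition hex_translate (t : hexlattice) (x : hexface) :=
  match x with
  | HexVertex u a => HexVertex u (t + a)
  | HexEdge k a => HexEdge k (t + a)
  | Hexagon a => Hexagon (t + a)
  | HexLeast | HexGreatest => x
  end.

Definition hexrk (x : hexface) : nat :=
  match x with
  | HexLeast => 0 | HexVertex _ _ => 1 | HexEdge _ _ => 2
  | Hexagon _ => 3 | HexGreatest => 4
  end%N.

Lemma hexface_le_refl : reflexive hexface_le.
Proof. by move=> x; rewrite /hexface_le; case: eqP => //= _; apply/allP. Qed.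

Lemma hexface_le_trans : transitive hexface_le.
Proof.
move=> y x z; rewrite /hexface_le; case: (x == _) => //=.
move=> /andP[/negPf-> /allP xy] /= /andP[-> /allP yz] /=.
by apply/allP=> a /yz/xy.
Qed.

Lemma ord3_case (Q : 'I_3 -> Prop) :
  Q ord0 -> Q (inord 1) -> Q (inord 2) -> forall k, Q k.
Proof.
move=> Q0 Q1 Q2 [[|[|[|//]]] lt_k3].
- by rewrite (_ : Ordinal _ = ord0) //; apply/val_inj.
- by rewrite (_ : Ordinal _ = inord 1) //; apply/val_inj; rewrite /= inordK.
- by rewrite (_ : Ordinal _ = inord 2) //; apply/val_inj; rewrite /= inordK.
Qed.

Lemma addpE (a b c e : int) : (a, b) + (c, e) = (a + c, b + e) :> hexlattice.
Proof. by []. Qed.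

Lemma hexface_le_rk x y : hexface_le x y -> (hexrk x <= hexrk y)%N.
Proof.
case: x y => [|u [a a']|k [a a']|[a a']|] [|v [e e']|l [e e']|[e e']|] //=;
  rewrite /hexface_le /= ?andbF //;
  do ?[elim/ord3_case: k]; do ?[elim/ord3_case: l]; do ?[case: u]; do ?[case: v];
  rewrite /zeta /rot60 /= ?inordK //= ?addpE !inE ?xpair_eqE; lia.
Qed.

Lemma hexface_le_eq x y : hexface_le x y -> (hexrk y <= hexrk x)%N -> x = y.
Proof.
case: x y => [|u [a a']|k [a a']|[a a']|] [|v [e e']|l [e e']|[e e']|] //=;
  rewrite /hexface_le /= ?andbF //;
  do ?[elim/ord3_case: k]; do ?[elim/ord3_case: l]; do ?[case: u]; do ?[case: v];
  rewrite /zeta /rot60 /= ?inordK //= ?addpE !inE ?xpair_eqE => H _;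
  try (by exfalso; lia);
  by (have -> : a = e by lia); (have -> : a' = e' by lia).
Qed.

Lemma hexrk_translate t x : hexrk (hex_translate t x) = hexrk x.
Proof. by case: x. Qed.

Lemma hexagons_at_translate t x :
  hexagons_at (hex_translate t x) = [seq t + a | a <- hexagons_at x].
Proof. by case: x => //= *; rewrite !addrA. Qed.

Lemma hexface_le_translate t x y :
  hexface_le x y -> hexface_le (hex_translate t x) (hex_translate t y).
Proof.
have eqT z : (hex_translate t z == HexLeast) = (z == HexLeast) by case: z.
rewrite /hexface_le !eqT !hexagons_at_translate; case: (_ == _) => //=.
case/andP=> -> /= /allP xy; apply/allP=> _ /mapP[a /xy xa ->].
exact: map_f.
Qed.

Lemma hex_translate0 x : hex_translate 0 x = x.
Proof. by case: x => //= *; rewrite add0r. Qed.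

Lemma hex_translateD s t x :
  hex_translate (s + t) x = hex_translate s (hex_translate t x).
Proof. by case: x => //= *; rewrite addrA. Qed.

(* The lattice generated by b + c zeta and its image under the rotation by 60
   degrees about the origin. *)
Definition translation_lattice (b c : int) (t : hexlattice) :=
  exists k l : int, t = (b, c) *~ k + rot60 (b, c) *~ l.

Definition hex_equiv (b c : int) : rel hexface := fun x y =>
  `[< exists2 t, translation_lattice b c t & y = hex_translate t x >].

Lemma hex_equiv_refl b c : reflexive (hex_equiv b c).
Proof.
by move=> x; apply/asboolP; exists 0; [exists 0, 0 | rewrite hex_translate0].
Qed.

Lemma hex_equiv_sym b c : symmetric (hex_equiv b c).
Proof.
suff imp x y : hex_equiv b c x y -> hex_equiv b c y x.
  by move=> x y; apply/idP/idP; apply: imp.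
move=> /asboolP[t [k [l tE]] ->]; apply/asboolP; exists (- t).
  by exists (- k), (- l); rewrite !mulrNz -opprD -tE.
by rewrite -hex_translateD addNr hex_translate0.
Qed.

Lemma hex_equiv_trans b c : transitive (hex_equiv b c).
Proof.
move=> y x z /asboolP[t [k [l tE]] ->] /asboolP[t' [k' [l' tE']] ->].
apply/asboolP; exists (t' + t); last by rewrite hex_translateD.
by exists (k' + k), (l' + l); rewrite !mulrzDr tE tE' addrACA.
Qed.

Definition hex_eqrel b c :=
  EquivRel (hex_equiv b c) (@hex_equiv_refl b c) (@hex_equiv_sym b c)
           (@hex_equiv_trans b c).

(* The toroidal map {6,3}_(b,c), as the poset of orbits of faces of the
   tessellation; orbits are compared through their representatives. *)
Definition torus63 (b c : int) := {eq_quot (hex_eqrel b c)}.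
HB.instance Definition _ b c := Choice.on (torus63 b c).

Definition torus63_le b c (A B : torus63 b c) :=
  `[< exists x y, [/\ \pi_(torus63 b c) x = A, \pi_(torus63 b c) y = B
                    & hexface_le x y] >].

Lemma torus63_piP b c x y :
  \pi_(torus63 b c) x = \pi y -> exists t, y = hex_translate t x.
Proof. by move/eqmodP/asboolP=> [t _ ->]; exists t. Qed.

Fact torus63_le_refl b c : reflexive (@torus63_le b c).
Proof.
move=> A; apply/asboolP; exists (repr A), (repr A).
by split; rewrite ?reprK //; apply: hexface_le_refl.
Qed.

Fact torus63_le_anti b c : antisymmetric (@torus63_le b c).
Proof.
move=> A B /andP[/asboolP[x [y [<- <- xy]]] /asboolP[y' [x' []]]].
move=> /esym/torus63_piP[t ->] /esym/torus63_piP[t' ->] /hexface_le_rk.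
by rewrite !hexrk_translate => /(hexface_le_eq xy) ->.
Qed.

Fact torus63_le_trans b c : transitive (@torus63_le b c).
Proof.
move=> B A C /asboolP[x [y [<- <- xy]]] /asboolP[y' [z [yy' <- yz]]].
have /eqmodP/asboolP[t tL y'E] := esym yy'.
apply/asboolP; exists (hex_translate t x), z; split=> //.
  by apply/esym/eqmodP/asboolP; exists t.
by apply: hexface_le_trans yz; rewrite y'E; apply: hexface_le_translate.
Qed.

Fact torus63_display : Order.disp_t. Proof. exact: Order.Disp tt tt. Qed.
HB.instance Definition _ b c :=
  Order.Le_isPOrder.Build torus63_display (torus63 b c)
    (@torus63_le_refl b c) (@torus63_le_anti b c) (@torus63_le_trans b c).

End HexagonalTessellation.

Section ProjectiveSpecialLinear.
Variable p : nat.

Definition SL2 : {set {'GL_2(p)}} := [set u : {'GL_2(p)} | (\det u == 1)%R].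

Lemma SL2_group_set : group_set SL2.
Proof.
apply/group_setP; split=> [|u v]; rewrite !inE ?det1 //.
by rewrite det_mulmx => /eqP-> /eqP->; rewrite mulr1.
Qed.
Canonical SL2_group := Group SL2_group_set.

Definition L2 := (SL2 / 'Z(SL2))%G.
End ProjectiveSpecialLinear.

(* Main.v *)
(* A polytope of rank n is encoded by its flags: a set of points with involutions
   r_1, ..., r_n, where r_j exchanges the face f_j of rank j - 1, and words in the
   r_j act on the points. Two polytopes are isomorphic as soon as two of their
   flags have the same stabilisers in the group of words, and the flag orbits of
   the automorphism group are the classes of flags with equal stabilisers.

   The rotations of the hyperbolic honeycomb {6,3,4} act on the projective line
   over F_p through x |-> z x, x |-> 1 - x and x |-> 1 / (2 x), where
   z = - b / c is a primitive sixth root of unity; the last two lie in L_2(p)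
   because -1 and -2 are squares. The polytope P is the mix of this action with Q:
   its flags are L_2(p) x flags(Q), where r_j multiplies the first component by a
   fixed element or by its inverse, according to the parity of the flag of Q.
   Simplicity of L_2(p) and the order hypothesis make it connected (Goursat).
   The octahedral vertex-figure group of Q acts faithfully, so P -> Q is bijective
   on vertex-figures, which gives the intersection property of P. The translations
   of the facets of P are those t in m Z[zeta] killed by zeta |-> z, that is
   by Z[zeta] / (b + c zeta) = F_p, whence the two types. P is chiral
   because the reflected translation b + c zeta^-1 does not vanish in F_p. *)
Require Import Defs.
From HB Require Import structures.
From mathcomp Require Import all_boot all_order all_algebra all_fingroup all_solvable finfield.
From mathcomp Require Import generic_quotient boolp zify ring.

Set Implicit Arguments.
Unset Strict Implicit.
Unset Printing Implicit Defensive.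

Import Order.TTheory GRing.Theory.

(** Points may be infinitely many and may repeat a flag: a toroidal map is handled through all flags
    of the plane tessellation, and only the comparison of faces sees the lattice. Only the cases of
    the intersection property that keep a vertex fixed need an argument; the others follow from the
    commutation of distant involutions. With the vertex fixed, a word acting trivially on Q is
    trivial in the Coxeter group of type B3, hence in every system satisfying the B3 relations, in
    particular on L_2(p). This is how faithfulness of the octahedral group is used. The congruence
    modulo 8 gives an e with e^4 = -1, which yields square roots of -1 and of -2 at once. Simplicity
    of L_2(p) is proved with explicit commutators, which need 2 and 15 to be invertible. Chirality
    is delicate when p divides m: every translation in the lattice of the facets of Q then vanishes
    in F_p together with its mirror image, so the facets show nothing and a distinguishing word has
    to involve r_4. This is why a commutator is taken. *)

(** * Polytopes presented by systems of flags *)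

Definition act (X : Type) (r : nat -> X -> X) (w : seq nat) (x : X) := foldr r x w.

Lemma act_cat (X : Type) (r : nat -> X -> X) w1 w2 x :
  act r (w1 ++ w2) x = act r w1 (act r w2 x).
Proof. exact: foldr_cat. Qed.

Definition letters (n : nat) (K : pred nat) : pred nat :=
  fun j => [&& 0 < j, j <= n & ~~ K j].

Definition word n := all (letters n pred0).

Lemma letters_sub n (K K' : pred nat) j :
  subpred K' K -> letters n K j -> letters n K' j.
Proof.
by move=> sK /and3P[j0 jn nK]; apply/and3P; split=> //; apply: contraNN nK; apply: sK.
Qed.

Lemma letters_word n K w : all (letters n K) w -> word n w.
Proof. by apply: sub_all => j; apply: letters_sub. Qed.

(** Faces are numbered from 0 (least) to [n.+1] (greatest), so index k means rank k - 1. The set [K]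
    in [rep_conn] holds the indices kept fixed, as in strong flag-connectedness. Two points with the
    same faces stand for one flag, so flags are compared by their faces and not as points. Words act
    from their last letter. *)
Record flagrep (d : Order.disp_t) (P : porderType d) (n : nat) (X : Type)
    (S : X -> Prop) (r : nat -> X -> X) (f : nat -> X -> P) : Prop := FlagRep {
  rep_ex : exists x, S x;
  rep_S : forall j x, 0 < j <= n -> S x -> S (r j x);
  rep_inv : forall j x, 0 < j <= n -> S x -> r j (r j x) = x;
  rep_fix : forall j k x, 0 < j <= n -> k <= n.+1 -> k != j -> S x ->
    f k (r j x) = f k x;
  rep_mov : forall j x, 0 < j <= n -> S x -> f j (r j x) <> f j x;
  rep_conn : forall (K : pred nat) x y, S x -> S y ->
    (forall k, 0 < k <= n -> K k -> f k x = f k y) ->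
    exists2 w, all (letters n K) w &
      forall k, k <= n.+1 -> f k (act r w x) = f k y;
  rep_splice : forall k x y, k <= n.+1 -> S x -> S y -> f k x = f k y ->
    exists z, [/\ S z, forall l, l <= k -> f l z = f l x
                & forall l, k <= l <= n.+1 -> f l z = f l y];
  rep_surj : forall p, exists k x, [/\ k <= n.+1, S x & f k x = p];
  rep_le : forall k l x, k <= l <= n.+1 -> S x -> (f k x <= f l x)%O;
  rep_le_inv : forall k l x y, k <= n.+1 -> l <= n.+1 -> S x -> S y ->
    (f k x <= f l y)%O ->
    k <= l /\ exists z, [/\ S z, f k z = f k x & f l z = f l y] }.

Section Rep.
Variables (d : Order.disp_t) (P : porderType d) (n : nat) (X : Type).
Variables (S : X -> Prop) (r : nat -> X -> X) (f : nat -> X -> P).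

Definition eqf x y := forall k, k <= n.+1 -> f k x = f k y.

Lemma eqf_sym x y : eqf x y -> eqf y x.
Proof. by move=> e k kn; rewrite e. Qed.

Lemma eqf_trans y x z : eqf x y -> eqf y z -> eqf x z.
Proof. by move=> e e' k kn; rewrite e ?e'. Qed.

Hypothesis R : flagrep n S r f.

Lemma rep_actS w x : word n w -> S x -> S (act r w x).
Proof.
elim: w => //= j w IH /andP[/and3P[j0 jn _] ww] Sx.
by apply: (rep_S R); rewrite ?j0 //; apply: IH.
Qed.

Lemma rep_act_fix K w x k : all (letters n K) w -> k <= n.+1 ->
  ~~ letters n K k -> S x -> f k (act r w x) = f k x.
Proof.
move=> aw kn nk Sx; elim: w aw => //= j w IH /andP[lj lw].
have [j0 jn _] := and3P lj.
rewrite (rep_fix R) ?j0 ?IH //; first by apply: contraNneq nk => ->.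
by apply: rep_actS => //; apply: letters_word lw.
Qed.

Lemma rep_act_rev w x : word n w -> S x -> act r (rev w) (act r w x) = x.
Proof.
elim: w x => //= j w IH x /andP[/and3P[j0 jn _] ww] Sx.
rewrite rev_cons -cats1 act_cat /= (rep_inv R) ?j0 ?IH //.
exact: rep_actS.
Qed.

Lemma rep_act_rev' w x : word n w -> S x -> act r w (act r (rev w) x) = x.
Proof.
move=> ww Sx; rewrite -{1}(revK w) rep_act_rev //.
by rewrite /word all_rev.
Qed.

Lemma rep_bot x y : S x -> S y -> f 0 x = f 0 y.
Proof.
move=> Sx Sy; have [//|w aw e] := rep_conn R (K := pred0) Sx Sy _.
by rewrite -e // (rep_act_fix aw).
Qed.

Lemma rep_top x y : S x -> S y -> f n.+1 x = f n.+1 y.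
Proof.
move=> Sx Sy; have [//|w aw e] := rep_conn R (K := pred0) Sx Sy _.
by rewrite -e // (rep_act_fix aw) //; rewrite /letters ltnn.
Qed.

Lemma rep_power j w x : 0 < j <= n -> all (pred1 j) w -> S x ->
  act r w x = x \/ act r w x = r j x.
Proof.
move=> jn; elim: w => [|i w IH] /=; first by left.
move=> /andP[/eqP-> aw] Sx; case: (IH aw Sx) => ->; first by right.
by left; apply: (rep_inv R).
Qed.

(** By [rep_conn] the two flags are joined by a word in the single letter j, and the powers of an
    involution leave only two candidates. This is the criterion by which flags are identified
    below. *)
Lemma rep_rchar j x y : 0 < j <= n -> S x -> S y ->
  (forall k, k <= n.+1 -> k != j -> f k x = f k y) -> f j x <> f j y ->
  eqf (r j x) y.
Proof.
move=> jn Sx Sy e ne.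
have [k kn kj|w aw ew] := rep_conn R (K := predC1 j) Sx Sy _.
  by apply: e => //; lia.
have aw' : all (pred1 j) w.
  by apply: sub_all aw => i /and3P[_ _ /=]; rewrite negbK.
case: (rep_power jn aw' Sx) ew => -> // ew.
by case: ne; apply: ew; lia.
Qed.

Lemma rep_ext j x y : 0 < j <= n -> S x -> S y -> eqf x y ->
  eqf (r j x) (r j y).
Proof.
move=> jn Sx Sy e; apply: rep_rchar => //; first exact: (rep_S R).
  by move=> k kn kj; rewrite (rep_fix R) ?e.
by rewrite e; [apply: nesym; apply: (rep_mov R) | lia].
Qed.

Lemma rep_ext_act w x y : word n w -> S x -> S y -> eqf x y ->
  eqf (act r w x) (act r w y).
Proof.
move=> ww Sx Sy e; elim: w ww => //= j w IH /andP[/and3P[j0 jn _] ww].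
by apply: rep_ext; rewrite ?j0 //; [apply: rep_actS|apply: rep_actS|apply: IH].
Qed.

Lemma rep_reach x y : S x -> S y -> exists2 w, word n w & eqf (act r w x) y.
Proof. by move=> Sx Sy; apply: (rep_conn R). Qed.

Lemma rep_rank_inj k l x y : k <= n.+1 -> l <= n.+1 -> S x -> S y ->
  f k x = f l y -> k = l.
Proof.
move=> kn ln Sx Sy e.
have [|kl _] := rep_le_inv R kn ln Sx Sy; first by rewrite e.
have [|lk _] := rep_le_inv R ln kn Sy Sx; first by rewrite e.
by apply/eqP; rewrite eqn_leq kl lk.
Qed.

Lemma rep_lt k l x : k < l <= n.+1 -> S x -> (f k x < f l x)%O.
Proof.
move=> kl Sx; rewrite lt_neqAle (rep_le R) ?andbT //; last by lia.
by apply/eqP => e; have := rep_rank_inj _ _ Sx Sx e; lia.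
Qed.

(** A chain is completed upwards: a flag that matches [C] up to index m is spliced, at the highest
    face of [C] it contains, with a flag through that face and the face of [C] of index m + 1. *)
Lemma rep_chain (C : P -> Prop) :
  (forall p q, C p -> C q -> (p <= q)%O \/ (q <= p)%O) ->
  exists2 z, S z & forall k y, k <= n.+1 -> S y -> C (f k y) -> f k z = f k y.
Proof.
move=> cC.
suff H m : m <= n.+1 -> exists2 z, S z &
    forall k y, k <= m -> S y -> C (f k y) -> f k z = f k y.
  by have [//|z Sz Hz] := H n.+1; exists z.
elim: m => [_|m IH mn].
  have [z Sz] := rep_ex R; exists z => // k y; rewrite leqn0 => /eqP-> Sy _.
  exact: rep_bot.
have [|z Sz Hz] := IH; first by lia.
have [[y Sy Cy]|no] := EM (exists2 y, S y & C (f m.+1 y)); last first.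
  exists z => // k y; rewrite leq_eqVlt => /orP[/eqP-> Sy Cy|]; last exact: Hz.
  by case: no; exists y.
(* If [C] has no face of index at most m, the splice is made at the least face; hence the
   alternative [k = 0]. *)
have exk : exists k, (k <= m) && `[< k = 0 \/ C (f k z) >].
  by exists 0; apply/andP; split=> //; apply/asboolP; left.
have ubk i : (i <= m) && `[< i = 0 \/ C (f i z) >] -> i <= m by case/andP.
have [k /andP[km /asboolP kC] kmax] := ex_maxnP exk ubk.
have kmax' l u : l <= m -> S u -> C (f l u) -> l <= k.
  move=> lm Su Cu; apply: kmax; rewrite lm; apply/asboolP; right.
  by rewrite (Hz l u).
have le1 : (f k z <= f m.+1 y)%O.
  case: kC => [->|kC].
    by rewrite (rep_bot Sz Sy) (rep_le R) //; lia.
  case: (cC _ _ kC Cy) => // /(rep_le_inv R _ _ Sy Sz)[] //; lia.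
have [||_ [u [Su uk um]]] := rep_le_inv R _ _ Sz Sy le1; [lia..|].
have [|z' [Sz' lz uz]] := rep_splice R _ Sz Su (esym uk); first by lia.
exists z' => // l v lm Sv Cv; have [lk|kl] := leqP l k.
  by rewrite lz // (Hz l v) //; lia.
have lE : l = m.+1.
  apply/eqP; rewrite eqn_leq lm ltnNge; apply/negP => lm'.
  by move: (kmax' _ _ lm' Sv Cv); lia.
rewrite lE in Cv *; rewrite uz ?um; last by lia.
by case: (cC _ _ Cy Cv) => /(rep_le_inv R mn mn)[] // _ [t [_ <- <-]].
Qed.

(** Splicing [r i x] with [r j x] at index i + 1 gives a flag in which both faces are changed; each
    of the two products is that flag. *)
Lemma rep_comm i j x : 0 < i -> i.+1 < j -> j <= n -> S x ->
  eqf (r i (r j x)) (r j (r i x)).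
Proof.
move=> i0 ij jn Sx.
have iP : 0 < i <= n by lia.
have jP : 0 < j <= n by lia.
have Si := rep_S R iP Sx; have Sj := rep_S R jP Sx.
have [||z [Sz zl zu]] := rep_splice R _ Si Sj (k := i.+1); first by lia.
  by rewrite !(rep_fix R) //; lia.
have e1 : eqf (r i (r j x)) z.
  apply: rep_rchar => // [k kn ki|].
    have [ki'|ki'] := leqP i.+1 k; first by rewrite zu //; lia.
    by rewrite zl ?(rep_fix R) //; lia.
  rewrite zl // (rep_fix R) //; [exact/nesym/(rep_mov R)|lia|lia].
have e2 : eqf (r j (r i x)) z.
  apply: rep_rchar => // [k kn ki|].
    have [ki'|ki'] := leqP k i.+1; first by rewrite zl //; lia.
    by rewrite zu ?(rep_fix R) //; lia.
  rewrite zu; last by lia.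
  by rewrite (rep_fix R) //; [exact/nesym/(rep_mov R)|lia|lia].
by move=> k kn; rewrite e1 ?e2.
Qed.

Definition stab x w := eqf (act r w x) x.

Lemma rep_pos x p : S x -> exists k w, [/\ k <= n.+1, word n w & f k (act r w x) = p].
Proof.
move=> Sx; have [k [y [kn Sy <-]]] := rep_surj R p.
by have [w ww e] := rep_reach Sx Sy; exists k, w; rewrite e.
Qed.

End Rep.

(** * Isomorphisms from equal stabilisers *)

Section Iso.
Variables (d1 d2 : Order.disp_t) (P1 : porderType d1) (P2 : porderType d2) (n : nat).
Variables (X1 X2 : Type) (S1 : X1 -> Prop) (S2 : X2 -> Prop).
Variables (r1 : nat -> X1 -> X1) (r2 : nat -> X2 -> X2).
Variables (f1 : nat -> X1 -> P1) (f2 : nat -> X2 -> P2).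
Hypotheses (R1 : flagrep n S1 r1 f1) (R2 : flagrep n S2 r2 f2).

Section Transport.
Variable g : P1 -> P2.
Hypothesis gmono : {mono g : x y / (x <= y)%O}.

Definition corr x y := forall k, k <= n.+1 -> g (f1 k x) = f2 k y.

(** Surjectivity of [g] is not assumed. The image of a flag is a chain, hence lies in a flag z; the
    induced map on indices is strictly increasing from 0, ..., n + 1 to itself, so it is the
    identity and z is the image. *)
Lemma rep_iso_flag x : S1 x -> exists2 y, S2 y & corr x y.
Proof.
move=> Sx.
have ginj := inc_inj gmono.
pose C q := exists2 k, k <= n.+1 & q = g (f1 k x).
have [p q [k kn ->] [l ln ->]|z Sz Hz] := rep_chain R2 (C := C).
  rewrite !gmono; case: (leqP k l) => kl; [left|right]; apply: (rep_le R1) => //; lia.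
exists z => //.
pose rk k k' := k' <= n.+1 /\ exists2 y, S2 y & g (f1 k x) = f2 k' y.
have rk_ex k : k <= n.+1 -> exists k', rk k k'.
  by move=> kn; have [k' [y [? ? ?]]] := rep_surj R2 (g (f1 k x)); exists k'; split=> //; exists y.
have rk_lt k l k' l' : k < l <= n.+1 -> rk k k' -> rk l l' -> k' < l'.
  move=> kl [kn' [y Sy ey]] [ln' [u Su eu]].
  have := rep_lt R1 kl Sx; rewrite lt_neqAle -(inj_eq ginj) -gmono ey eu.
  move=> /andP[ne le]; have [kl' [t [_ tk tl]]] := rep_le_inv R2 kn' ln' Sy Su le.
  rewrite ltn_neqAle kl' andbT; apply: contraNneq ne => e.
  by rewrite -tk -tl e.
(* Counting from the least face gives k <= k', counting from the greatest one gives k' <= k. *)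
have lb k k' : k <= n.+1 -> rk k k' -> k <= k'.
  elim: k k' => // k IH k' kn Rk.
  have [|k0 Rk0] := rk_ex k; first by lia.
  have := rk_lt _ _ _ _ _ Rk0 Rk; have := IH _ _ Rk0; lia.
have ub i k k' : k + i = n.+1 -> rk k k' -> k' + i <= n.+1.
  elim: i k k' => [|i IH] k k' ki Rk; first by case: Rk; lia.
  have [|k0 Rk0] := rk_ex k.+1; first by lia.
  have := rk_lt _ _ _ _ _ Rk Rk0; have := IH _ _ _ Rk0; lia.
move=> k kn; have [k' Rk] := rk_ex k kn.
have e : k' = k by have := lb _ _ kn Rk; have := ub (n.+1 - k) _ _ _ Rk; lia.
move: Rk; rewrite e => -[_ [y Sy ey]]; rewrite ey; apply/esym/Hz => //.
by exists k.
Qed.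

Lemma rep_iso_act w x y : word n w -> S1 x -> S2 y -> corr x y ->
  corr (act r1 w x) (act r2 w y).
Proof.
move=> ww Sx Sy c; elim: w ww => //= j w IH /andP[/and3P[j0 jn _] ww].
have jP : 0 < j <= n by rewrite j0.
have Sx' := rep_actS R1 ww Sx; have Sy' := rep_actS R2 ww Sy.
have [y' Sy1 c'] := rep_iso_flag (rep_S R1 jP Sx').
move=> k kn; rewrite c' //; apply/esym; move: k kn.
apply: (rep_rchar R2 jP Sy' Sy1) => [k kn kj|].
  by rewrite -c' // (rep_fix R1) // IH.
rewrite -c' ?(IH ww j) -?IH //; [|lia..] .
by move/(inc_inj gmono)/esym; apply: (rep_mov R1).
Qed.

Lemma corr_stab w x y : word n w -> S1 x -> S2 y -> corr x y ->
  stab n r1 f1 x w <-> stab n r2 f2 y w.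
Proof.
move=> ww Sx Sy c; have c' := rep_iso_act ww Sx Sy c.
split=> st k kn; first by rewrite -c' // st // c.
by apply: (inc_inj gmono); rewrite c' // st // c.
Qed.

End Transport.

Section Build.
Variables (x1 : X1) (x2 : X2).
Hypotheses (Sx1 : S1 x1) (Sx2 : S2 x2).
Hypothesis same_stab : forall w, word n w -> stab n r1 f1 x1 w -> stab n r2 f2 x2 w.

(** The words w and w' lead to the same flag exactly when [rev w ++ w'] fixes the base flag, a
    condition that is transported. So the base flags determine a map on flags. *)
Lemma same_stab_act w w' : word n w -> word n w' ->
  eqf n f1 (act r1 w x1) (act r1 w' x1) -> eqf n f2 (act r2 w x2) (act r2 w' x2).
Proof.
move=> ww ww' e.
have wr : word n (rev w) by rewrite /word all_rev.
have Sw := rep_actS R1 ww Sx1; have Sw' := rep_actS R1 ww' Sx1.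
have Tw := rep_actS R2 ww Sx2; have Tw' := rep_actS R2 ww' Sx2.
have /same_stab st : stab n r1 f1 x1 (rev w ++ w').
  rewrite /stab act_cat; apply: eqf_sym.
  by have := rep_ext_act R1 wr Sw Sw' e; rewrite (rep_act_rev R1).
have {}st : stab n r2 f2 x2 (rev w ++ w') by apply: st; rewrite /word all_cat -!/(word n _) wr.
move: st; rewrite /stab act_cat => st.
have := rep_ext_act R2 ww (rep_actS R2 wr Tw') Sx2 st.
by rewrite (rep_act_rev' R2) //; apply: eqf_sym.
Qed.

(** Comparable faces share a flag, reached from the first flag by a word avoiding k and left towards
    the second one by a word avoiding l. The same words, carried out in [P2], exhibit a common flag
    there. *)
Lemma same_stab_le k l w w' : k <= n.+1 -> l <= n.+1 -> word n w -> word n w' ->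
  (f1 k (act r1 w x1) <= f1 l (act r1 w' x1))%O ->
  (f2 k (act r2 w x2) <= f2 l (act r2 w' x2))%O.
Proof.
move=> kn ln ww ww' le.
have Sw := rep_actS R1 ww Sx1; have Sw' := rep_actS R1 ww' Sx1.
have Tw := rep_actS R2 ww Sx2; have Tw' := rep_actS R2 ww' Sx2.
have [kl [z [Sz zk zl]]] := rep_le_inv R1 kn ln Sw Sw' le.
have [i _ /eqP->|u au eu] := rep_conn R1 (K := pred1 k) Sw Sz _; first by rewrite zk.
have [i _ /eqP->|v av ev] := rep_conn R1 (K := pred1 l) Sz Sw' _; first by rewrite zl.
have wu := letters_word au; have wv := letters_word av.
have wvuw : word n (v ++ u ++ w) by rewrite /word !all_cat -!/(word n _) wu wv.
have /(same_stab_act wvuw ww') e : eqf n f1 (act r1 (v ++ u ++ w) x1) (act r1 w' x1).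
  rewrite !act_cat; apply: eqf_trans ev; apply: (rep_ext_act R1) => //.
  by rewrite -act_cat; apply: rep_actS R1 _ _ _ Sx1; rewrite /word all_cat -!/(word n _) wu.
rewrite -e // !act_cat.
have Tuw := rep_actS R2 wu Tw.
rewrite (rep_act_fix R2 av) //; last by rewrite /letters /= eqxx !andbF.
rewrite -(rep_act_fix R2 au kn _ Tw); last by rewrite /letters /= eqxx !andbF.
by apply: (rep_le R2) => //; lia.
Qed.
End Build.

End Iso.

Section BuildIso.
Variables (d1 d2 : Order.disp_t) (P1 : porderType d1) (P2 : porderType d2) (n : nat).
Variables (X1 X2 : Type) (S1 : X1 -> Prop) (S2 : X2 -> Prop).
Variables (r1 : nat -> X1 -> X1) (r2 : nat -> X2 -> X2).
Variables (f1 : nat -> X1 -> P1) (f2 : nat -> X2 -> P2).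

Lemma same_stab_mono x1 x2 :
  flagrep n S1 r1 f1 -> flagrep n S2 r2 f2 -> S1 x1 -> S2 x2 ->
  (forall w, word n w -> stab n r1 f1 x1 w <-> stab n r2 f2 x2 w) ->
  exists2 g : P1 -> P2, {mono g : x y / (x <= y)%O} &
    forall w k, word n w -> k <= n.+1 ->
      g (f1 k (act r1 w x1)) = f2 k (act r2 w x2).
Proof.
move=> R1 R2 Sx1 Sx2 st.
have le1 := same_stab_le R1 R2 Sx1 Sx2 (fun w ww => (st w ww).1).
have le2 := same_stab_le R2 R1 Sx2 Sx1 (fun w ww => (st w ww).2).
(* A face is addressed by an index and a word; by [le1] and antisymmetry the image does not depend
   on the address chosen. *)
have ex p : {kw : nat * seq nat |
    [/\ kw.1 <= n.+1, word n kw.2 & f1 kw.1 (act r1 kw.2 x1) = p]}.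
  by apply: cid; have [k [w H]] := rep_pos R1 p Sx1; exists (k, w).
pose g p := f2 (sval (ex p)).1 (act r2 (sval (ex p)).2 x2).
have gE w k : word n w -> k <= n.+1 -> g (f1 k (act r1 w x1)) = f2 k (act r2 w x2).
  rewrite /g; case: (ex _) => -[l u] /= [ln wu e] ww kn.
  by apply: le_anti; rewrite !le1 ?e.
exists g => // p q.
have [k [w [kn ww <-]]] := rep_pos R1 p Sx1.
have [l [u [ln wu <-]]] := rep_pos R1 q Sx1.
by rewrite !gE //; apply/idP/idP => ?; [apply: le2|apply: le1].
Qed.

End BuildIso.

Lemma same_stab_iso (d1 d2 : Order.disp_t) (P1 : porderType d1) (P2 : porderType d2)
    n (X1 X2 : Type) (S1 : X1 -> Prop) (S2 : X2 -> Prop) r1 r2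
    (f1 : nat -> X1 -> P1) (f2 : nat -> X2 -> P2) x1 x2 :
  flagrep n S1 r1 f1 -> flagrep n S2 r2 f2 -> S1 x1 -> S2 x2 ->
  (forall w, word n w -> stab n r1 f1 x1 w <-> stab n r2 f2 x2 w) ->
  exists g : P1 -> P2, [/\ bijective g, {mono g : x y / (x <= y)%O} & corr n f1 f2 g x1 x2].
Proof.
move=> R1 R2 Sx1 Sx2 st.
have [g gm gE] := same_stab_mono R1 R2 Sx1 Sx2 st.
have [h hm hE] := same_stab_mono R2 R1 Sx2 Sx1 (fun w ww => iff_sym (st w ww)).
exists g; split=> //; last by move=> k kn; apply: (gE [::]).
exists h => p.
  by have [k [w [kn ww <-]]] := rep_pos R1 p Sx1; rewrite gE ?hE.
by have [k [w [kn ww <-]]] := rep_pos R2 p Sx2; rewrite hE ?gE.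
Qed.

(** * Ranks, flag orbits and automorphisms of a finite represented poset *)

Section FinRep.
Variables (d : Order.disp_t) (P : finPOrderType d) (n : nat) (X : Type).
Variables (S : X -> Prop) (r : nat -> X -> X) (f : nat -> X -> P).
Hypothesis R : flagrep n S r f.

Definition fl x : {set P} := [set f k x | k : 'I_n.+2].

Lemma mem_fl k x : k <= n.+1 -> f k x \in fl x.
Proof. by move=> kn; apply/imsetP; exists (Ordinal (kn : k < n.+2)). Qed.

Lemma flP p x : reflect (exists2 k, k <= n.+1 & p = f k x) (p \in fl x).
Proof.
apply: (iffP imsetP) => [[k _ ->]|[k kn ->]]; first by exists k => //; rewrite -ltnS.
by exists (Ordinal (kn : k < n.+2)).
Qed.

Lemma mem_fl_eq k x y : k <= n.+1 -> S x -> S y ->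
  (f k y \in fl x) = (f k y == f k x).
Proof.
move=> kn Sx Sy; apply/flP/eqP => [[l ln e]|->]; last by exists k.
by have kl := rep_rank_inj R kn ln Sy Sx e; rewrite e kl.
Qed.

Lemma fl_eq x y : S x -> S y -> fl x = fl y <-> eqf n f x y.
Proof.
move=> Sx Sy; split=> [e k kn|e].
  by apply/eqP; rewrite -mem_fl_eq // -e mem_fl.
by apply/setP=> p; apply/flP/flP => -[k kn ->]; exists k; rewrite ?e.
Qed.

Lemma card_fl_lt k x : k <= n.+2 -> S x -> #|[set f l x | l : 'I_k]| = k.
Proof.
move=> kn Sx; rewrite card_imset ?card_ord // => i j e; apply: val_inj.
by apply: (rep_rank_inj R _ _ Sx Sx e); rewrite -ltnS (leq_trans _ kn).
Qed.

Lemma card_fl x : S x -> #|fl x| = n.+2.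
Proof. exact: card_fl_lt. Qed.

Lemma chain_fl x : S x -> chain (fl x).
Proof.
move=> Sx; apply/forall_inP=> _ /flP[k kn ->]; apply/forall_inP=> _ /flP[l ln ->].
by case: (leqP k l) => kl; apply/orP; [left|right]; apply: (rep_le R) => //; lia.
Qed.

Lemma chain_sub C : chain C -> exists2 z, S z & C \subset fl z.
Proof.
move=> /forall_inP cC.
have [p q pC /(forall_inP (cC p pC))/orP //|z Sz Hz] := rep_chain R (C := fun p => p \in C).
exists z => //; apply/subsetP=> p pC; have [k [x [kn Sx e]]] := rep_surj R p.
by rewrite -e mem_fl_eq // (Hz k x) // e.
Qed.

Lemma mem_flags Phi : Phi \in flags P <-> exists2 x, S x & Phi = fl x.
Proof.
rewrite inE; split=> [/maxsetP[cP mP]|[x Sx ->]].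
  have [z Sz sub] := chain_sub cP; exists z => //.
  by apply/esym/mP => //; apply: chain_fl.
apply/maxsetP; split; first exact: chain_fl.
move=> B cB sub; have [z Sz sub'] := chain_sub cB.
have e : fl x = fl z.
  by apply/eqP; rewrite eqEcard (subset_trans sub sub') !card_fl ?leqnn.
by apply/eqP; rewrite eqEsubset sub e sub'.
Qed.

(** A chain strictly below [f k x], with that face added, lies in a flag, and a flag has only k
    faces of smaller index. *)
Lemma rank_f k x : k <= n.+1 -> S x -> Defs.rank (f k x) = (k%:Z - 1)%R.
Proof.
move=> kn Sx; rewrite /Defs.rank; congr (Posz _ - 1)%R; apply/eqP; rewrite eqn_leq.
apply/andP; split.
  apply/bigmax_leqP => C /andP[cC /forall_inP ltC].
  have [|z Sz] := @chain_sub (f k x |: C).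
    have cmp p : p \in C -> (p <= f k x)%O by move=> /ltC/ltW.
    apply/forall_inP=> p /setU1P[->|pC]; apply/forall_inP=> q /setU1P[->|qC].
    - by rewrite lexx.
    - by rewrite (cmp _ qC) orbT.
    - by rewrite (cmp _ pC).
    - exact: (forall_inP (forall_inP cC _ pC)).
  rewrite subUset sub1set mem_fl_eq // => /andP[/eqP ek sC].
  rewrite -[leqRHS](@card_fl_lt k z) //; last by lia.
  apply/subset_leq_card/subsetP=> p pC; have /flP[l ln pE] := subsetP sC _ pC.
  have lk : l < k.
    rewrite ltnNge; apply/negP=> kl; have := ltC _ pC.
    by rewrite pE ek le_gtF // (rep_le R) // kl.
  by apply/imsetP; exists (Ordinal lk).
rewrite -{1}(@card_fl_lt k x) //; last by lia.
apply: (@leq_bigmax_cond _ _ _ [set f l x | l : 'I_k]); apply/andP; split.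
  apply/forall_inP=> _ /imsetP[[i ik] _ ->]; apply/forall_inP=> _ /imsetP[[j jk] _ ->].
  apply: (forall_inP (forall_inP (chain_fl Sx) _ _)); apply: mem_fl => /=; lia.
by apply/forall_inP=> _ /imsetP[[i ik] _ ->]; apply: (rep_lt R) => //=; lia.
Qed.

Lemma fl_diff j x y : 0 < j <= n -> S x -> S y -> eqf n f (r j x) y ->
  fl x :\: fl y = [set f j x].
Proof.
move=> jn Sx Sy e; apply/setP=> p; rewrite in_set1 in_setD; apply/andP/eqP.
  move=> [npy /flP[k kn pE]]; rewrite pE; case: (eqVneq k j) => [->//|kj].
  by case/negP: npy; rewrite pE -(rep_fix R jn kn kj Sx) e // mem_fl.
move=> ->; split; last by apply: mem_fl; lia.
rewrite mem_fl_eq //; last by lia.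
rewrite -e; last by lia.
by apply/eqP=> /esym; apply: (rep_mov R).
Qed.

Lemma eqf_r j x y : 0 < j <= n -> S x -> S y -> eqf n f (r j x) y -> eqf n f (r j y) x.
Proof.
move=> jn Sx Sy e; have Sj := rep_S R jn Sx.
by have := rep_ext R jn Sy Sj (eqf_sym e); rewrite (rep_inv R).
Qed.

Lemma adjacentP x y : S x -> S y ->
  adjacent (fl x) (fl y) <-> exists2 j, 0 < j <= n & eqf n f (r j x) y.
Proof.
move=> Sx Sy; split; last first.
  move=> [j jn e]; rewrite /adjacent; apply/and4P; split.
  - by apply/mem_flags; exists x.
  - by apply/mem_flags; exists y.
  - by rewrite (fl_diff jn Sx Sy e) cards1.
  - by rewrite (fl_diff jn Sy Sx (eqf_r jn Sx Sy e)) cards1.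
case/and4P=> _ _ /cards1P[p pE] _.
have /setDP[/flP[j jn pj] npy] : p \in fl x :\: fl y by rewrite pE set11.
have oth k : k <= n.+1 -> k != j -> f k x = f k y.
  move=> kn kj; apply/eqP; rewrite -mem_fl_eq //; apply/negPn/negP=> nk.
  have : f k x \in fl x :\: fl y by rewrite inE nk mem_fl.
  rewrite pE in_set1 pj => /eqP e.
  by have := rep_rank_inj R kn jn Sx Sx e; apply/eqP.
have nej : f j x <> f j y by move=> e; move: npy; rewrite pj e mem_fl.
have j0 : 0 < j.
  by rewrite lt0n; apply/eqP => j0; apply: nej; rewrite j0; apply: (rep_bot R).
have j1 : j <= n.
  by rewrite -ltnS ltn_neqAle jn andbT; apply/eqP=> jE; apply: nej; rewrite jE; apply: (rep_top R).
by exists j; [rewrite j0 | apply: (rep_rchar R); rewrite ?j0].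
Qed.

Lemma i_adjacentP i x y : i < n -> S x -> S y ->
  i_adjacent i (fl x) (fl y) <-> eqf n f (r i.+1 x) y.
Proof.
move=> iN Sx Sy; have iP : 0 < i.+1 <= n by lia.
have rk j z : j <= n.+1 -> S z -> (Defs.rank (f j z) == i%:Z%R) = (j == i.+1).
  by move=> jn Sz; rewrite rank_f //; apply/eqP/eqP; lia.
split.
  case/andP=> /(adjacentP Sx Sy)[j jn e] /forall_inP H.
  have := H (f j x); rewrite (fl_diff jn Sx Sy e) set11 rk //; last by lia.
  by move=> /(_ isT)/eqP ji; rewrite -ji.
move=> e; apply/andP; split; first by apply/(adjacentP Sx Sy); exists i.+1.
rewrite (fl_diff iP Sx Sy e); apply/forall_inP=> _ /set1P->.
by rewrite rk //; lia.
Qed.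

Lemma fl_connect K w x : all (letters n K) w -> S x -> forall A : {set P},
  (forall p, p \in A -> exists k, [/\ k <= n.+1, p = f k x & ~~ letters n K k]) ->
  connect [rel B C | [&& adjacent B C, A \subset B & A \subset C]]
    (fl x) (fl (act r w x)).
Proof.
move=> aw Sx A HA.
have sA u : all (letters n K) u -> A \subset fl (act r u x).
  move=> au; apply/subsetP=> p /HA[k [kn -> nk]].
  by rewrite -(rep_act_fix R au) // mem_fl.
elim: w aw => [|j w IH] /= /[dup] aw; first by rewrite connect0.
move=> /andP[/and3P[j0 jn _] aw']; apply: connect_trans (IH aw') _.
apply: connect1; rewrite /= (sA _ aw') (sA (j :: w) aw) !andbT.
have Sw := rep_actS R (letters_word aw') Sx.
have jP : 0 < j <= n by rewrite j0.
by apply/(adjacentP Sw (rep_S R jP Sw)); exists j.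
Qed.

Lemma rep_polytope : polytope P n.
Proof.
have [x0 Sx0] := rep_ex R; split.
- split; [exists (f 0 x0)|exists (f n.+1 x0)] => p.
    have [k [x [kn Sx <-]]] := rep_surj R p; rewrite (rep_bot R Sx0 Sx).
    by apply: (rep_le R).
  have [k [x [kn Sx <-]]] := rep_surj R p; rewrite (rep_top R Sx0 Sx).
  by apply: (rep_le R) => //; rewrite kn /=.
- by move=> Phi /mem_flags[x Sx ->]; apply: card_fl.
- move=> Phi Psi /mem_flags[x Sx ->] /mem_flags[y Sy ->].
  (* Taking for [K] all indices where the two flags agree keeps the whole intersection fixed along
     the path. *)
  have [k kn /eqP//|w aw e] := rep_conn R (K := [pred k | f k x == f k y]) Sx Sy _.
  have <- : fl (act r w x) = fl y.
    by apply/fl_eq => //; apply: (rep_actS R) => //; apply: letters_word aw.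
  apply: (fl_connect aw Sx) => p; rewrite inE => /andP[/flP[k kn ->]].
  have -> : fl (act r w x) = fl y.
    by apply/fl_eq => //; apply: (rep_actS R) => //; apply: letters_word aw.
  rewrite mem_fl_eq // => ek; exists k; split=> //.
  by rewrite /letters /= ek !andbF.
move=> F G ltFG; have [k [x [kn Sx xF]]] := rep_surj R F.
have [l [y [ln Sy yG]]] := rep_surj R G.
have := ltW ltFG; rewrite -xF -yG => /(rep_le_inv R kn ln Sx Sy).
move=> [kl [z [Sz zk zl]]]; rewrite !rank_f // => rkE.
have lE : l = k.+2 by lia.
rewrite -zk -zl lE; rewrite {}lE in ln kl => {F G ltFG xF yG x y Sx Sy rkE zk zl l}.
have jP : 0 < k.+1 <= n by lia.
suff -> : [set x | (f k z < x < f k.+2 z)%O] = [set f k.+1 z; f k.+1 (r k.+1 z)].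
  by rewrite cards2; case: eqP => // /esym e; case: (rep_mov R jP Sz).
apply/setP=> p; rewrite in_set in_set2; apply/idP/idP; last first.
  case/orP=> /eqP->; first by rewrite !(rep_lt R) //; lia.
  have Sr := rep_S R jP Sz.
  rewrite -(rep_fix R jP kn _ Sz) ?(rep_lt R) //; [|lia|lia].
  by rewrite /= -(rep_fix R jP ln _ Sz) ?(rep_lt R) //; lia.
move=> /andP[lt1 lt2]; have [m [u [mn Su uE]]] := rep_surj R p.
rewrite -{}uE in lt1 lt2 *.
have [km [v [Sv vk vm]]] := rep_le_inv R kn mn Sz Su (ltW lt1).
have [ml [v' [Sv' vm' vl]]] := rep_le_inv R mn ln Su Sz (ltW lt2).
have mk : k != m.
  by apply: contraTneq lt1 => e; rewrite -vk -vm e ltxx.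
have mk' : k.+2 != m.
  by apply: contraTneq lt2 => e; rewrite -vm' -vl e ltxx.
have mE : m = k.+1 by lia.
rewrite {}mE in mn lt1 lt2 vm vm' km ml mk mk' *.
(* Three splices put the intermediate face into z and change nothing else; [rep_rchar] then leaves
   only the two expected faces. *)
have [z1 [S1 l1 u1]] := rep_splice R kn Sz Sv (esym vk).
have [|z2 [S2 l2 u2]] := rep_splice R mn S1 Sv' _; first by rewrite u1 ?vm //; lia.
have [|z3 [S3 l3 u3]] := rep_splice R ln S2 Sz _; first by rewrite u2 //; lia.
have e3 : f k.+1 z3 = f k.+1 u by rewrite l3 // u2 // mn leqnn.
have [->|/eqP ne] := eqVneq (f k.+1 u) (f k.+1 z); first by [].
apply/eqP; rewrite -e3; apply/esym/(rep_rchar R jP Sz S3) => //.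
  move=> i iN ik; have [ki|ki] := leqP k.+2 i; first by rewrite u3 ?ki.
  by rewrite l3 ?l2 ?l1 //; lia.
by rewrite e3; apply/nesym.
Qed.

Definition same_stab x y := forall w, word n w -> stab n r f x w <-> stab n r f y w.

Lemma autP (s : {perm P}) : reflect {mono (s : P -> P) : x y / (x <= y)%O} (s \in autgroup P).
Proof.
rewrite inE; apply: (iffP forallP) => [H x y|H x].
  by have /forallP/(_ y)/eqP := H x.
by apply/forallP=> y; rewrite H.
Qed.

Lemma corr_fl (s : {perm P}) x y : corr n f f s x y -> s @: fl x = fl y.
Proof.
move=> c; apply/setP=> p; apply/imsetP/flP => [[_ /flP[k kn ->] ->]|[k kn ->]].
  by exists k => //; rewrite c.
by exists (f k x); [apply: mem_fl|rewrite c].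
Qed.

Lemma aut_corr s x : s \in autgroup P -> S x ->
  exists2 y, S y & corr n f f s x y.
Proof. by move=> /autP sm Sx; apply: (rep_iso_flag R R sm Sx). Qed.

Lemma same_stab_aut x y : S x -> S y -> same_stab x y ->
  exists2 s, s \in autgroup P & corr n f f s x y.
Proof.
move=> Sx Sy st; have [g [bg gm gc]] := same_stab_iso R R Sx Sy st.
by exists (perm (bij_inj bg)); [apply/autP=> p q|move=> k kn]; rewrite !permE ?gm ?gc.
Qed.

Lemma orbit_stab x y : S x -> S y ->
  fl y \in orbit ('P^*) (autgroup P) (fl x) <-> same_stab x y.
Proof.
move=> Sx Sy; split.
  case/orbitP=> s sA; rewrite -[_ _ s]/(s @: fl x) => e w ww.
  have [y' Sy' c] := aut_corr sA Sx.
  have /(fl_eq Sy' Sy) ey : fl y' = fl y by rewrite -(corr_fl c).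
  apply: (corr_stab R R (g := s)) => //; first exact/autP.
  by move=> k kn; rewrite c ?ey.
move=> /(same_stab_aut Sx Sy)[s sA c]; apply/orbitP; exists s => //.
by rewrite -[LHS]/(s @: fl x) (corr_fl c).
Qed.

Lemma rep_regular : (forall x y, S x -> S y -> same_stab x y) -> regular P n.
Proof.
move=> H; split; first exact: rep_polytope.
have [x Sx] := rep_ex R; apply/imsetP; exists (fl x); first by apply/mem_flags; exists x.
apply/setP=> Phi; apply/idP/idP => [/mem_flags[y Sy ->]|].
  by apply/orbit_stab => //; apply: H.
case/orbitP=> s sA <-; rewrite -[_ _ s]/(s @: fl x).
have [y Sy c] := aut_corr sA Sx; rewrite (corr_fl c).
by apply/mem_flags; exists y.
Qed.

Lemma regular_stab x y : regular P n -> S x -> S y -> same_stab x y.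
Proof.
move=> [_ tr] Sx Sy; apply/orbit_stab => //.
by rewrite (atransP tr); apply/mem_flags; [exists y|exists x].
Qed.

Lemma rep_chiral (col : X -> bool) :
  (0 < n) ->
  (forall j x, 0 < j <= n -> S x -> col (r j x) = ~~ col x) ->
  (forall x y, S x -> S y -> col x = col y -> same_stab x y) ->
  (exists x y, [/\ S x, S y & ~ same_stab x y]) ->
  chiral P n.
Proof.
move=> n0 colr colS [x1 [x2 [Sx1 Sx2 nst]]].
have symst x y : same_stab x y -> same_stab y x by move=> H w ww; apply: iff_sym; apply: H.
have trst x y z : same_stab x y -> same_stab y z -> same_stab x z.
  by move=> H1 H2 w ww; apply: iff_trans (H1 _ ww) (H2 _ ww).
have nc : col x1 != col x2 by apply/eqP=> /(colS _ _ Sx1 Sx2).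
have colSE x y : S x -> S y -> same_stab x y <-> col x = col y.
  move=> Sx Sy; split; last exact: colS.
  move=> st; apply/eqP/negPn/negP=> nxy; apply: nst.
  have [e|e] : col x = col x1 /\ col y = col x2 \/ col x = col x2 /\ col y = col x1.
    by move: nc nxy; case: (col x1) (col x2) (col x) (col y) => [] [] [] []; auto.
    exact: (trst _ _ _ (trst _ _ _ (colS _ _ Sx1 Sx (esym e.1)) st) (colS _ _ Sy Sx2 e.2)).
  exact: (trst _ _ _ (trst _ _ _ (colS _ _ Sx1 Sy (esym e.2)) (symst _ _ st)) (colS _ _ Sx Sx2 e.1)).
have orbE x y : S x -> S y ->
    (orbit ('P^*) (autgroup P) (fl x) == orbit ('P^*) (autgroup P) (fl y)) = (col x == col y).
  move=> Sx Sy; rewrite eq_sym orbit_eq_mem.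
  by apply/idP/eqP => [/(orbit_stab Sx Sy)/(colSE _ _ Sx Sy)|/(colSE _ _ Sx Sy)/(orbit_stab Sx Sy)].
split; first exact: rep_polytope.
  have -> : [set orbit ('P^*) (autgroup P) Phi | Phi in flags P] =
    [set orbit ('P^*) (autgroup P) (fl x1); orbit ('P^*) (autgroup P) (fl x2)].
    apply/setP=> O; rewrite in_set2; apply/imsetP/orP.
      move=> [Phi /mem_flags[x Sx ->] ->]; rewrite !orbE //.
      by move: nc; case: (col x1) (col x2) (col x) => [] [] []; auto.
    by case=> /eqP->; [exists (fl x1)|exists (fl x2)] => //; apply/mem_flags; [exists x1|exists x2].
  by rewrite cards2 orbE // nc.
move=> Phi Psi adj; have /and4P[/mem_flags[x Sx xE] /mem_flags[y Sy yE] _ _] := adj.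
move: adj; rewrite xE yE => /(adjacentP Sx Sy)[j jn e]; rewrite orbE //.
have Sj := rep_S R jn Sx.
have -> : col y = col (r j x).
  apply/esym/colSE => // w ww.
  have e' := rep_ext_act R ww Sj Sy e.
  by split=> st k kn; [rewrite -e' // st // e|rewrite e' // st // e].
by rewrite colr //; case: (col x).
Qed.

Section Isog.
Variables (gT : finGroupType) (G : {group gT}) (to : X -> gT -> X) (x0 : X).
Hypothesis Sx0 : S x0.
Hypothesis sep : forall x y, S x -> S y -> eqf n f x y -> x = y.
Hypothesis toS : forall x g, S x -> g \in G -> S (to x g).
Hypothesis toM : forall x g h, to x (g * h)%g = to (to x g) h.
Hypothesis to_r : forall j x g, 0 < j <= n -> S x -> g \in G -> to (r j x) g = r j (to x g).
Hypothesis to_free : forall g, g \in G -> to x0 g = x0 -> g = 1%g.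
Hypothesis to_inj : forall x y g, S x -> S y -> g \in G -> to x g = to y g -> x = y.
Hypothesis aut_to : forall s, s \in autgroup P ->
  exists2 g, g \in G & corr n f f s x0 (to x0 g).

Lemma to_act w x g : word n w -> S x -> g \in G -> to (act r w x) g = act r w (to x g).
Proof.
move=> ww Sx gG; elim: w ww => //= j w IH /andP[/and3P[j0 jn _] ww].
by rewrite to_r ?j0 ?IH //; apply: (rep_actS R).
Qed.

Lemma to_aut g : exists s : {perm P}, g \in G ->
  s \in autgroup P /\ forall x, S x -> corr n f f s x (to x g).
Proof.
case: (boolP (g \in G)) => gG; last by exists 1%g.
have Sg := toS Sx0 gG.
have [w ww|s sA c] := @same_stab_aut x0 (to x0 g) Sx0 Sg _.
  have Sw := rep_actS R ww Sx0.
  rewrite /stab -to_act //; split=> [/(sep Sw Sx0)->//|e].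
  by have /(to_inj Sw Sx0 gG)-> := sep (toS Sw gG) Sg e.
exists s => _; split=> // x Sx; have [w ww e] := rep_reach R Sx0 Sx.
rewrite -(sep (rep_actS R ww Sx0) Sx e) to_act //.
by apply: (rep_iso_act R R) => //; apply/autP.
Qed.

Lemma corr_aut_inj (s t : {perm P}) y : s \in autgroup P -> t \in autgroup P -> S y ->
  corr n f f s x0 y -> corr n f f t x0 y -> s = t.
Proof.
move=> /autP sA /autP tA Sy cs ct; apply/permP=> p.
have [k [w [kn ww <-]]] := rep_pos R p Sx0.
by rewrite (rep_iso_act R R sA ww Sx0 Sy cs) // (rep_iso_act R R tA ww Sx0 Sy ct).
Qed.

(** As [to] commutes with words, [x0] and [to x0 g] have the same stabilisers, so g induces an
    automorphism; [aut_to] gives surjectivity and freeness at [x0] injectivity. Permutations are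
    multiplied first factor first, which matches a right action. *)
Lemma rep_isog : autgroup P \isog G.
Proof.
have [psi psiP] := choice to_aut.
have psiA g : g \in G -> psi g \in autgroup P by move=> /psiP[].
have psiC g x : g \in G -> S x -> corr n f f (psi g) x (to x g) by move=> /psiP[] _; apply.
have psiM : {in G &, {morph psi : g h / (g * h)%g}}.
  move=> g h gG hG; have Sg := toS Sx0 gG.
  have Sgh := toS Sx0 (groupM gG hG).
  apply: (corr_aut_inj (psiA _ (groupM gG hG)) _ Sgh).
  - by rewrite groupM ?psiA.
  - by apply: psiC => //; apply: groupM.
  by move=> k kn; rewrite permM toM psiC // psiC.
have inj g : g \in G -> psi g = 1%g -> g = 1%g.
  move=> gG e; apply: to_free => //; apply: sep => //; first exact: toS.
  by move=> k kn; rewrite -(psiC _ _ gG Sx0) // e perm1.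
pose phi := Morphism psiM.
have injphi : ('injm phi)%g.
  apply/subsetP=> g /morphpreP[gG /set1P e].
  by rewrite (inj g gG e) group1.
rewrite isog_sym; apply/isogP; exists phi => //.
apply/setP=> s; rewrite morphimEdom; apply/imsetP/idP => [[g gG ->]|sA]; first exact: psiA.
have [g gG c] := aut_to sA; exists g => //.
exact: (corr_aut_inj sA (psiA _ gG) (toS Sx0 gG) c (psiC _ _ gG Sx0)).
Qed.
End Isog.

End FinRep.

(** * Flag systems of facets and vertex-figures *)

Section Sections.
Variables (d : Order.disp_t) (P : finPOrderType d) (n : nat) (X : Type).
Variables (S : X -> Prop) (r : nat -> X -> X) (f : nat -> X -> P).
Hypothesis R : flagrep n.+1 S r f.

Section Facet.
Variable F : P.
Hypothesis F_facet : exists2 x, S x & f n.+1 x = F.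

Definition facet_flags x := S x /\ f n.+1 x = F.

Definition facet_face k x : facet_section F := 
  @insubd _ _ (facet_section F) (exist (fun y => y <= F)%O F (lexx F)) (f k x).

Lemma facet_leE (p q : facet_section F) : (p <= q)%O = (val p <= val q)%O.
Proof. by []. Qed.

Lemma facet_faceK k x : k <= n.+1 -> facet_flags x -> val (facet_face k x) = f k x.
Proof.
move=> kn [Sx xF]; rewrite val_insubd ifT // -xF.
by apply: (rep_le R) => //; rewrite kn /=.
Qed.

Lemma facet_face_eq k x y : k <= n.+1 -> facet_flags x -> facet_flags y ->
  facet_face k x = facet_face k y <-> f k x = f k y.
Proof.
move=> kn Sx Sy; split=> [e|e]; first by rewrite -!facet_faceK ?e.
by apply: val_inj; rewrite /= !facet_faceK.
Qed.

(** The points and involutions stay the same; only flags through F are kept, and F, of index n + 1,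
    becomes the greatest face. *)
Lemma facet_rep : flagrep n facet_flags r facet_face.
Proof.
have rS j x : 0 < j <= n -> facet_flags x -> facet_flags (r j x).
  move=> jn [Sx xF]; split; first by apply: (rep_S R) => //; lia.
  by rewrite (rep_fix R) //; lia.
split=> //.
- by have [x Sx xF] := F_facet; exists x.
- by move=> j x jn [Sx _]; apply: (rep_inv R) => //; lia.
- move=> j k x jn kn kj Sx; apply/facet_face_eq => //; first exact: rS.
  by case: Sx => Sx _; apply: (rep_fix R) => //; lia.
- move=> j x jn Sx; rewrite facet_face_eq //; [|lia|exact: rS].
  by case: Sx => Sx _; apply: (rep_mov R) => //; lia.
- move=> K x y Sx Sy H; have [[Sx' xF] [Sy' yF]] := (Sx, Sy).
  have [k kn /orP[/eqP->|Kk]|w aw ew] :=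
    rep_conn R (K := fun k => (k == n.+1) || K k) Sx' Sy' _.
  + by rewrite xF yF.
  + have [->|kN] := eqVneq k n.+1; first by rewrite xF yF.
    by apply/facet_face_eq => //; [lia|apply: H => //; lia].
  have lw : all (letters n K) w.
    apply: sub_all aw => j /and3P[j0 jn /norP[jN nK]]; apply/and3P; split=> //; lia.
  exists w => // k kn; apply/facet_face_eq => //; last by apply: ew; lia.
  have ww : word n w by apply: letters_word lw.
  elim: {aw ew lw} w ww => //= j w IH /andP[/and3P[j0 jn _] ww].
  by apply: rS; rewrite ?j0 //; apply: IH.
- move=> k x y kn Sx Sy /facet_face_eq e; have [[Sx' xF] [Sy' yF]] := (Sx, Sy).
  have [|z [Sz zl zu]] := rep_splice R _ Sx' Sy' (e kn Sx Sy); first by lia.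
  have Sz' : facet_flags z by split=> //; rewrite zu // kn leqnSn.
  exists z; split=> // l ll; apply/facet_face_eq => //; [lia|exact: zl|lia|].
  by apply: zu; lia.
- move=> [p pF]; have [k [x [kn Sx xp]]] := rep_surj R p.
  have [y Sy yF] := F_facet.
  have [|kn' [z [Sz zk zn]]] := rep_le_inv R kn (leqnSn n.+1) Sx Sy; first by rewrite xp yF.
  have Sz' : facet_flags z by split=> //; rewrite zn.
  exists k, z; split=> //.
  by apply: val_inj; rewrite facet_faceK //= zk.
- move=> k l x kl Sx; rewrite facet_leE !facet_faceK //; try lia.
  by case: Sx => Sx _; apply: (rep_le R) => //; lia.
- move=> k l x y kn ln Sx Sy; rewrite facet_leE !facet_faceK //.
  have [[Sx' xF] [Sy' yF]] := (Sx, Sy).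
  move=> /(rep_le_inv R (leqW kn) (leqW ln) Sx' Sy')[kl [z [Sz zk zl]]].
  have [z' [Sz' z'l z'u]] := rep_splice R (leqW ln) Sz Sy' zl.
  have Sz1 : facet_flags z' by split=> //; rewrite z'u // ln leqnSn.
  split=> //; exists z'; split=> //; apply/facet_face_eq => //; rewrite z'l //.
Qed.
End Facet.

Section VertexFigure.
Variable V : P.
Hypothesis V_vertex : exists2 x, S x & f 1 x = V.

Definition vertex_flags x := S x /\ f 1 x = V.

Definition vertex_face k x : vertex_figure V := 
  @insubd _ _ (vertex_figure V) (exist (fun y => V <= y)%O V (lexx V)) (f k.+1 x).

Lemma vertex_leE (p q : vertex_figure V) : (p <= q)%O = (val p <= val q)%O.
Proof. by []. Qed.

Lemma vertex_faceK k x : k <= n.+1 -> vertex_flags x -> val (vertex_face k x) = f k.+1 x.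
Proof.
move=> kn [Sx xV]; rewrite val_insubd ifT // -xV.
by apply: (rep_le R).
Qed.

Lemma vertex_face_eq k x y : k <= n.+1 -> vertex_flags x -> vertex_flags y ->
  vertex_face k x = vertex_face k y <-> f k.+1 x = f k.+1 y.
Proof.
move=> kn Sx Sy; split=> [e|e]; first by rewrite -!vertex_faceK ?e.
by apply: val_inj; rewrite /= !vertex_faceK.
Qed.

Lemma act_shift w x : act (fun j => r j.+1) w x = act r (map succn w) x.
Proof. by elim: w => //= j w ->. Qed.

(** All indices drop by one, since the vertex becomes the least face; this is why words on a
    vertex-figure appear later under [map succn]. *)
Lemma vertex_rep : flagrep n vertex_flags (fun j => r j.+1) vertex_face.
Proof.
have rS j x : 0 < j <= n -> vertex_flags x -> vertex_flags (r j.+1 x).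
  move=> jn [Sx xV]; split; first by apply: (rep_S R) => //; lia.
  by rewrite (rep_fix R) //; lia.
split=> //.
- by have [x Sx xV] := V_vertex; exists x.
- by move=> j x jn [Sx _]; apply: (rep_inv R) => //; lia.
- move=> j k x jn kn kj Sx; apply/vertex_face_eq => //; first exact: rS.
  by case: Sx => Sx _; apply: (rep_fix R) => //; lia.
- move=> j x jn Sx; rewrite vertex_face_eq //; [|lia|exact: rS].
  by case: Sx => Sx _; apply: (rep_mov R) => //; lia.
- move=> K x y Sx Sy H; have [[Sx' xV] [Sy' yV]] := (Sx, Sy).
  have [k kn /orP[/eqP->|Kk]|w aw ew] :=
    rep_conn R (K := fun k => (k == 1) || K k.-1) Sx' Sy' _.
  + by rewrite xV yV.
  + have [->|k1] := eqVneq k 1; first by rewrite xV yV.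
    have kE : k = k.-1.+1 by lia.
    by rewrite kE; apply/vertex_face_eq => //; [lia|apply: H => //; lia].
  have lw : all (letters n K) (map predn w).
    rewrite all_map; apply: sub_all aw => j /and3P[j0 jn /norP[j1 nK]].
    by apply/and3P; split=> //=; lia.
  have wE : map succn (map predn w) = w.
    rewrite -map_comp -[RHS]map_id; apply/eq_in_map => j /(allP aw)/and3P[j0 _ _] /=.
    by rewrite prednK.
  exists (map predn w) => // k kn; apply/vertex_face_eq => //; last first.
    by rewrite act_shift wE; apply: ew; lia.
  have ww : word n (map predn w) by apply: letters_word lw.
  elim: {aw ew lw wE} (map _ w) ww => //= j u IH /andP[/and3P[j0 jn _] ww].
  by apply: rS; rewrite ?j0 //; apply: IH.
- move=> k x y kn Sx Sy /vertex_face_eq e; have [[Sx' xV] [Sy' yV]] := (Sx, Sy).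
  have [|z [Sz zl zu]] := rep_splice R _ Sx' Sy' (e kn Sx Sy); first by lia.
  have Sz' : vertex_flags z by split=> //; rewrite zl.
  exists z; split=> // l ll; apply/vertex_face_eq => //; [lia|exact: zl|lia|].
  by apply: zu; lia.
- move=> [p pV]; have [k [x [kn Sx xp]]] := rep_surj R p.
  have [y Sy yV] := V_vertex.
  have [|//|kn' [z [Sz zk zn]]] := rep_le_inv R _ kn Sy Sx (k := 1) _ => //.
    by rewrite xp yV.
  have Sz' : vertex_flags z by split=> //; rewrite zk.
  have kE : k = k.-1.+1 by lia.
  exists k.-1, z; split=> //; first by lia.
  by apply: val_inj; rewrite vertex_faceK //= -?kE ?zn //; lia.
- move=> k l x kl Sx; rewrite vertex_leE !vertex_faceK //; try lia.
  by case: Sx => Sx _; apply: (rep_le R) => //; lia.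
- move=> k l x y kn ln Sx Sy; rewrite vertex_leE !vertex_faceK //.
  have [[Sx' xV] [Sy' yV]] := (Sx, Sy).
  have kn' : k.+1 <= n.+2 by lia.
  have ln' : l.+1 <= n.+2 by lia.
  move=> /(rep_le_inv R kn' ln' Sx' Sy')[kl [z [Sz zk zl]]].
  have [z' [Sz' z'l z'u]] := rep_splice R kn' Sx' Sz (esym zk).
  have Sz1 : vertex_flags z' by split=> //; rewrite z'l.
  split=> //; exists z'; split=> //; apply/vertex_face_eq => //; first by rewrite z'l.
  by rewrite z'u // kl.
Qed.
End VertexFigure.

End Sections.

(** * The flag system of an abstract polytope *)

Section PolytopeRep.
Variables (d : Order.disp_t) (Q : finPOrderType d) (n : nat) (q0 : Q).
Hypothesis polyQ : polytope Q n.
Implicit Types (x y : Q) (C Phi Psi : {set Q}).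

Definition height x := \max_(C : {set Q} | chain C && [forall y in C, (y < x)%O]) #|C|.

Lemma rankE x : Defs.rank x = ((height x)%:Z - 1)%R. Proof. by []. Qed.

Lemma chainP C : reflect {in C &, forall x y, (x <= y)%O || (y <= x)%O} (chain C).
Proof.
apply: (iffP forall_inP) => [H x y xC|H x xC]; first exact: (forall_inP (H x xC)).
by apply/forall_inP=> y yC; apply: H.
Qed.

Lemma chain_ext C : chain C -> exists2 Phi, Phi \in flags Q & C \subset Phi.
Proof.
by move=> cC; have [Phi m s] := maxset_exists cC; exists Phi; rewrite ?inE.
Qed.

Lemma chainU1 C x : chain C -> (forall y, y \in C -> (x <= y)%O || (y <= x)%O) ->
  chain (x |: C).
Proof.
move=> /chainP cC xC; apply/chainP=> y z /setU1P[->|yC] /setU1P[->|zC].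
- by rewrite lexx.
- exact: xC.
- by rewrite orbC xC.
- exact: cC.
Qed.

Lemma height_ex x : exists C, [/\ chain C, forall y, y \in C -> (y < x)%O & #|C| = height x].
Proof.
rewrite /height.
have [|C] := @eq_bigmax_cond _ [pred C : {set Q} | chain C && [forall y in C, (y < x)%O]] (fun C => #|C|).
  apply/card_gt0P; exists set0; apply/andP; split; first by apply/chainP=> y; rewrite inE.
  by apply/forall_inP=> y; rewrite inE.
by move=> /andP[cC /forall_inP CP] e; exists C.
Qed.

Lemma height_max x C : chain C -> (forall y, y \in C -> (y < x)%O) -> #|C| <= height x.
Proof.
move=> cC lC; apply: (@leq_bigmax_cond _ _ (fun C : {set Q} => #|C|) C).
by rewrite cC; apply/forall_inP.
Qed.

Lemma chain_height x C : chain C -> (forall y, y \in C -> (y < x)%O) -> chain (x |: C).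
Proof. by move=> cC lC; apply: chainU1 => // y /lC/ltW->; rewrite orbT. Qed.

Lemma height_lt x y : (x < y)%O -> height x < height y.
Proof.
move=> xy; have [C [cC lC <-]] := height_ex x.
have := @height_max y (x |: C) (chain_height cC lC).
rewrite cardsU1; have -> : x \notin C by apply/negP=> /lC; rewrite ltxx.
by apply=> z /setU1P[->|/lC/lt_trans->].
Qed.

Lemma height_le x : height x <= n.+1.
Proof.
have [C [cC lC <-]] := height_ex x.
have [Phi fPhi sub] := chain_ext (chain_height cC lC).
have [_ cardF _ _] := polyQ; rewrite -ltnS -(cardF _ fPhi).
have := subset_leq_card sub; rewrite cardsU1.
by have -> : x \notin C by apply/negP=> /lC; rewrite ltxx.
Qed.

Lemma flag_chain Phi : Phi \in flags Q -> {in Phi &, forall x y, (x <= y)%O || (y <= x)%O}.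
Proof. by rewrite inE => /maxsetP[/chainP]. Qed.

Lemma flag_height_inj Phi : Phi \in flags Q -> {in Phi &, injective height}.
Proof.
move=> fPhi x y xP yP e; apply/eqP; apply/negPn/negP=> ne.
have /orP[le|le] := flag_chain fPhi xP yP.
  by have := @height_lt x y; rewrite lt_neqAle ne le e ltnn => /(_ isT).
by have := @height_lt y x; rewrite lt_neqAle eq_sym ne le e ltnn => /(_ isT).
Qed.

Lemma flag_le Phi x y : Phi \in flags Q -> x \in Phi -> y \in Phi ->
  height x <= height y -> (x <= y)%O.
Proof.
move=> fP xP yP h; have /orP[//|le] := flag_chain fP xP yP.
have := @height_lt y x; rewrite lt_neqAle le andbT.
by case: eqP => [->//|_ /(_ isT)]; rewrite ltnNge h.
Qed.

(** Pigeonhole: the n + 2 faces of a flag have distinct heights, all at most n + 1. *)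
Lemma flag_height_surj Phi k : Phi \in flags Q -> k <= n.+1 ->
  exists2 x, x \in Phi & height x = k.
Proof.
move=> fPhi kn; have [_ cardF _ _] := polyQ.
have : inord k \in [set (inord (height x) : 'I_n.+2) | x in Phi].
  suff /eqP-> : [set (inord (height x) : 'I_n.+2) | x in Phi] == setT by rewrite in_setT.
  rewrite eqEcard subsetT cardsT card_ord card_in_imset ?cardF ?leqnn //.
  move=> x y xP yP /(congr1 val); rewrite /= !inordK ?ltnS ?height_le //.
  exact: (flag_height_inj fPhi).
case/imsetP=> x xP /(congr1 val); rewrite /= !inordK ?ltnS ?height_le // => e.
by exists x.
Qed.

Definition face k Phi : Q := odflt q0 [pick x in Phi | height x == k].

Lemma faceP k Phi : Phi \in flags Q -> k <= n.+1 ->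
  face k Phi \in Phi /\ height (face k Phi) = k.
Proof.
move=> fP kn; rewrite /face; case: pickP => [x /andP[xP /eqP]//|no].
by have [x xP e] := flag_height_surj fP kn; have := no x; rewrite /= xP e eqxx.
Qed.

Lemma face_in k Phi : Phi \in flags Q -> k <= n.+1 -> face k Phi \in Phi.
Proof. by move=> fP kn; have [] := faceP fP kn. Qed.

Lemma face_height k Phi : Phi \in flags Q -> k <= n.+1 -> height (face k Phi) = k.
Proof. by move=> fP kn; have [] := faceP fP kn. Qed.

Lemma face_eq x Phi : Phi \in flags Q -> x \in Phi -> face (height x) Phi = x.
Proof.
move=> fP xP; apply: (flag_height_inj fP) => //; rewrite ?face_in ?face_height ?height_le //.
Qed.

Lemma face_eqk k x Phi : Phi \in flags Q -> x \in Phi -> height x = k -> face k Phi = x.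
Proof. by move=> fP xP <-; apply: face_eq. Qed.

Lemma face_le k l Phi : Phi \in flags Q -> k <= l <= n.+1 -> (face k Phi <= face l Phi)%O.
Proof.
move=> fP kl; apply: (flag_le fP); rewrite ?face_in ?face_height //; lia.
Qed.

Lemma flag_eq Phi Psi : Phi \in flags Q -> Psi \in flags Q ->
  (forall k, k <= n.+1 -> face k Phi = face k Psi) -> Phi = Psi.
Proof.
move=> fP fS e.
have sub A B : A \in flags Q -> B \in flags Q ->
    (forall k, k <= n.+1 -> face k A = face k B) -> A \subset B.
  move=> fA fB eAB; apply/subsetP=> x xA.
  by rewrite -(face_eq fA xA) eAB ?height_le // face_in ?height_le.
by apply/eqP; rewrite eqEsubset !sub // => k kn; rewrite e.
Qed.

Definition flip j Phi : {set Q} :=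
  odflt Phi [pick Psi in flags Q | (Psi != Phi) &&
    [forall k : 'I_n.+2, (k != j :> nat) ==> (face k Psi == face k Phi)]].

Definition differ j Phi Psi := [/\ Psi \in flags Q, Psi <> Phi &
  forall k, k <= n.+1 -> k != j -> face k Psi = face k Phi].

Lemma between_face j Phi x : 0 < j <= n -> Phi \in flags Q ->
  (face j.-1 Phi < x < face j.+1 Phi)%O -> height x = j.
Proof.
move=> jn fP /andP[/height_lt l1 /height_lt l2].
by rewrite !face_height // in l1 l2; lia.
Qed.

Lemma face_between j Phi Psi : 0 < j <= n -> Phi \in flags Q -> Psi \in flags Q ->
  (forall k, k <= n.+1 -> k != j -> face k Psi = face k Phi) ->
  (face j.-1 Phi < face j Psi < face j.+1 Phi)%O.
Proof.
move=> jn fP fS e.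
have h k l : k < l <= n.+1 -> (face k Psi < face l Psi)%O.
  move=> kl; rewrite lt_neqAle face_le //; last by lia.
  rewrite andbT; apply/eqP=> /(congr1 height); rewrite !face_height //; lia.
rewrite -!e ?h //; lia.
Qed.

Lemma diamond2 j Phi : 0 < j <= n -> Phi \in flags Q ->
  #|[set x | (face j.-1 Phi < x < face j.+1 Phi)%O]| = 2.
Proof.
move=> jn fP; have [_ _ _ dia] := polyQ.
have /andP[l1 l2] := face_between jn fP fP (fun k _ _ => erefl).
apply: dia; first exact: lt_trans l1 l2.
by rewrite !rankE !face_height //; lia.
Qed.

(** Otherwise three faces would lie between those of index j - 1 and j + 1, where the diamond
    condition allows two. *)
Lemma differ_uniq j Phi Psi Psi' : 0 < j <= n -> Phi \in flags Q ->
  differ j Phi Psi -> differ j Phi Psi' -> Psi = Psi'.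
Proof.
move=> jn fP [fS nS eS] [fS' nS' eS'].
have neq A : A \in flags Q -> A <> Phi -> (forall k, k <= n.+1 -> k != j -> face k A = face k Phi) ->
    face j A != face j Phi.
  move=> fA nA eA; apply/eqP=> e; apply: nA; apply: flag_eq => // k kn.
  by have [->//|kj] := eqVneq k j; apply: eA.
have jE : face j Psi = face j Psi'.
  apply/eqP/negPn/negP=> ne.
  have : [set face j Psi; face j Psi'; face j Phi] \subset
      [set x | (face j.-1 Phi < x < face j.+1 Phi)%O].
    apply/subsetP=> x; rewrite !inE -orbA.
    by case/or3P=> /eqP->; apply: face_between.
  move/subset_leq_card; rewrite diamond2 //.
  by rewrite -setUA !cardsU1 cards1 !inE negb_or ne !neq.
apply: flag_eq => // k kn; have [->//|kj] := eqVneq k j.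
by rewrite eS ?eS'.
Qed.

Lemma differ_ex j Phi : 0 < j <= n -> Phi \in flags Q -> exists Psi, differ j Phi Psi.
Proof.
move=> jn fP; have b0 := face_between jn fP fP (fun k _ _ => erefl).
have := diamond2 jn fP; rewrite (cardsD1 (face j Phi)) inE b0 => -[] /eqP/cards1P[y yE].
have : y \in [set x | (face j.-1 Phi < x < face j.+1 Phi)%O] :\ face j Phi by rewrite yE set11.
rewrite !inE => /andP[ny yb]; have /andP[y1 y2] := yb.
have cC : chain (y |: (Phi :\ face j Phi)).
  apply: chainU1 => [|x /setD1P[nx xP]].
    apply/chainP=> x z /setD1P[_ xP] /setD1P[_ zP]; exact: (flag_chain fP).
  have hx : height x != j by apply: contra_neq nx => <-; rewrite face_eq.
  rewrite -(face_eq fP xP); have hn := height_le x.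
  have [h|h] := ltnP (height x) j.
    by rewrite orbC (le_trans _ (ltW y1)) // face_le //; lia.
  by rewrite (le_trans (ltW y2)) // face_le //; lia.
have [Psi fS sub] := chain_ext cC.
have yS : y \in Psi by apply: (subsetP sub); rewrite setU11.
have yj : face j Psi = y by apply: face_eqk => //; apply: between_face yb.
exists Psi; split=> // [e|k kn kj]; first by move: ny; rewrite -yj e eqxx.
apply: face_eqk => //; last by rewrite face_height.
apply: (subsetP sub); rewrite in_setU1 in_setD1 face_in // andbT.
rewrite (_ : _ != _) ?orbT //; apply/eqP=> /(congr1 height).
by rewrite !face_height //; [apply/eqP|lia].
Qed.

Lemma flipP j Phi : 0 < j <= n -> Phi \in flags Q -> differ j Phi (flip j Phi).
Proof.
move=> jn fP; rewrite /flip; case: pickP => [Psi /and3P[fS /eqP nS /forallP eS]|no].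
  by split=> // k kn kj; have /implyP/(_ kj)/eqP := eS (Ordinal (kn : k < n.+2)).
have [Psi [fS nS eS]] := differ_ex jn fP; have := no Psi; rewrite /= fS.
have -> : Psi != Phi by apply/eqP.
case: forallP => // H; case: H => -[k kn]; apply/implyP=> kj; apply/eqP; exact: eS.
Qed.

Lemma flip_uniq j Phi Psi : 0 < j <= n -> Phi \in flags Q -> differ j Phi Psi -> flip j Phi = Psi.
Proof. by move=> jn fP; apply: differ_uniq (flipP jn fP). Qed.

Lemma flip_flip j Phi : 0 < j <= n -> Phi \in flags Q -> flip j (flip j Phi) = Phi.
Proof.
move=> jn fP; have [fS nS eS] := flipP jn fP; apply: flip_uniq => //.
by split=> // [/esym//|k kn kj]; rewrite eS.
Qed.

Lemma height0 x y : height x = 0 -> height y = 0 -> x = y.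
Proof.
have [[[F0 leF] _] _ _ _] := polyQ.
suff H z : height z = 0 -> z = F0 by move=> /H-> /H->.
move=> hz; apply/eqP/negPn/negP=> ne; have : (F0 < z)%O by rewrite lt_neqAle eq_sym ne leF.
by move/height_lt; rewrite hz.
Qed.

Lemma height_n x y : height x = n.+1 -> height y = n.+1 -> x = y.
Proof.
have [[_ [F1 leF]] _ _ _] := polyQ.
suff H z : height z = n.+1 -> z = F1 by move=> /H-> /H->.
move=> hz; apply/eqP/negPn/negP=> ne; have : (z < F1)%O by rewrite lt_neqAle ne leF.
by move/height_lt; rewrite hz ltnNge height_le.
Qed.

Lemma adjacent_flip A B : adjacent A B ->
  exists j, [/\ 0 < j <= n, B = flip j A & face j A \notin B].
Proof.
case/and4P=> fA fB /cards1P[p pE] _.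
have /setDP[pA pB] : p \in A :\: B by rewrite pE set11.
have pf := face_eq fA pA; have hn := height_le p.
have oth k : k <= n.+1 -> k != height p -> face k B = face k A.
  move=> kn kj; apply: face_eqk; rewrite ?face_height //.
  apply/negPn/negP=> nk; have : face k A \in A :\: B by rewrite inE nk face_in.
  rewrite pE in_set1 => /eqP e; move: kj; rewrite -e face_height // eqxx //.
have npf : face (height p) B <> p by move=> e; move: pB; rewrite -e face_in.
have jn : 0 < height p <= n.
  apply/andP; split.
    rewrite lt0n; apply/eqP=> h; apply: npf; apply: height0 => //.
    by rewrite face_height.
  rewrite -ltnS ltn_neqAle hn andbT; apply/eqP=> h; apply: npf.
  by apply: height_n => //; rewrite face_height.
exists (height p); split=> //; last by rewrite pf.
by apply/esym/flip_uniq => //; split=> // e; apply: npf; rewrite e.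
Qed.

Lemma polytope_rep : flagrep n (fun Phi => Phi \in flags Q) flip face.
Proof.
have flS j Phi : 0 < j <= n -> Phi \in flags Q -> flip j Phi \in flags Q.
  by move=> jn fP; have [] := flipP jn fP.
split=> //.
- have [|Phi fP _] := @chain_ext set0; last by exists Phi.
  by apply/chainP=> x; rewrite inE.
- exact: flip_flip.
- by move=> j k Phi jn kn kj fP; have [_ _] := flipP jn fP; apply.
- move=> j Phi jn fP e; have [fS nS eS] := flipP jn fP; apply: nS.
  by apply: flag_eq => // k kn; have [->|] := eqVneq k j => //; apply: eS.
- move=> K Phi Psi fP fS e; have [_ _ sfc _] := polyQ.
  have /connectP[p pp lp] := sfc _ _ fP fS.
  suff [w aw wE] : exists2 w, all (letters n K) w & act flip w Phi = last Phi p.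
    by exists w => // k kn; rewrite wE -lp.
  have e' k : 0 < k <= n -> K k -> face k Phi \in Phi :&: Psi.
    by move=> kn Kk; rewrite inE face_in ?e ?face_in //; lia.
  have fP' := fP.
  move: (Phi :&: Psi) pp e' => I pp e';
  elim: p (Phi) fP pp {lp} => [|B p IH] A fA /=; first by exists [::].
  move=> /andP[/and3P[adj sA sB] pp].
  have [j [jn BE nB]] := adjacent_flip adj.
  have fB : B \in flags Q by have /and4P[] := adj.
  (* The first flip of the path is the last letter of the word, hence [rcons]. A flip at an index of
     [K] would lose a face common to [Phi] and [Psi], which the path keeps. *)
  have [w aw <-] := IH B fB pp; exists (rcons w j); last first.
    by rewrite -cats1 act_cat /= BE.
  rewrite all_rcons aw andbT /letters andbA jn /=; apply/negP=> Kj.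
  have jf := e' j jn Kj; move: nB.
  have -> : face j A = face j Phi.
    apply: face_eqk => //; first exact: (subsetP sA).
    by rewrite face_height //; lia.
  by rewrite (subsetP sB).
- move=> k Phi Psi kn fP fS e; set c := face k Phi in e.
  have cP : c \in Phi by apply: face_in.
  have cS : c \in Psi by rewrite e face_in.
  have [|z fz sub] := @chain_ext ([set x in Phi | (x <= c)%O] :|: [set x in Psi | (c <= x)%O]).
    apply/chainP=> x y; rewrite !inE => /orP[]/andP[xP xc] /orP[]/andP[yP yc].
    - exact: (flag_chain fP).
    - by rewrite (le_trans xc yc).
    - by rewrite orbC (le_trans yc xc).
    - exact: (flag_chain fS).
  exists z; split=> // l ll; apply: face_eqk; rewrite ?face_height //; try lia.
    apply: (subsetP sub); rewrite !inE; apply/orP; left.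
    by rewrite face_in /c ?face_le //; lia.
  apply: (subsetP sub); rewrite !inE e; apply/orP; right.
  by rewrite face_in ?face_le //; lia.
- move=> p; have [|Phi fP] := @chain_ext [set p].
    by apply/chainP=> x y /set1P-> /set1P->; rewrite lexx.
  by rewrite sub1set => pP; exists (height p), Phi; rewrite height_le face_eq.
- by move=> k l Phi kl fP; apply: face_le.
move=> k l Phi Psi kn ln fP fS le.
split.
  move: le; rewrite le_eqVlt => /orP[/eqP/(congr1 height)|/height_lt].
    by rewrite !face_height // => ->.
  by rewrite !face_height //; apply: ltnW.
have [|z fz] := @chain_ext [set face k Phi; face l Psi].
  by apply/chainP=> x y /set2P[->|->] /set2P[->|->]; rewrite ?lexx ?le ?orbT.
rewrite subUset !sub1set => /andP[z1 z2]; exists z; split=> //.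
  by apply: face_eqk => //; rewrite face_height.
by apply: face_eqk => //; rewrite face_height.
Qed.

Lemma fl_face Phi : Phi \in flags Q -> fl n face Phi = Phi.
Proof.
move=> fP; apply/setP=> x; apply/flP/idP => [[k kn ->]|xP]; first exact: face_in.
by exists (height x); rewrite ?height_le ?face_eq.
Qed.

End PolytopeRep.

(** * Polytopes built from involutions with the intersection property *)

Lemma finporder_of_rel (T : finType) (le : rel T) :
  reflexive le -> antisymmetric le -> transitive le ->
  exists (d : Order.disp_t) (P : finPOrderType d) (g : T -> P),
    bijective g /\ forall x y, (g x <= g y)%O = le x y.
Proof.
move=> le_refl le_anti le_trans.
pose m := Order.Le_isPOrder.Build (Order.Disp tt tt) T le_refl le_anti le_trans.
pose P : finPOrderType (Order.Disp tt tt) := HB.pack (Finite.sort T) m.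
by exists (Order.Disp tt tt), P, id; split=> //; exists id.
Qed.

Section Construct.
Variables (n : nat) (X : finType) (S : pred X) (r : nat -> X -> X).
Hypothesis S_ex : exists x, S x.
Hypothesis rS : forall j x, 0 < j <= n -> S x -> S (r j x).
Hypothesis rK : forall j x, 0 < j <= n -> S x -> r j (r j x) = x.
Hypothesis r_neq : forall j x, 0 < j <= n -> S x -> r j x <> x.
Hypothesis rC : forall i j x, 0 < i -> i.+1 < j -> j <= n -> S x ->
  r i (r j x) = r j (r i x).

Definition reach (K : pred nat) x y := exists2 w, all (letters n K) w & act r w x = y.

Hypothesis r_conn : forall x y, S x -> S y -> reach pred0 x y.
Hypothesis r_meet1 : forall (K : pred nat) x y, S x -> S y -> K 1 ->
  (forall k, 0 < k <= n -> K k -> reach (pred1 k) x y) -> reach K x y.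

Lemma actS w x : word n w -> S x -> S (act r w x).
Proof.
elim: w => //= j w IH /andP[/and3P[j0 jn _] ww] Sx.
by apply: rS; rewrite ?j0 //; apply: IH.
Qed.

Lemma reach_refl K x : reach K x x. Proof. by exists [::]. Qed.

Lemma reach_trans K y x z : reach K x y -> reach K y z -> reach K x z.
Proof.
move=> [w aw <-] [u au <-]; exists (u ++ w); first by rewrite all_cat au.
exact: act_cat.
Qed.

Lemma reachS K x y : S x -> reach K x y -> S y.
Proof. by move=> Sx [w /letters_word ww <-]; apply: actS. Qed.

Lemma reach_r (K : pred nat) j x : 0 < j <= n -> ~~ K j -> reach K x (r j x).
Proof. by move=> /andP[j0 jn] nK; exists [:: j] => //=; rewrite andbT; apply/and3P. Qed.

Lemma reach_sym K x y : S x -> reach K x y -> reach K y x.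
Proof.
move=> Sx [w aw <-]; elim: w aw => [|j w IH] /=; first by exists [::].
case/andP=> /and3P[j0 jn nj] aw; apply: reach_trans (IH aw).
have jP : 0 < j <= n by rewrite j0.
rewrite -{2}(rK jP (actS (letters_word aw) Sx)); exact: reach_r.
Qed.

Lemma reach_sub (K K' : pred nat) x y : subpred K' K -> reach K x y -> reach K' x y.
Proof.
by move=> sK [w aw <-]; exists w => //; apply: sub_all aw => j; apply: letters_sub.
Qed.

(** Letters below k commute with letters above k, so a word without k can be sorted: the letters
    above k act first, those below k afterwards. *)
Lemma reach_split k x y : S x -> reach (pred1 k) x y ->
  exists2 z, reach (fun j => j <= k) x z & reach (fun j => k <= j) z y.
Proof.
move=> Sx [w aw <-]; elim: w aw => [|j w IH] /=.
  by exists x; apply: reach_refl.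
case/andP=> /and3P[j0 jn /= jk] /IH[z zl zu]; have jP : 0 < j <= n by rewrite j0.
have Sz := reachS Sx zl.
have [ltjk|] := ltnP j k.
  by exists z => //; apply: reach_trans zu _; apply: reach_r => //; rewrite -ltnNge.
rewrite leq_eqVlt eq_sym (negPf jk) /= => ltkj; exists (r j z).
  by apply: reach_trans zl _; apply: reach_r => //; rewrite -ltnNge.
case: zu => v av <-; exists v => //.
elim: v av => //= i v IHv /andP[/and3P[i0 iN ik] av]; rewrite IHv //.
by apply: rC => //; [lia|apply: actS => //; apply: letters_word av].
Qed.

(** Reduction to sets containing 1. Let m be the least element of [K] and split the path that avoids
    m. The part with letters below m avoids [K] anyway; for the part with letters above m, all
    indices up to m can be added to [K], which then contains 1. *)
Lemma reach_meet (K : pred nat) x y : S x -> S y ->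
  (forall k, 0 < k <= n -> K k -> reach (pred1 k) x y) -> reach K x y.
Proof.
move=> Sx Sy H.
have [[k kP]|no] := EM (exists k, [&& 0 < k, k <= n & K k]); last first.
  have [w aw <-] := r_conn Sx Sy; exists w => //.
  apply: sub_all aw => j /and3P[j0 jn _]; apply/and3P; split=> //.
  by apply/negP=> Kj; apply: no; exists j; rewrite j0 jn.
have exk : exists k, [&& 0 < k, k <= n & K k] by exists k.
have [{kP} m /and3P[m0 mn Km] mmin] := ex_minnP exk.
have mP : 0 < m <= n by rewrite m0.
have [z zl zu] := reach_split Sx (H m mP Km).
have Sz := reachS Sx zl.
have [|l ln Kl|w aw wE] := @r_meet1 (fun l => (l <= m) || K l) x z Sx Sz.
- by rewrite m0.
- have [lm|ml] := leqP l m; first by apply: reach_sub zl => j /eqP->.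
  move: Kl; rewrite leqNgt ml /= => Kl.
  apply: reach_trans (H l ln Kl) _; apply: reach_sym => //.
  by apply: reach_sub zu => j /eqP->; apply: ltnW.
have xz : reach K x z.
  by exists w => //; apply: sub_all aw => j; apply: letters_sub => i Ki; apply/orP; right.
apply: reach_trans xz _; case: zu => v av <-; exists v => //.
apply: sub_all av => j /and3P[j0 jn jm]; apply/and3P; split=> //.
by apply: contra jm => Kj; apply: mmin; rewrite j0 jn.
Qed.

Definition cls k x : {set X} := [set y | `[< reach (pred1 k) x y >]].

Lemma clsP k x y : reflect (reach (pred1 k) x y) (y \in cls k x).
Proof. by rewrite inE; apply: asboolP. Qed.

Lemma cls_eq k x y : S x -> S y -> cls k x = cls k y <-> reach (pred1 k) x y.
Proof.
move=> Sx Sy; split=> [e|xy].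
  by apply/clsP; rewrite e; apply/clsP; apply: reach_refl.
apply/setP=> z; apply/clsP/clsP; last exact: reach_trans.
by apply: reach_trans; apply: reach_sym.
Qed.

(** The index is stored with the class because the classes of index 0 and [n.+1] are both the set of
    all flags. *)
Definition is_face (p : 'I_n.+2 * {set X}) := [exists x, S x && (p.2 == cls p.1 x)].

Definition face_type := {p | is_face p}.

Definition cls_le (p q : face_type) :=
  ((val p).1 <= (val q).1) && ((val p).2 :&: (val q).2 != set0).

Lemma face_clsP (k : 'I_n.+2) x : S x ->
  is_face (k, cls k x).
Proof. by move=> Sx; apply/existsP; exists x; rewrite Sx /=. Qed.

Definition mkface k x (Sx : S x) : face_type := exist is_face _ (@face_clsP k x Sx).

Lemma face_type_ind (Pr : face_type -> Prop) :
  (forall k x (Sx : S x), Pr (@mkface k x Sx)) -> forall p, Pr p.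
Proof.
move=> H [[k C] pP]; have /existsP[x /andP[Sx /eqP/= CE]] := pP.
move: pP; rewrite CE => pP; have := H k x Sx.
by rewrite /mkface (bool_irrelevance (face_clsP _ _) pP).
Qed.

Lemma mkface_eq k x y (Sx : S x) (Sy : S y) :
  @mkface k x Sx = @mkface k y Sy <-> reach (pred1 (k : nat)) x y.
Proof.
split; first by move=> /(congr1 (fun p => (val p).2))/cls_eq; apply.
by move=> xy; apply: val_inj => /=; congr (_, _); apply/cls_eq.
Qed.

Lemma cls_leP k l x y (Sx : S x) (Sy : S y) :
  cls_le (@mkface k x Sx) (@mkface l y Sy) <->
  k <= l /\ exists z, [/\ S z, reach (pred1 (k : nat)) x z & reach (pred1 (l : nat)) y z].
Proof.
split=> [/andP[kl /set0Pn[z /setIP[/clsP xz /clsP yz]]]|[kl [z [Sz xz yz]]]].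
  by split=> //; exists z; split=> //; apply: reachS xz.
rewrite /cls_le /= kl; apply/set0Pn; exists z; rewrite inE.
by apply/andP; split; apply/clsP.
Qed.

Lemma cls_le_refl : reflexive cls_le.
Proof.
elim/face_type_ind=> k x Sx; apply/cls_leP; split=> //.
by exists x; split=> //; apply: reach_refl.
Qed.

Lemma cls_le_anti : antisymmetric cls_le.
Proof.
elim/face_type_ind=> k x Sx; elim/face_type_ind=> l y Sy.
move=> /andP[/cls_leP[kl [z [Sz xz yz]]] /cls_leP[lk _]].
have e : k = l by apply/val_inj/eqP; rewrite eqn_leq kl lk.
rewrite e in xz *; apply/mkface_eq.
by apply: reach_trans xz _; apply: reach_sym.
Qed.

Lemma cls_le_trans : transitive cls_le.
Proof.
elim/face_type_ind=> l y Sy; elim/face_type_ind=> k x Sx; elim/face_type_ind=> m z Sz.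
move=> /cls_leP[kl [u [Su xu yu]]] /cls_leP[lm [v [Sv yv zv]]].
have uv : reach (pred1 (l : nat)) u v by apply: reach_trans yv; apply: reach_sym.
have [t tl tu] := reach_split Su uv; have St := reachS Su tl.
apply/cls_leP; split; first exact: leq_trans kl lm.
exists t; split=> //.
  by apply: reach_trans xu _; apply: reach_sub tl => j /eqP->.
apply: reach_trans zv _; apply: reach_sym => //.
by apply: reach_sub tu => j /eqP->.
Qed.

Lemma flagrep_ex : exists (d : Order.disp_t) (P : finPOrderType d) (f : nat -> X -> P),
  flagrep n S r f /\ forall x y, S x -> S y -> eqf n f x y -> x = y.
Proof.
have [d [P [g [gb gle]]]] := finporder_of_rel cls_le_refl cls_le_anti cls_le_trans.
have [x0 Sx0] := S_ex.
exists d, P.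
pose dflt := @mkface ord0 x0 Sx0.
pose f k x := g (insubd dflt (inord k, cls (inord k : 'I_n.+2) x)).
have fE k x (Sx : S x) : f k x = g (mkface (inord k) Sx).
  by congr g; apply: val_inj; rewrite val_insubd face_clsP.
have kE k : k <= n.+1 -> (inord k : 'I_n.+2) = k :> nat by move=> kn; rewrite inordK.
have feq k x y : k <= n.+1 -> S x -> S y -> f k x = f k y <-> reach (pred1 k) x y.
  move=> kn Sx Sy; rewrite !fE; have := mkface_eq (inord k) Sx Sy.
  by rewrite kE // => H; split=> [/(bij_inj gb)/H|/H->].
(* With every index in [K], the intersection property leaves only the empty word. *)
have sep x y : S x -> S y -> eqf n f x y -> x = y.
  move=> Sx Sy e; have [k kn _|[//|j w] /= ] := @reach_meet predT x y Sx Sy.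
    by apply/feq => //; [lia|apply: e; lia].
  by rewrite /letters !andbF.
have fle k l x y : k <= n.+1 -> l <= n.+1 -> S x -> S y -> (f k x <= f l y)%O <->
    k <= l /\ exists z, [/\ S z, reach (pred1 k) x z & reach (pred1 l) y z].
  move=> kn ln Sx Sy; rewrite !fE gle; have := cls_leP (inord k) (inord l) Sx Sy.
  by rewrite !kE.
exists f; split=> //; split=> //.
- move=> j k x jn kn kj Sx; apply/feq => //; first exact: rS.
  by apply: reach_sym => //; apply: reach_r => //=; rewrite eq_sym.
- move=> j x jn Sx e; apply: (r_neq jn Sx); apply: sep => //; first exact: rS.
  move=> k kn; have [->//|kj] := eqVneq k j.
  apply/feq => //; first exact: rS.
  by apply: reach_sym => //; apply: reach_r => //=; rewrite eq_sym.
- move=> K x y Sx Sy H; have [k kn Kk|w aw wE] := @reach_meet K x y Sx Sy.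
    by apply/feq => //; [lia|apply: H].
  by exists w => // k kn; rewrite wE.
- move=> k x y kn Sx Sy /feq xy; have [z zl zu] := reach_split Sx (xy kn Sx Sy).
  have Sz := reachS Sx zl; exists z; split=> // l ll.
    apply/feq => //; [lia|apply: reach_sym => //].
    by apply: reach_sub zl => j /eqP->.
  by apply/feq => //; [lia|apply: reach_sub zu => j /eqP->; lia].
- move=> p; have [h gK hK] := gb; rewrite -(hK p).
  elim/face_type_ind: (h p) => k x Sx; exists k, x; split=> //.
    by rewrite -ltnS.
  by rewrite fE inord_val.
- move=> k l x /andP[kl ln] Sx; apply/fle => //; first exact: leq_trans kl ln.
  by split=> //; exists x; split=> //; apply: reach_refl.
move=> k l x y kn ln Sx Sy /fle[] // kl [z [Sz xz yz]]; split=> //.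
by exists z; split=> //; apply/feq => //; apply: reach_sym.
Qed.

End Construct.

(** * Flags of the hexagonal tessellation *)

Section HexFlags.
Local Open Scope ring_scope.
Local Open Scope quotient_scope.

Definition hexflag := (hexlattice * nat * bool)%type.

Definition unit6 (k : nat) : hexlattice :=
  match k with
  | 0%N => (1, 0) | 1%N => (0, 1) | 2%N => (-1, 1)
  | 3%N => (-1, 0) | 4%N => (0, -1) | _ => (1, -1)
  end.

(* The flag (a, k, e) consists of the hexagon centred at a, its edge towards
   a + zeta ^ k and the end of that edge on the side of a + zeta ^ (k + 1) if
   e = false and of a + zeta ^ (k - 1) if e = true. *)
Definition hexS (x : hexflag) : Prop := (x.1.2 < 6)%N.

(** Each involution negates the last component, which is thus the orientation of the flag. In
    [k + 5] the 5 stands for -1 modulo 6; in [k + 3] the direction of the edge is reversed, being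
    seen from the other hexagon. *)
Definition hexr (j : nat) (x : hexflag) : hexflag :=
  let: (a, k, e) := x in
  match j with
  | 1%N => (a, k, ~~ e)
  | 2%N => (a, ((if e then k + 5 else k + 1) %% 6)%N, ~~ e)
  | _ => (a + unit6 k, ((k + 3) %% 6)%N, ~~ e)
  end.

(** The corner between the directions m and m + 1 of the hexagon a, and its side in direction k, are
    renamed to the one name that the tessellation has for them, which may be based at a neighbouring
    hexagon. *)
Definition hexf (j : nat) (x : hexflag) : hexface :=
  let: (a, k, e) := x in
  match j with
  | 0%N => HexLeast
  | 1%N =>
    match (if e then (k + 5) %% 6 else k)%N with
    | 0%N => HexVertex false a
    | 1%N => HexVertex true a
    | 2%N => HexVertex false (a + unit6 3)
    | 3%N => HexVertex true (a + unit6 4)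
    | 4%N => HexVertex false (a + unit6 4)
    | _ => HexVertex true (a + unit6 5)
    end
  | 2%N => if (k < 3)%N then HexEdge (inord k) a else HexEdge (inord (k - 3)) (a + unit6 k)
  | 3%N => Hexagon a
  | _ => HexGreatest
  end.

Definition tr (t : hexlattice) (x : hexflag) : hexflag := (t + x.1.1, x.1.2, x.2).

Lemma hexr_tr j t x : hexr j (tr t x) = tr t (hexr j x).
Proof. by case: x j => [[a k] e] [|[|[|j]]] //=; rewrite /tr /= addrA. Qed.

Lemma act_tr w t x : act hexr w (tr t x) = tr t (act hexr w x).
Proof. by elim: w => //= j w ->; rewrite hexr_tr. Qed.

Lemma hexf_tr j t x : hexf j (tr t x) = hex_translate t (hexf j x).
Proof.
case: x => [[a k] e]; rewrite /tr /hexf /=; case: j => [|[|[|[|j]]]] //=.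
  by case: (if e then _ else _) => [|[|[|[|[|m]]]]] //=; rewrite addrA.
by case: ifP => //=; rewrite addrA.
Qed.

Lemma k6_ind (Pr : nat -> Prop) : Pr 0%N -> Pr 1%N -> Pr 2%N -> Pr 3%N -> Pr 4%N -> Pr 5%N ->
  forall k, (k < 6)%N -> Pr k.
Proof. by move=> ? ? ? ? ? ?; do 6!case=> //. Qed.

Lemma HexEdge_inj (k l : nat) a a' : (k < 3)%N -> (l < 3)%N ->
  HexEdge (inord k) a = HexEdge (inord l) a' -> k = l /\ a = a'.
Proof. by move=> k3 l3 [/(congr1 val)]; rewrite /= !inordK. Qed.

Lemma HexVertex_inj u v a a' : HexVertex u a = HexVertex v a' -> u = v /\ a = a'.
Proof. by case. Qed.

Lemma pairE (a1 a2 b1 b2 : int) : (a1, a2) = (b1, b2) :> hexlattice -> a1 = b1 /\ a2 = b2.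
Proof. by case. Qed.

Lemma hexS_r j x : hexS x -> hexS (hexr j x).
Proof. by case: x => [[a k] e]; case: j => [|[|[|j]]] //= _; rewrite /hexS /= ltn_mod. Qed.

Lemma hexrK j x : (0 < j <= 3)%N -> hexS x -> hexr j (hexr j x) = x.
Proof.
case: x => [[[a1 a2] k] e]; rewrite /hexS /= => jn k6.
case: j jn => [|[|[|[|j]]]] // _; first by rewrite /= negbK.
  by move: k k6; apply: k6_ind; case: e.
by move: k k6; apply: k6_ind; rewrite /= ?addpE negbK; congr (_, _, _); congr pair; lia.
Qed.

Lemma hexf_fix j k x : (0 < j <= 3)%N -> (k <= 4)%N -> k != j -> hexS x ->
  hexf k (hexr j x) = hexf k x.
Proof.
case: x => [[[a1 a2] i] e]; rewrite /hexS /= => jn kn kj i6.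
case: j jn kj => [|[|[|[|j]]]] //; case: k kn => [|[|[|[|[|k]]]]] // _ _ _.
- by move: i i6; apply: k6_ind; case: e; rewrite /= ?addpE //; congr HexVertex; congr pair; lia.
- by move: i i6; apply: k6_ind; case: e; rewrite /= ?addpE //; congr HexVertex; congr pair; lia.
by move: i i6; apply: k6_ind; rewrite /= ?addpE //; congr HexEdge; congr pair; lia.
Qed.

Lemma hexf2_eq x y : hexS x -> hexS y -> hexf 2 x = hexf 2 y ->
  [\/ y = x, y = hexr 1 x, y = hexr 3 x | y = hexr 1 (hexr 3 x)].
Proof.
case: x y => [[[a1 a2] i] e] [[[b1 b2] j] e']; rewrite /hexS => /= i6 j6.
move: i i6 j j6; apply: k6_ind; apply: k6_ind; rewrite /= ?addpE => /HexEdge_inj[] // _ /pairE[ea eb];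
  (have [->|->] : e' = e \/ e' = ~~ e by case: e e' => [] []; auto);
  first [by apply: Or41; congr (_, _, _); congr pair; lia
        |by apply: Or42; congr (_, _, _); congr pair; lia
        |by apply: Or43; congr (_, _, _); congr pair; lia
        |by apply: Or44; rewrite negbK; congr (_, _, _); congr pair; lia].
Qed.

Lemma hexf1_eq x y : hexS x -> hexS y -> hexf 1 x = hexf 1 y ->
  [\/ y = x, y = hexr 2 x, y = hexr 3 x | [\/ y = hexr 2 (hexr 3 x),
    y = hexr 3 (hexr 2 x) | y = hexr 2 (hexr 3 (hexr 2 x))]].
Proof.
case: x y => [[[a1 a2] i] e] [[[b1 b2] j] e']; rewrite /hexS => /= i6 j6.
case: e e' => [] []; move: i i6 j j6; apply: k6_ind; apply: k6_ind;
  rewrite /= ?addpE => /HexVertex_inj[] // _ /pairE[ea eb];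
  first [by apply: Or41; congr (_, _, _); congr pair; lia
        |by apply: Or42; congr (_, _, _); congr pair; lia
        |by apply: Or43; congr (_, _, _); congr pair; lia
        |by apply: Or44; apply: Or31; congr (_, _, _); congr pair; lia
        |by apply: Or44; apply: Or32; congr (_, _, _); congr pair; lia
        |by apply: Or44; apply: Or33; congr (_, _, _); congr pair; lia].
Qed.

Lemma hexf_le k l x : (k <= l <= 4)%N -> hexS x -> hexface_le (hexf k x) (hexf l x).
Proof.
case: x => [[[a1 a2] i] e]; rewrite /hexS /= => kl i6.
case: k kl => [|[|[|[|[|k]]]]]; case: l => [|[|[|[|[|l]]]]] // _;
  rewrite ?hexface_le_refl //;
  (try by rewrite /hexface_le; do ![case: ifP => _ //=]);
  case: e; move: i i6; apply: k6_ind;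
  by rewrite /hexface_le /= /zeta /rot60 /= ?inordK //= ?addpE ?inE ?xpair_eqE /=; lia.
Qed.

Lemma hexrk_f k x : (k <= 4)%N -> hexrk (hexf k x) = k.
Proof.
case: x => [[a i] e]; case: k => [|[|[|[|[|k]]]]] //= _; last by case: ifP.
by case: (if e then _ else _) => [|[|[|[|[|m]]]]].
Qed.

Ltac hexle := rewrite /hexface_le /= /zeta /rot60 /= ?inordK //= ?addpE ?inE ?xpair_eqE /=.

Lemma hexf12 x y : hexS x -> hexS y -> hexface_le (hexf 1 x) (hexf 2 y) ->
  [\/ hexf 2 x = hexf 2 y, hexf 2 (hexr 2 x) = hexf 2 y
    | hexf 2 (hexr 2 (hexr 3 x)) = hexf 2 y].
Proof.
case: x y => [[[a1 a2] i] e] [[[b1 b2] j] e']; rewrite /hexS => /= i6 j6.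
case: e; move: i i6 j j6; apply: k6_ind; apply: k6_ind; hexle => H;
  first [by exfalso; clear -H; lia
        |by apply: Or31; congr HexEdge; congr pair; clear -H; lia
        |by apply: Or32; congr HexEdge; congr pair; clear -H; lia
        |by apply: Or33; congr HexEdge; congr pair; clear -H; lia].
Qed.

Lemma hexf13 x y : hexS x -> hexface_le (hexf 1 x) (hexf 3 y) ->
  [\/ hexf 3 x = hexf 3 y, hexf 3 (hexr 3 x) = hexf 3 y
    | hexf 3 (hexr 3 (hexr 2 x)) = hexf 3 y].
Proof.
case: x y => [[[a1 a2] i] e] [[[b1 b2] j] e']; rewrite /hexS => /= i6.
case: e; move: i i6; apply: k6_ind; hexle; rewrite ?andbT => /or3P[] H;
  first [by apply: Or31; congr Hexagon; congr pair; clear -H; lia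
        |by apply: Or32; congr Hexagon; congr pair; clear -H; lia
        |by apply: Or33; congr Hexagon; congr pair; clear -H; lia].
Qed.

Lemma hexf23 x y : hexS x -> hexface_le (hexf 2 x) (hexf 3 y) ->
  hexf 3 x = hexf 3 y \/ hexf 3 (hexr 3 x) = hexf 3 y.
Proof.
case: x y => [[[a1 a2] i] e] [[[b1 b2] j] e']; rewrite /hexS => /= i6.
move: i i6; apply: k6_ind; hexle; rewrite ?andbT => /orP[] H;
  first [by left; congr Hexagon; congr pair; clear -H; lia
        |by right; congr Hexagon; congr pair; clear -H; lia].
Qed.

Lemma hexf0 x y : hexf 0 x = hexf 0 y. Proof. by case: x y => [[? ?] ?] [[? ?] ?]. Qed.
Lemma hexf4 x y : hexf 4 x = hexf 4 y. Proof. by case: x y => [[? ?] ?] [[? ?] ?]. Qed.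

Lemma hexf_le_inv k l x y : (k <= 4)%N -> (l <= 4)%N -> hexS x -> hexS y ->
  hexface_le (hexf k x) (hexf l y) ->
  (k <= l)%N /\ exists z, [/\ hexS z, hexf k z = hexf k x & hexf l z = hexf l y].
Proof.
move=> kn ln Sx Sy le; have := hexface_le_rk le; rewrite !hexrk_f // => kl; split=> //.
have [e|ne] := eqVneq k l.
  exists x; split=> //; move: le; rewrite e => /hexface_le_eq; apply.
  by rewrite !hexrk_f.
have [->|k0] := eqVneq k 0%N; first by exists y; split=> //; apply: hexf0.
have [->|l0] := eqVneq l 4%N; first by exists x; split=> //; apply: hexf4.
have : k = 1%N /\ l = 2%N \/ (k = 1%N /\ l = 3%N \/ k = 2%N /\ l = 3%N) by lia.
have S2 := hexS_r 2 Sx; have S3 := hexS_r 3 Sx; have S23 := hexS_r 2 S3; have S32 := hexS_r 3 S2.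
case=> [|[]] [kE lE]; rewrite {}kE {}lE {k l kn ln kl ne k0 l0} in le *.
- case: (hexf12 Sx Sy le) => e; [exists x|exists (hexr 2 x)|exists (hexr 2 (hexr 3 x))];
    by split=> //; rewrite !hexf_fix.
- case: (hexf13 Sx le) => e; [exists x|exists (hexr 3 x)|exists (hexr 3 (hexr 2 x))];
    by split=> //; rewrite !hexf_fix.
- case: (hexf23 Sx le) => e; [exists x|exists (hexr 3 x)];
    by split=> //; rewrite !hexf_fix.
Qed.

(** Vertices form two classes under translation and edges three, according to direction. These
    invariants survive in every quotient by translations and show there that r_1 moves the vertex
    and r_2 the edge. *)
Definition vertex_type (x : hexface) := if x is HexVertex u _ then u else false.
Definition edge_type (x : hexface) : nat := if x is HexEdge k _ then k else 3.

Lemma vertex_type_tr t x : vertex_type (hex_translate t x) = vertex_type x.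
Proof. by case: x. Qed.

Lemma edge_type_tr t x : edge_type (hex_translate t x) = edge_type x.
Proof. by case: x. Qed.

Lemma vertex_type_r1 x : hexS x -> vertex_type (hexf 1 (hexr 1 x)) = ~~ vertex_type (hexf 1 x).
Proof.
by case: x => [[a i] e]; rewrite /hexS /= => i6; move: i i6; apply: k6_ind; case: e.
Qed.

Lemma edge_type_r2 x : hexS x -> edge_type (hexf 2 (hexr 2 x)) != edge_type (hexf 2 x).
Proof.
by case: x => [[a i] e]; rewrite /hexS /= => i6; move: i i6; apply: k6_ind; case: e; rewrite /= ?inordK.
Qed.

Definition rotf (x : hexflag) : hexflag := (rot60 x.1.1, ((x.1.2 + 1) %% 6)%N, x.2).

Lemma rotf_r j x : (0 < j <= 3)%N -> hexS x -> hexr j (rotf x) = rotf (hexr j x).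
Proof.
case: x => [[[a1 a2] i] e]; rewrite /hexS /= => jn i6; rewrite /rotf /rot60 /=.
case: j jn => [|[|[|[|j]]]] // _ /=.
  by move: i i6; apply: k6_ind; case: e.
by move: i i6; apply: k6_ind; rewrite /= ?addpE; congr (_, _, _); congr pair; lia.
Qed.

(** The reflection that sends zeta to its inverse 1 - zeta, whence a1 + a2 zeta goes to (a1 + a2) -
    a2 zeta and orientation is reversed. *)
Definition conjf (x : hexflag) : hexflag :=
  ((x.1.1.1 + x.1.1.2, - x.1.1.2), ((6 - x.1.2) %% 6)%N, ~~ x.2).

Lemma conjf_r j x : (0 < j <= 3)%N -> hexS x -> hexr j (conjf x) = conjf (hexr j x).
Proof.
case: x => [[[a1 a2] i] e]; rewrite /hexS /= => jn i6; rewrite /conjf /=.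
case: j jn => [|[|[|[|j]]]] // _ /=.
  by move: i i6; apply: k6_ind; case: e.
by move: i i6; apply: k6_ind; rewrite /= ?addpE; congr (_, _, _); congr pair; lia.
Qed.

Lemma hex_actS w x : hexS x -> hexS (act hexr w x).
Proof. by move=> Sx; elim: w => //= j w; apply: hexS_r. Qed.

Lemma rotf_act w x : word 3 w -> hexS x -> act hexr w (rotf x) = rotf (act hexr w x).
Proof.
move=> ww Sx; elim: w ww => //= j w IH /andP[/and3P[j0 jn _] ww].
by rewrite IH // rotf_r ?j0 //; apply: hex_actS.
Qed.

Lemma conjf_act w x : word 3 w -> hexS x -> act hexr w (conjf x) = conjf (act hexr w x).
Proof.
move=> ww Sx; elim: w ww => //= j w IH /andP[/and3P[j0 jn _] ww].
by rewrite IH // conjf_r ?j0 //; apply: hex_actS.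
Qed.

Definition hex0 : hexflag := ((0, 0), 0%N, false).

Definition hex_reach (K : pred nat) x y := exists2 w, all (letters 3 K) w & act hexr w x = y.

Lemma hex_reach_trans K y x z : hex_reach K x y -> hex_reach K y z -> hex_reach K x z.
Proof.
move=> [w aw <-] [u au <-]; exists (u ++ w); first by rewrite all_cat au.
exact: act_cat.
Qed.

Lemma hex_reach_rev (K : pred nat) j x : hexS x -> letters 3 K j -> hex_reach K (hexr j x) x.
Proof.
move=> Sx lj; exists [:: j]; first by rewrite /= lj.
by apply: hexrK => //; case/and3P: lj => -> ->.
Qed.

Lemma hex_reach_sym K x y : hexS x -> hex_reach K x y -> hex_reach K y x.
Proof.
move=> Sx [w aw <-]; elim: w aw => [|j w IH] /=; first by exists [::].
case/andP=> lj aw; apply: hex_reach_trans (IH aw).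
by apply: hex_reach_rev => //; apply: hex_actS.
Qed.

Lemma hex_reach_0 (K : pred nat) a i e : (i < 6)%N -> ~~ K 1%N -> ~~ K 2%N ->
  hex_reach K (a, i, e) (a, 0%N, false).
Proof.
(* Each block turns the flag by one side around its hexagon, towards direction 0; the optional final
   letter, which acts first, corrects the orientation. *)
move=> i6 K1 K2; exists (flatten (nseq i [:: 2%N; 1%N]) ++ (if e then [:: 1%N] else [::])).
  have l1 : letters 3 K 1 by rewrite /letters K1.
  have l2 : letters 3 K 2 by rewrite /letters K2.
  by rewrite all_cat; case: e; rewrite /= ?l1 ?andbT; elim: i {i6} => //= i ->; rewrite l1 l2.
by move: i i6; apply: k6_ind; case: e.
Qed.

Lemma hex_reach_same (K : pred nat) a i e j e' : (i < 6)%N -> (j < 6)%N -> ~~ K 1%N -> ~~ K 2%N ->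
  hex_reach K (a, i, e) (a, j, e').
Proof.
move=> i6 j6 K1 K2; apply: hex_reach_trans (hex_reach_0 a e i6 K1 K2) _.
by apply: hex_reach_sym => //; apply: hex_reach_0.
Qed.

Lemma hex_reach_all x y : hexS x -> hexS y -> hex_reach pred0 x y.
Proof.
pose o (a : hexlattice) : hexflag := (a, 0%N, false).
have So a : hexS (o a) by [].
have st a k : (k < 6)%N -> hex_reach pred0 (o a) (o (a + unit6 k)).
  move=> k6; apply: (hex_reach_trans (y := (a, k, false))); first exact: hex_reach_same.
  apply: (hex_reach_trans (y := hexr 3 (a, k, false))); first by exists [:: 3%N].
  by apply: hex_reach_same; rewrite ?ltn_mod.
have s1 a1 a2 (m : nat) : hex_reach pred0 (o (a1, a2)) (o (a1 + m%:Z, a2)).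
  elim: m => [|m IH]; first by rewrite addr0; exists [::].
  apply: hex_reach_trans IH _; have := st (a1 + m%:Z, a2) 0%N isT.
  by congr (hex_reach _ _ (_, _, _)); rewrite addpE; congr pair; lia.
have s2 a1 a2 (m : nat) : hex_reach pred0 (o (a1, a2)) (o (a1, a2 + m%:Z)).
  elim: m => [|m IH]; first by rewrite addr0; exists [::].
  apply: hex_reach_trans IH _; have := st (a1, a2 + m%:Z) 1%N isT.
  by congr (hex_reach _ _ (_, _, _)); rewrite addpE; congr pair; lia.
have S1 a1 a2 b1 : hex_reach pred0 (o (a1, a2)) (o (b1, a2)).
  have [le|le] : a1 <= b1 \/ b1 <= a1 by lia.
    by have := s1 a1 a2 `|b1 - a1|%N; congr (hex_reach _ _ (_, _, _)); congr pair; lia.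
  apply: hex_reach_sym => //.
  by have := s1 b1 a2 `|a1 - b1|%N; congr (hex_reach _ _ (_, _, _)); congr pair; lia.
have S2 a1 a2 b2 : hex_reach pred0 (o (a1, a2)) (o (a1, b2)).
  have [le|le] : a2 <= b2 \/ b2 <= a2 by lia.
    by have := s2 a1 a2 `|b2 - a2|%N; congr (hex_reach _ _ (_, _, _)); congr pair; lia.
  apply: hex_reach_sym => //.
  by have := s2 a1 b2 `|a2 - b2|%N; congr (hex_reach _ _ (_, _, _)); congr pair; lia.
case: x y => [[[a1 a2] i] e] [[[b1 b2] j] e'] i6 j6.
apply: hex_reach_trans (hex_reach_0 _ _ i6 _ _) _ => //.
apply: hex_reach_trans (S1 a1 a2 b1) _; apply: hex_reach_trans (S2 b1 a2 b2) _.
by apply: hex_reach_sym => //; apply: hex_reach_0.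
Qed.

End HexFlags.

(** * Flag systems of the toroidal maps *)

Section TorusRep.
Local Open Scope ring_scope.
Local Open Scope quotient_scope.
Variables b c : int.
Let Lat := translation_lattice b c.
Hypothesis Lat1 : ~ Lat (1, 0).

Lemma Lat_opp t : Lat t -> Lat (- t).
Proof. by move=> [k [l ->]]; exists (- k), (- l); rewrite !mulrNz opprD. Qed.

Lemma pair_mulz (a1 a2 k : int) : ((a1, a2) : hexlattice) *~ k = (a1 * k, a2 * k).
Proof.
have H (m : nat) : ((a1, a2) : hexlattice) *+ m = (a1 * m%:Z, a2 * m%:Z).
  elim: m => [|m IH]; first by rewrite mulr0n !mulr0.
  by rewrite mulrS IH addpE; congr pair; lia.
case: k => m; first exact: H.
transitivity (- (((a1, a2) : hexlattice) *+ m.+1)); first by [].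
by rewrite H NegzE !mulrN.
Qed.

Lemma LatE (t1 t2 : int) : Lat (t1, t2) <->
  exists k l : int, t1 = b * k - c * l /\ t2 = c * k + (b + c) * l.
Proof.
split=> [[k [l]]|[k [l [-> ->]]]]; last first.
  by exists k, l; rewrite /rot60 /= !pair_mulz addpE mulNr.
by rewrite /rot60 /= !pair_mulz addpE mulNr => -[-> ->]; exists k, l.
Qed.

Lemma Lat_rot t : Lat t -> Lat (rot60 t).
Proof.
by case: t => t1 t2 /LatE[k [l [-> ->]]]; apply/LatE; exists (- l), (k + l); split=> /=; ring.
Qed.

Lemma rot60_6 t : rot60 (rot60 (rot60 (rot60 (rot60 (rot60 t))))) = t.
Proof. by case: t => t1 t2; rewrite /rot60 /=; congr pair; lia. Qed.

(** The lattice is stable under rotation by 60 degrees, which turns every unit vector into (1, 0).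
    So no hexagon is identified with a neighbour; this alone makes the quotient polytopal. *)
Lemma Lat_unit k : ~ Lat (unit6 k).
Proof.
suff H m : (m < 6)%N -> ~ Lat (unit6 m) by case: k => [|[|[|[|[|[|k]]]]]]; try exact: H; apply: (H 5%N).
have r0 a e : rot60 (a, e) = (- e, a + e) by [].
have R1 t : Lat t -> Lat (rot60 t) by apply: Lat_rot.
have R2 t : Lat t -> Lat (rot60 (rot60 t)) by move=> /R1/R1.
have R3 t : Lat t -> Lat (rot60 (rot60 (rot60 t))) by move=> /R2/R1.
move: m; apply: k6_ind => // H; apply: Lat1.
- by move/R3/R2: H; rewrite !r0; congr Lat.
- by move/R3/R1: H; rewrite !r0; congr Lat.
- by move/R3: H; rewrite !r0; congr Lat.
- by move/R2: H; rewrite !r0; congr Lat.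
- by move/R1: H; rewrite !r0; congr Lat.
Qed.

Definition torf k x : torus63 b c := \pi_(torus63 b c) (hexf k x).

Lemma torus_pi_eq u v : \pi_(torus63 b c) u = \pi v <->
  exists2 t, Lat t & v = hex_translate t u.
Proof. by split=> [/eqmodP/asboolP|H]; [|apply/eqmodP/asboolP]. Qed.

Lemma torf_eq k x y : torf k x = torf k y <-> exists2 t, Lat t & hexf k (tr t x) = hexf k y.
Proof.
rewrite torus_pi_eq; split=> -[t Lt e]; exists t => //; first by rewrite hexf_tr.
by rewrite -hexf_tr.
Qed.

Lemma torf_tr k t x : Lat t -> torf k (tr t x) = torf k x.
Proof.
move=> Lt; apply/esym/torf_eq; exists t => //.
Qed.

Lemma subpE (a1 a2 b1 b2 : int) : (a1, a2) - (b1, b2) = (a1 - b1, a2 - b2) :> hexlattice.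
Proof. by []. Qed.

Lemma tr_unit (a s : hexlattice) k : Lat s -> s + a + unit6 k = a -> False.
Proof.
move=> Ls e; apply: (@Lat_unit k).
have -> : unit6 k = - s; last exact: Lat_opp.
by apply: (addrI (s + a)); rewrite e addrAC subrr add0r.
Qed.

(** If the edges are congruent but the flags are not on the same edge of the plane, the lattice
    vector matching the edges carries the hexagon to a neighbour, which [tr_unit] forbids. *)
Lemma torf32 x y : hexS x -> hexS y -> hexf 3 x = hexf 3 y -> torf 2 x = torf 2 y ->
  y = x \/ y = hexr 1 x.
Proof.
move=> Sx Sy h3 /torf_eq[s Ls /(hexf2_eq (Sx : hexS (tr s x)) Sy)].
case: x Sx h3 => [[a i] e] Sx; case: y Sy => [[a' i'] e'] Sy [aE].
rewrite -{}aE {a'} in Sy *; case; rewrite /tr /=.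
- by case=> _ -> ->; left.
- by case=> _ -> ->; right.
- by case=> /esym/(tr_unit Ls).
- by case=> /esym/(tr_unit Ls).
Qed.

Lemma torf31 x y : hexS x -> hexS y -> hexf 3 x = hexf 3 y -> torf 1 x = torf 1 y ->
  y = x \/ y = hexr 2 x.
Proof.
move=> Sx Sy h3 /torf_eq[s Ls /(hexf1_eq (Sx : hexS (tr s x)) Sy)].
case: x Sx h3 => [[a i] e] Sx; case: y Sy => [[a' i'] e'] Sy [aE].
rewrite -{}aE {a'} in Sy *; case; rewrite /tr /=.
- by case=> _ -> ->; left.
- by case=> _ -> ->; right.
- by case=> /esym/(tr_unit Ls).
case; by case=> /esym/(tr_unit Ls).
Qed.

Lemma torf21 x y : hexS x -> hexS y -> hexf 2 x = hexf 2 y -> torf 1 x = torf 1 y ->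
  y = x \/ y = hexr 3 x.
Proof.
move=> Sx Sy /(hexf2_eq Sx Sy) yE /torf_eq[s Ls].
rewrite hexf_tr => /(congr1 vertex_type); rewrite vertex_type_tr => ty.
case: yE => yE; [by left| |by right|]; move: ty; rewrite yE vertex_type_r1 //; last exact: hexS_r.
  by case: (vertex_type _).
by rewrite hexf_fix //; case: (vertex_type _).
Qed.

Lemma torf_conn K x y t : Lat t -> hex_reach K (tr t x) y ->
  exists2 w, all (letters 3 K) w & forall k, (k <= 4)%N -> torf k (act hexr w x) = torf k y.
Proof.
move=> Lt [w aw wE]; exists w => // k kn.
by rewrite -wE act_tr torf_tr.
Qed.

Lemma torus_rep : flagrep 3 hexS hexr torf.
Proof.
have ex3 x y : torf 3 x = torf 3 y -> exists2 t, Lat t & hexf 3 (tr t x) = hexf 3 y by move/torf_eq.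
split.
- by exists hex0.
- by move=> j x _; apply: hexS_r.
- exact: hexrK.
- by move=> j k x jn kn kj Sx; rewrite /torf hexf_fix.
- move=> j x jn Sx /torf_eq[t Lt]; rewrite hexf_tr.
  case: j jn => [|[|[|[|j]]]] // _.
  + move/(congr1 vertex_type); rewrite vertex_type_tr vertex_type_r1 //.
    by case: (vertex_type _).
  + move/(congr1 edge_type); rewrite edge_type_tr => /eqP.
    by rewrite (negPf (edge_type_r2 Sx)).
  + by case: x Sx => [[a i] e] Sx /= [] /[!addrA] e'; apply: (tr_unit Lt e').
- move=> K x y Sx Sy H.
  have H3 : K 3%N -> torf 3 x = torf 3 y by apply: H.
  have H2 : K 2%N -> torf 2 x = torf 2 y by apply: H.
  have H1 : K 1%N -> torf 1 x = torf 1 y by apply: H.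
  have one j : ~~ K j -> (0 < j <= 3)%N -> forall z, hex_reach K z (hexr j z).
    move=> Kj jn z; exists [:: j] => //=; rewrite andbT /letters Kj.
    by case/andP: jn => -> ->.
  have nul z : hex_reach K z z by exists [::].
  have trf k t : Lat t -> torf k (tr t x) = torf k y -> torf k x = torf k y by move=> Lt; rewrite torf_tr.
  (* In each case a lattice translation makes the face of highest index in [K] agree with that of y
     already in the plane, where the flags through it are known. *)
  case K3: (K 3%N); [have [t Lt e3] := ex3 _ _ (H3 K3)|].
    have St : hexS (tr t x) by [].
    have E k : torf k x = torf k y -> torf k (tr t x) = torf k y by rewrite torf_tr.
    case K2: (K 2%N).
      case K1: (K 1%N).
        exists [::] => // k kn; rewrite /act /=.
        case: k kn => [|[|[|[|[|k]]]]] // _; [|exact: H1|exact: H2|exact: H3|].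
          by rewrite /torf (hexf0 x y).
        by rewrite /torf (hexf4 x y).
      apply: (torf_conn Lt); case: (torf32 St Sy e3 (E _ (H2 K2))) => -> //.
      by apply: one; rewrite ?K1.
    case K1: (K 1%N).
      apply: (torf_conn Lt); case: (torf31 St Sy e3 (E _ (H1 K1))) => -> //.
      by apply: one; rewrite ?K2.
    apply: (torf_conn Lt); case: x y Sx Sy {H H1 H2 H3 trf St E} e3 => [[a i] e] [[a' i'] e'] Sx Sy /=.
    by case=> <-; apply: hex_reach_same; rewrite ?K1 ?K2.
  case K2: (K 2%N); [have /torf_eq[t Lt e2] := H2 K2|].
    have St : hexS (tr t x) by [].
    have E k : torf k x = torf k y -> torf k (tr t x) = torf k y by rewrite torf_tr.
    apply: (torf_conn Lt); case K1: (K 1%N).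
      case: (torf21 St Sy e2 (E _ (H1 K1))) => -> //.
      by apply: one; rewrite ?K3.
    case: (hexf2_eq St Sy e2) => -> //; try by apply: one; rewrite ?K1 ?K3.
    by apply: (hex_reach_trans (y := hexr 3 (tr t x))); apply: one; rewrite ?K1 ?K3.
  case K1: (K 1%N); [have /torf_eq[t Lt e1] := H1 K1|].
    have St : hexS (tr t x) by [].
    have o2 z : hex_reach K z (hexr 2 z) by apply: one; rewrite ?K2.
    have o3 z : hex_reach K z (hexr 3 z) by apply: one; rewrite ?K3.
    apply: (torf_conn Lt); case: (hexf1_eq St Sy e1) => [-> //|-> //|-> //|[]->].
    + exact: hex_reach_trans (o3 _) (o2 _).
    + exact: hex_reach_trans (o2 _) (o3 _).
    + exact: hex_reach_trans (hex_reach_trans (o2 _) (o3 _)) (o2 _).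
  have [w aw wE] := hex_reach_all Sx Sy; exists w; last by move=> k kn; rewrite wE.
  apply: sub_all aw => -[|[|[|[|j]]]] //; rewrite /letters ?K1 ?K2 ?K3 //.
(* The least and greatest faces are constant, so y itself serves for k <= 1 and x for k >= 3. Only
   gluing along an edge remains. *)
- move=> k x y kn Sx Sy e.
  have t0 u v : torf 0 u = torf 0 v by rewrite /torf (hexf0 u v).
  have t4 u v : torf 4 u = torf 4 v by rewrite /torf (hexf4 u v).
  case: k kn e => [|[|[|[|[|k]]]]] // _ e.
  + by exists y; split=> // -[|l] // _; apply: t0.
  + by exists y; split=> // -[|[|l]] // _; apply: t0.
  + have /torf_eq[t Lt e2] := e; have St : hexS (tr t x) by [].
    have S3 : hexS (hexr 3 (tr t x)) by apply: hexS_r.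
    have ff j k z : (0 < j <= 3)%N -> (k <= 4)%N -> k != j -> hexS z -> torf k (hexr j z) = torf k z.
      by move=> *; rewrite /torf hexf_fix.
    have [z [Sz z1 z2 z3]] : exists z, [/\ hexS z, torf 1 z = torf 1 x, torf 2 z = torf 2 y
        & torf 3 z = torf 3 y].
      case: (hexf2_eq St Sy e2) => yE.
      * by exists y; split=> //; rewrite yE torf_tr.
      * by exists (tr t x); split=> //; rewrite ?torf_tr // yE ff // torf_tr.
      * by exists y; split=> //; rewrite yE ff // torf_tr.
      * exists (hexr 3 (tr t x)); split=> //; first by rewrite ff // torf_tr.
          by rewrite yE (ff 1%N 2%N).
        by rewrite yE (ff 1%N 3%N).
    exists z; split=> // -[|[|[|[|[|l]]]]] // _ //.
    by rewrite e.
  + exists x; split=> // -[|[|[|[|[|l]]]]] // _; exact: t4.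
  + exists x; split=> // -[|[|[|[|[|l]]]]] // _; exact: t4.
- move=> p; rewrite -(reprK p); case: (repr p) => [|u a|k a|a|].
  + by exists 0%N, hex0.
  + exists 1%N, (a, nat_of_bool u, false); split=> //; first by case: u.
    by rewrite /torf; case: u.
  + exists 2%N, (a, nat_of_ord k, false); split=> //.
      by rewrite /hexS /=; apply: leq_trans (ltn_ord k) _.
    by rewrite /torf /hexf ltn_ord inord_val.
  + by exists 3%N, (a, 0%N, false).
  + by exists 4%N, hex0.
- move=> k l x kl Sx; apply/asboolP; exists (hexf k x), (hexf l x); split=> //.
  exact: hexf_le.
move=> k l x y kn ln Sx Sy /asboolP[u [v [uE vE le]]].
have [t Lt ut] : exists2 t, Lat t & u = hexf k (tr t x).
  by have /torus_pi_eq[t Lt ->] := esym uE; exists t; rewrite // hexf_tr.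
have [s Ls vs] : exists2 t, Lat t & v = hexf l (tr t y).
  by have /torus_pi_eq[s Ls ->] := esym vE; exists s; rewrite // hexf_tr.
rewrite ut vs in le.
have [kl [z [Sz zk zl]]] := hexf_le_inv kn ln (Sx : hexS (tr t x)) (Sy : hexS (tr s y)) le.
split=> //; exists z; split=> //; rewrite /torf ?zk ?zl; exact: torf_tr.
Qed.

Lemma torus_eqf a i e a' i' e' : (i < 6)%N -> (i' < 6)%N ->
  eqf 3 torf (a, i, e) (a', i', e') <-> [/\ i = i', e = e' & Lat (a' - a)].
Proof.
move=> i6 i6'; split=> [E|[<- <- L] k kn]; last first.
  by rewrite -(torf_tr k (a, i, e) L) /tr /= subrK.
have /torf_eq[t Lt [/= aE]] := E 3%N isT.
have E2 : torf 2 (tr t (a, i, e)) = torf 2 (a', i', e') by rewrite torf_tr // E.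
have h3 : hexf 3 (tr t (a, i, e)) = hexf 3 (a', i', e') by rewrite /= aE.
have [] := torf32 (i6 : hexS (tr t (a, i, e))) (i6' : hexS (a', i', e')) h3 E2.
  by case=> -> -> ->; rewrite addrK; split.
move=> yE; have : torf 1 (tr t (a, i, e)) = torf 1 (a', i', e') by rewrite torf_tr // E.
rewrite yE => /torf_eq[s _]; rewrite hexf_tr => /(congr1 vertex_type).
rewrite vertex_type_tr vertex_type_r1 //.
by case: (vertex_type _).
Qed.

Lemma torus_stab0 w : word 3 w ->
  stab 3 hexr torf hex0 w <-> exists2 t, Lat t & act hexr w hex0 = (t, 0%N, false).
Proof.
move=> ww; rewrite /stab; have : hexS (act hexr w hex0) by apply: hex_actS.
case: (act hexr w hex0) => [[t i] e] i6; rewrite torus_eqf //.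
rewrite sub0r; split=> [[-> -> /Lat_opp]|[s Ls [-> -> ->]]]; last by split=> //; apply: Lat_opp.
by rewrite opprK => Lt; exists t.
Qed.

(** Translations and rotations by 60 degrees commute with words, preserve the lattice and act
    transitively on flags of one orientation. Reflections need not preserve the lattice, hence the
    condition [x.2 = false]. *)
Lemma torus_stab x w : word 3 w -> hexS x -> x.2 = false ->
  stab 3 hexr torf x w <-> stab 3 hexr torf hex0 w.
Proof.
move=> ww; case: x => [[a i] e] /= i6 ->.
have trS t y : hexS y -> stab 3 hexr torf (tr t y) w <-> stab 3 hexr torf y w.
  move=> Sy; rewrite /stab act_tr; have := hex_actS w Sy.
  case: (act hexr w y) => [[t' i'] e'] i6'; case: y Sy => [[u k] g] k6.
  rewrite /tr /= !torus_eqf //.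
  by rewrite (_ : t + u - (t + t') = u - t') // opprD addrACA subrr add0r.
have rotS y : hexS y -> stab 3 hexr torf (rotf y) w <-> stab 3 hexr torf y w.
  move=> Sy; rewrite /stab rotf_act //; have := hex_actS w Sy.
  case: (act hexr w y) => [[[t1 t2] i'] e'] i6'; case: y Sy => [[[u1 u2] k] g] k6.
  rewrite /rotf /= !torus_eqf ?ltn_mod //.
  have rotB : rot60 (u1, u2) - rot60 (t1, t2) = rot60 ((u1, u2) - (t1, t2)).
    by rewrite subpE /rot60 /= subpE; congr pair; lia.
  rewrite rotB; split=> -[iE eE L]; split=> //; first by rewrite /hexS /= in i6' k6; lia.
  - rewrite -[X in Lat X]rot60_6; do 5!apply: Lat_rot; exact: L.
  - by rewrite iE.
  - exact: Lat_rot.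
have iS k : hexS (iter k rotf hex0) by case: k => //= k; rewrite /hexS /= ltn_mod.
have -> : (a, i, false) = tr a (iter i rotf hex0).
  rewrite /tr; congr (_, _, _); last by elim: (i).
    rewrite (_ : (iter i rotf hex0).1.1 = 0) ?addr0 //.
    by elim: (i) => //= k ->.
  by move: i i6; apply: k6_ind.
rewrite trS //; elim: (i) => //= k IH; rewrite rotS //.
Qed.

End TorusRep.

(** * The Coxeter group of type B3 and the octahedron *)

Record b3rel (Y : Type) (r : nat -> Y -> Y) : Prop := B3Rel {
  b3_inv : forall j y, 0 < j <= 3 -> r j (r j y) = y;
  b3_comm : forall y, r 3 (r 1 y) = r 1 (r 3 y);
  b3_braid3 : forall y, r 1 (r 2 (r 1 y)) = r 2 (r 1 (r 2 y));
  b3_braid4 : forall y, r 3 (r 2 (r 3 (r 2 y))) = r 2 (r 3 (r 2 (r 3 y))) }.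

(* Words for the elements of the parabolic subgroup of order 8 and for
   representatives of its six cosets in the Coxeter group of type B3. *)
Definition b3_parabolic : seq (seq nat) :=
  [:: [::]; [:: 2]; [:: 3]; [:: 2; 3]; [:: 3; 2]; [:: 2; 3; 2]; [:: 3; 2; 3]; [:: 2; 3; 2; 3]].
Definition b3_cosets : seq (seq nat) :=
  [:: [::]; [:: 1]; [:: 2; 1]; [:: 3; 2; 1]; [:: 2; 3; 2; 1]; [:: 1; 2; 3; 2; 1]].
Definition b3_words := [seq c ++ v | c <- b3_cosets, v <- b3_parabolic].

(** Equality in the Coxeter group, expressed through all its actions; an identity detected on the
    octahedron can then be applied to L_2(p). *)
Definition weq w u := forall (Y : Type) (r : nat -> Y -> Y), b3rel r ->
  forall y, act r w y = act r u y.

Lemma weq_cat w u v : weq w u -> weq (w ++ v) (u ++ v).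
Proof. by move=> e Y r Rr y; rewrite !act_cat e. Qed.

Lemma weq_cat2 w u v : weq w u -> weq (v ++ w) (v ++ u).
Proof. by move=> e Y r Rr y; rewrite !act_cat e. Qed.

Ltac mem_cases := repeat (move=> /orP[/eqP->|]); try move=> /eqP->.

Lemma b3_parabolic_mul j v : j \in [:: 2; 3] -> v \in b3_parabolic ->
  exists2 u, u \in b3_parabolic & weq (j :: v) u.
Proof.
rewrite !inE => /orP[]/eqP->; mem_cases.
- by exists [:: 2].
- by exists [::] => // Y r Rr y /=; rewrite !(b3_inv Rr).
- by exists [:: 2; 3].
- by exists [:: 3] => // Y r Rr y /=; rewrite !(b3_inv Rr).
- by exists [:: 2; 3; 2].
- by exists [:: 3; 2] => // Y r Rr y /=; rewrite !(b3_inv Rr).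
- by exists [:: 2; 3; 2; 3].
- by exists [:: 3; 2; 3] => // Y r Rr y /=; rewrite !(b3_inv Rr).
- by exists [:: 3].
- by exists [:: 3; 2].
- by exists [::] => // Y r Rr y /=; rewrite !(b3_inv Rr).
- by exists [:: 3; 2; 3].
- by exists [:: 2] => // Y r Rr y /=; rewrite !(b3_inv Rr).
- by exists [:: 2; 3; 2; 3] => // Y r Rr y /=; rewrite (b3_braid4 Rr).
- by exists [:: 2; 3] => // Y r Rr y /=; rewrite !(b3_inv Rr).
- by exists [:: 2; 3; 2] => // Y r Rr y /=; rewrite -(b3_braid4 Rr) !(b3_inv Rr).
Qed.

(** A Todd-Coxeter table: 3 generators times 6 cosets of the parabolic subgroup, each entry
    justified by the defining relations. *)
Lemma b3_coset_mul j c : 0 < j <= 3 -> c \in b3_cosets ->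
  exists c' v, [/\ c' \in b3_cosets, all [in [:: 2; 3]] v & weq (j :: c) (c' ++ v)].
Proof.
rewrite !inE; case: j => [|[|[|[|j]]]] // _; mem_cases.
- by exists [:: 1], [::].
- by exists [::], [::]; split=> // Y r Rr y /=; rewrite !(b3_inv Rr).
- by exists [:: 2; 1], [:: 2]; split=> // Y r Rr y /=; rewrite (b3_braid3 Rr).
- by exists [:: 3; 2; 1], [:: 2]; split=> // Y r Rr y /=; rewrite -(b3_comm Rr) (b3_braid3 Rr).
- by exists [:: 1; 2; 3; 2; 1], [::].
- by exists [:: 2; 3; 2; 1], [::]; split=> // Y r Rr y /=; rewrite !(b3_inv Rr).
- by exists [::], [:: 2].
- by exists [:: 2; 1], [::].
- by exists [:: 1], [::]; split=> // Y r Rr y /=; rewrite !(b3_inv Rr).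
- by exists [:: 2; 3; 2; 1], [::].
- by exists [:: 3; 2; 1], [::]; split=> // Y r Rr y /=; rewrite !(b3_inv Rr).
- exists [:: 1; 2; 3; 2; 1], [:: 2]; split=> // Y r Rr y /=.
  by rewrite -(b3_braid3 Rr) -(b3_comm Rr) -(b3_braid3 Rr) // (b3_comm Rr).
- by exists [::], [:: 3].
- by exists [:: 1], [:: 3]; split=> // Y r Rr y /=; rewrite (b3_comm Rr).
- by exists [:: 3; 2; 1], [::].
- by exists [:: 2; 1], [::]; split=> // Y r Rr y /=; rewrite !(b3_inv Rr).
- by exists [:: 2; 3; 2; 1], [:: 3]; split=> // Y r Rr y /=; rewrite (b3_braid4 Rr) (b3_comm Rr).
exists [:: 1; 2; 3; 2; 1], [:: 3]; split=> // Y r Rr y /=.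
by rewrite (b3_comm Rr) (b3_braid4 Rr) (b3_comm Rr).
Qed.

(** This bounds the group by 48 elements; that nothing collapses further is seen on the flags of the
    octahedron. *)
Lemma b3_normal_form w : word 3 w -> exists2 u, u \in b3_words & weq w u.
Proof.
elim: w => [|j w IH] /=; first by exists [::].
move=> /andP[/and3P[j0 jn _] /IH[u /allpairsP[[c v] /= [cc vv ->]] wu]].
have jP : 0 < j <= 3 by rewrite j0.
have [c' [v' [cc' av' e]]] := b3_coset_mul jP cc.
have [v1 vv1 e1] : exists2 v1, v1 \in b3_parabolic & weq (v' ++ v) v1.
  elim: v' av' {e} => [_|i v' IHv /= /andP[i23 av']]; first by exists v.
  have [v1 v1P e1] := IHv av'; have [v2 v2P e2] := b3_parabolic_mul i23 v1P.
  by exists v2 => // Y r Rr y; rewrite -e2 //= e1.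
exists (c' ++ v1); first by apply/allpairsP; exists (c', v1).
move=> Y r Rr y; rewrite /= wu // -[LHS]/(act r ((j :: c) ++ v) y).
by rewrite (weq_cat v e) // -catA (weq_cat2 c' e1).
Qed.

(* A flag of the octahedron is a signed ordering of the coordinates: its face of
   rank k - 1 is spanned by the first k signed basis vectors. *)
Definition octflag := ((nat * bool) * (nat * bool) * (nat * bool))%type.

Definition octflags : seq octflag :=
  [seq (((p.1.1, s.1.1), (p.1.2, s.1.2)), (p.2, s.2)) |
    p <- [:: (0, 1, 2); (0, 2, 1); (1, 0, 2); (1, 2, 0); (2, 0, 1); (2, 1, 0)],
    s <- [seq (a, b) | a <- [seq (a, b) | a <- [:: true; false], b <- [:: true; false]],
                       b <- [:: true; false]]].

Definition octS (x : octflag) : Prop := x \in octflags.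

Definition octr (j : nat) (x : octflag) : octflag :=
  let: (u, v, w) := x in
  match j with
  | 1 => (v, u, w)
  | 2 => (u, w, v)
  | _ => (u, v, (w.1, ~~ w.2))
  end.

Definition octseq (x : octflag) := [:: x.1.1; x.1.2; x.2].

(** The sign vector of a face as a list, so that the finite checks below can be computed. *)
Definition octvec k (x : octflag) : seq (option bool) :=
  [seq (let s := take k (octseq x) in
        if i \in unzip1 s then Some (nth false (unzip2 s) (index i (unzip1 s))) else None)
  | i <- [:: 0; 1; 2]].

Definition octdec (v : seq (option bool)) : {ffun 'I_3 -> option bool} :=
  [ffun i : 'I_3 => nth None v i].

Definition octf k x : octahedron := if k < 4 then Some (octdec (octvec k x)) else None.

Definition octfeq k x y := (4 <= k) || (octvec k x == octvec k y).

Definition octfle k l x y := (4 <= l) || (k < 4) &&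
  all (fun i => (nth None (octvec k x) i == None) ||
                (nth None (octvec k x) i == nth None (octvec l y) i)) [:: 0; 1; 2].

Lemma octdec_inj v v' : size v = 3 -> size v' = 3 -> octdec v = octdec v' -> v = v'.
Proof.
move=> sv sv' /ffunP e; apply: (@eq_from_nth _ None); rewrite sv // => i i3.
by have := e (Ordinal i3); rewrite !ffunE.
Qed.

Lemma octfeqP k x y : reflect (octf k x = octf k y) (octfeq k x y).
Proof.
rewrite /octf /octfeq; case: (ltnP k 4) => _ /=; last by constructor.
apply: (iffP eqP) => [->//|[]]; exact: octdec_inj.
Qed.

Lemma octfleE k l x y : (octf k x <= octf l y)%O = octfle k l x y.
Proof.
rewrite -[LHS]/(octahedron_le _ _) /octf /octfle.
case: (ltnP l 4) => _ /=; last by case: (k < 4).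
case: (k < 4) => //=; apply/forallP/idP => [H|].
  have h i (i3 : i < 3) := H (Ordinal i3).
  by have := (h 0 isT, h 1 isT, h 2 isT); rewrite !ffunE /= => -[[-> ->] ->].
move=> /and4P[h0 h1 h2 _] [[|[|[|i]]] i3] //; rewrite !ffunE //=.
Qed.

Definition subsets3 : seq (seq nat) :=
  [:: [::]; [:: 1]; [:: 2]; [:: 3]; [:: 1; 2]; [:: 1; 3]; [:: 2; 3]; [:: 1; 2; 3]].

Definition b3_avoid (K : seq nat) := [seq w <- b3_words | all (fun j => j \notin K) w].

(* The tests are conditionals because ==>, && and || do not shortcut under
   vm_compute. *)
Lemma oct_conn_check : all (fun K => let W := b3_avoid K in
  all (fun x => all (fun y => if all (fun k => octfeq k x y) K then
    y \in [seq act octr w x | w <- W] else true) octflags) octflags) subsets3.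
Proof. by vm_compute. Qed.

Lemma oct_splice_check : all (fun x => all (fun y => if octfeq 2 x y then
  has (fun z => if octfeq 1 z x then octfeq 3 z y else false)
    [seq act octr w x | w <- b3_avoid [:: 2]] else true) octflags) octflags.
Proof. by vm_compute. Qed.

Lemma oct_le_check : all (fun k => let W := b3_avoid [:: k] in
  all (fun l => all (fun x => all (fun y => if octfle k l x y then
    (k <= l) && has (fun z => octfeq l z y) [seq act octr w x | w <- W] else true)
  octflags) octflags) [:: 0; 1; 2; 3]) [:: 1; 2; 3].
Proof. by vm_compute. Qed.

Lemma oct_flip_check : all (fun x => all (fun j => [&& octr j x \in octflags,
  octr j (octr j x) == x, ~~ octfeq j (octr j x) x &
  all (fun k => (k != j) ==> octfeq k (octr j x) x) [:: 0; 1; 2; 3; 4]])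
  [:: 1; 2; 3]) octflags.
Proof. by vm_compute. Qed.

Lemma oct_le_refl_check : all (fun x => all (fun k => all (fun l => (k <= l) ==> octfle k l x x)
  [:: 0; 1; 2; 3; 4]) [:: 0; 1; 2; 3; 4]) octflags.
Proof. by vm_compute. Qed.

Lemma oct_surj_check : all (fun v => has (fun k => has (fun x => octvec k x == v) octflags)
  [:: 0; 1; 2; 3])
  [seq a :: v | a <- [:: None; Some true; Some false],
     v <- [seq [:: a; b] | a <- [:: None; Some true; Some false], b <- [:: None; Some true; Some false]]].
Proof. by vm_compute. Qed.

Lemma oct_free_check : all (fun u => all (fun x => (act octr u x == x) ==> (u == [::]))
  octflags) b3_words.
Proof. by vm_compute. Qed.

Lemma oct_b3 : b3rel octr.
Proof.
split=> [|[[u v] w] //|[[u v] w] //|[[u v] w] //].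
by case=> [|[|[|[|j]]]] // [[u v] [i e]] _ /=; rewrite ?negbK.
Qed.

Lemma le4_mem k : k <= 4 -> k \in [:: 0; 1; 2; 3; 4].
Proof. by case: k => [|[|[|[|[|k]]]]]. Qed.

Lemma oct_rep : flagrep 3 octS octr octf.
Proof.
have fl j x : 0 < j <= 3 -> octS x -> [&& octr j x \in octflags,
  octr j (octr j x) == x, ~~ octfeq j (octr j x) x &
  all (fun k => (k != j) ==> octfeq k (octr j x) x) [:: 0; 1; 2; 3; 4]].
  move=> jn Sx; have /allP := allP oct_flip_check x Sx; apply.
  by case: j jn => [|[|[|[|j]]]].
have rS j x : 0 < j <= 3 -> octS x -> octS (octr j x) by move=> jn /(fl j x jn)/and4P[].
have rfix j k x : 0 < j <= 3 -> k <= 4 -> k != j -> octS x -> octf k (octr j x) = octf k x.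
  move=> jn kn kj /(fl j x jn)/and4P[_ _ _ /allP/(_ k (le4_mem kn))].
  by rewrite kj => /octfeqP.
have ww w : w \in b3_words -> word 3 w by apply: (allP (_ : all (word 3) b3_words)).
have Sact K x z : octS x -> z \in [seq act octr w x | w <- b3_avoid K] ->
    octS z /\ forall k, k <= 4 -> k \in K -> octf k z = octf k x.
  move=> Sx /mapP[w]; rewrite mem_filter => /andP[wK /ww wW] ->.
  elim: w wK wW => //= j w IH /andP[jK wK] /andP[/and3P[j0 jn _] wW].
  have jP : 0 < j <= 3 by rewrite j0.
  have [Sw fw] := IH wK wW; split=> [|k kn kK]; first exact: rS.
  by rewrite rfix ?fw //; apply: contraNneq jK => <-.
split=> //.
- by exists (((0, true), (1, true)), (2, true)).
- by move=> j x jn /(fl j x jn)/and4P[_ /eqP].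
- by move=> j x jn /(fl j x jn)/and4P[_ _ /octfeqP].
- move=> K x y Sx Sy H; pose K' := filter K [:: 1; 2; 3].
  have K'in : K' \in subsets3 by rewrite /K' /=; case: (K 1) (K 2) (K 3) => [] [] [].
  have /allP/(_ x Sx)/allP/(_ y Sy) := allP oct_conn_check K' K'in.
  rewrite ifT => [/mapP[w]|]; last first.
    apply/allP=> k; rewrite mem_filter !inE => /andP[Kk k3]; apply/octfeqP/H => //.
    by case/or3P: k3 => /eqP->.
  rewrite mem_filter => /andP[wK wW] wE.
  exists w; last by move=> k _; rewrite wE.
  apply/allP=> j jw; have /and3P[j0 jn _] := allP (ww _ wW) j jw; apply/and3P; split=> //.
  have := allP wK j jw; rewrite mem_filter negb_and => /orP[//|].
  by rewrite !inE; lia.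
- move=> k x y kn Sx Sy e.
  have t0 u v : octf 0 u = octf 0 v by apply/octfeqP.
  have t4 u v : octf 4 u = octf 4 v by [].
  case: k kn e => [|[|[|[|[|k]]]]] // _ e.
  + by exists y; split=> // -[|l] // _; apply: t0.
  + by exists y; split=> // -[|[|l]] // _; apply: t0.
  + have /allP/(_ y Sy) := allP oct_splice_check x Sx.
    rewrite (introT (octfeqP _ _ _) e) => /hasP[z zW].
    case: octfeqP => // z1 /octfeqP z3.
    have [Sz /(_ 2 isT isT) z2] := Sact [:: 2] x z Sx zW.
    exists z; split=> //; first by case=> [|[|[|l]]] // _; apply: t0.
    by case=> [|[|[|[|[|l]]]]] // _; rewrite z2.
  + by exists x; split=> // -[|[|[|[|[|l]]]]].
  + by exists x; split=> // -[|[|[|[|[|l]]]]].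
- case=> [s|]; last by exists 4, (((0, true), (1, true)), (2, true)).
  pose v := [seq s i | i <- [:: inord 0; inord 1; inord 2]].
  have [|k k4 /hasP[x Sx /eqP e]] := hasP (allP oct_surj_check v _).
    by rewrite /v /=; case: (s _) (s _) (s _) => [[]|] [[]|] [[]|].
  have k4' : k < 4 by move: k4; rewrite !inE; lia.
  exists k, x; split=> //; first exact: ltnW.
  rewrite /octf k4' e; congr Some; apply/ffunP=> i; rewrite ffunE.
  rewrite (nth_map (inord 0)) //; congr (s _); apply: val_inj.
  by case: i => [[|[|[|i]]] i3] //=; rewrite inordK.
- move=> k l x /andP[kl l4] Sx; rewrite octfleE.
  have /allP/(_ k (le4_mem (leq_trans kl l4)))/allP/(_ l (le4_mem l4)) := allP oct_le_refl_check x Sx.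
  by rewrite kl.
move=> k l x y kn ln Sx Sy; rewrite octfleE => le.
have [->|k0] := eqVneq k 0; first by split=> //; exists y; split=> //; apply/octfeqP.
have [l4|l4] := eqVneq l 4; first by rewrite l4; split=> //; exists x.
have k4 : k != 4 by apply: contraTneq le => ->; rewrite /octfle; lia.
have kin : k \in [:: 1; 2; 3] by rewrite !inE; lia.
have lin : l \in [:: 0; 1; 2; 3] by rewrite !inE; lia.
have /allP/(_ l lin)/allP/(_ x Sx)/allP/(_ y Sy) := allP oct_le_check k kin.
rewrite le => /andP[kl /hasP[z zW /octfeqP zl]].
have [Sz fz] := Sact [:: k] x z Sx zW.
by split=> //; exists z; split=> //; apply: fz; rewrite ?inE.
Qed.

(** The automorphism group of the octahedron is the full Coxeter group: a word fixing a flag has a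
    normal form fixing it, and by [oct_free_check] this is the empty word. *)
Lemma oct_stab x w : word 3 w -> octS x -> stab 3 octr octf x w -> weq w [::].
Proof.
move=> ww Sx st; have [u uW wu] := b3_normal_form ww.
have Sw := rep_actS oct_rep ww Sx.
have e : act octr u x = x.
  rewrite -(wu _ _ oct_b3); apply/eqP.
  (* With all three indices in [K] only the empty word is available, so flags with the same faces
     are equal. *)
  have /allP/(_ x Sx) := allP (allP oct_conn_check [:: 1; 2; 3] isT) _ Sw.
  rewrite ifT => [/mapP[w']|]; last by apply/and4P; split=> //; apply/octfeqP/st.
  rewrite (_ : b3_avoid _ = [:: [::]]) ?inE; last by vm_compute.
  by move=> /eqP-> /= <-.
have := allP (allP oct_free_check u uW) x Sx; rewrite e eqxx => /eqP u0.
by rewrite u0 in wu.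
Qed.

(** * The group SL_2 over a finite field *)

Section ProjectiveLine.
Local Open Scope ring_scope.
Variable F : finFieldType.
Notation GL2 := {'GL_2[F]}.

Definition SLF : {set GL2} := [set u : GL2 | \det u == 1].

Definition mx2 (a b c d : F) : 'M[F]_2 :=
  \matrix_(i, j) (if i == 0 then if j == 0 then a else b else if j == 0 then c else d).

Lemma mx2_mul a b c d a' b' c' d' : mx2 a b c d *m mx2 a' b' c' d' =
  mx2 (a * a' + b * c') (a * b' + b * d') (c * a' + d * c') (c * b' + d * d').
Proof.
apply/matrixP=> i j; rewrite !mxE !big_ord_recl big_ord0 !mxE addr0 /=.
by case: i j => [[|[|i]] ?] [[|[|j]] ?].
Qed.

Lemma mx2_det a b c d : \det (mx2 a b c d) = a * d - b * c.
Proof.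
rewrite (expand_det_row _ 0) !big_ord_recl big_ord0 addr0 /cofactor !det_mx11 !mxE /=.
by rewrite expr0 expr1 mul1r mulN1r mulrN.
Qed.

Lemma mx2_eta (M : 'M[F]_2) : exists a b c d, M = mx2 a b c d.
Proof.
exists (M 0 0), (M 0 1), (M 1 0), (M 1 1); apply/matrixP=> i j; rewrite !mxE.
case: i j => [[|[|i]] ?] [[|[|j]] ?] //=; by congr (M _ _); apply: val_inj.
Qed.

Lemma mx2_inj a b c d a' b' c' d' : mx2 a b c d = mx2 a' b' c' d' ->
  [/\ a = a', b = b', c = c' & d = d'].
Proof.
move=> /matrixP e; split.
- by have := e 0 0; rewrite !mxE.
- by have := e 0 1; rewrite !mxE.
- by have := e 1 0; rewrite !mxE.
- by have := e 1 1; rewrite !mxE.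
Qed.

Lemma GLval_inj (g h : GL2) : GLval g = GLval h -> g = h.
Proof. exact: val_inj. Qed.

Definition gl a b c d : GL2 := insubd (1%g : GL2) (mx2 a b c d).

Lemma glK a b c d : a * d - b * c != 0 -> GLval (gl a b c d) = mx2 a b c d.
Proof.
move=> h; have u : mx2 a b c d \in unitmx by rewrite unitmxE mx2_det unitfE.
exact: insubdK.
Qed.

Lemma slK a b c d : a * d - b * c = 1 -> GLval (gl a b c d) = mx2 a b c d.
Proof. by move=> h; rewrite glK // h oner_neq0. Qed.

Lemma sl_in a b c d : a * d - b * c = 1 -> gl a b c d \in SLF.
Proof. by move=> h; rewrite inE slK // mx2_det h. Qed.

Lemma slP g : g \in SLF -> exists a b c d, a * d - b * c = 1 /\ g = gl a b c d.
Proof.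
rewrite inE => /eqP dg; have [a [b [c [d e]]]] := mx2_eta (GLval g).
have h : a * d - b * c = 1 by rewrite -mx2_det -e.
by exists a, b, c, d; split=> //; apply: GLval_inj; rewrite slK.
Qed.

Lemma sl_inj a b c d a' b' c' d' : a * d - b * c = 1 -> a' * d' - b' * c' = 1 ->
  gl a b c d = gl a' b' c' d' -> [/\ a = a', b = b', c = c' & d = d'].
Proof. by move=> h h' /(congr1 (@GLval _ _)); rewrite !slK // => /mx2_inj. Qed.

Lemma sl_mul a b c d a' b' c' d' : a * d - b * c = 1 -> a' * d' - b' * c' = 1 ->
  (gl a b c d * gl a' b' c' d')%g =
  gl (a * a' + b * c') (a * b' + b * d') (c * a' + d * c') (c * b' + d * d').
Proof.
move=> h h'; apply: GLval_inj; rewrite GL_MxE.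
rewrite !slK ?mx2_mul //.
have -> : (a * a' + b * c') * (c * b' + d * d') - (a * b' + b * d') * (c * a' + d * c') =
  (a * d - b * c) * (a' * d' - b' * c') by ring.
by rewrite h h' mulr1.
Qed.

Lemma gl1 : gl 1 0 0 1 = 1%g.
Proof.
apply: GLval_inj; rewrite GL_1E slK; last by ring.
apply/matrixP=> i j; rewrite !mxE.
by case: i j => [[|[|i]] ?] [[|[|j]] ?].
Qed.

Lemma finField_gt1 : (1 < #|F|)%N.
Proof. exact: card_finNzRing_gt1. Qed.

(** An invertible matrix is uniquely the product of an element of SL_2 and diag(x, 1), where x is
    its determinant; the order of GL_2 then gives that of SL_2. *)
Lemma card_SLF : (#|SLF| = #|F| * (#|F|.-1 * #|F|.+1))%N.
Proof.
pose dg (x : F) : GL2 := gl x 0 0 1.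
pose f (y : F * GL2) : GL2 := (y.2 * dg y.1)%g.
have dgx (x : F) : x != 0 -> GLval (dg x) = mx2 x 0 0 1.
  by move=> x0; rewrite glK // mulr1 mulr0 subr0.
have detf (x : F) (s : GL2) : x != 0 -> s \in SLF -> \det (GLval (s * dg x)%g) = x.
  move=> x0; rewrite inE => /eqP ds; rewrite GL_MxE det_mulmx ds dgx //.
  by rewrite mx2_det; ring.
have : #|setX [set~ (0 : F)] SLF| = #|[set: GL2]|.
  have surj (g : GL2) : g \in f @: setX [set~ (0 : F)] SLF.
    apply/imsetP; exists (\det g, (g * (dg (\det g))^-1)%g).
      apply/setXP; split; first by rewrite !inE GL_det.
      rewrite inE GL_MxE det_mulmx GL_VxE det_inv dgx ?GL_det //.
      by rewrite mx2_det mulr1 mulr0 subr0 mulfV ?GL_det.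
    by rewrite -[f _]/(g * (dg (\det g))^-1 * dg (\det g))%g mulgKV.
  have <- : f @: setX [set~ (0 : F)] SLF = [set: GL2].
    by apply/setP=> g; rewrite in_setT; apply: surj.
  rewrite card_in_imset // => -[x s] [x' s'] /setXP[x0 sS] /setXP[x0' sS'].
  rewrite -[f _]/(s * dg x)%g -[f _]/(s' * dg x')%g => e.
  have {}x0 : x != 0 by move: x0; rewrite !inE.
  have {}x0' : x' != 0 by move: x0'; rewrite !inE.
  have xE : x = x' by rewrite -(detf x s) // -(detf x' s') // e.
  by move: e; rewrite xE => /mulIg->.
rewrite cardsX cardsC1 => e.
have : #|[set: GL2]| = (#|F| * #|F|.-1 ^ 2 * #|F|.+1)%N by rewrite -card_GL_2.
rewrite -e => e'; apply/eqP; rewrite -(@eqn_pmul2l #|F|.-1); last first.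
  by have := finField_gt1; lia.
by rewrite e'; apply/eqP; lia.
Qed.

End ProjectiveLine.


(* T t, D and W are the Moebius maps x |-> x + t, x |-> z x and x |-> 1 / (2 x),
   composed from left to right. *)
Record L2_data (F : fieldType) (z : F) (gT : finGroupType) (L : {group gT})
    (D W : gT) (T : F -> gT) : Prop := L2Data {
  L2_D : D \in L;
  L2_W : W \in L;
  L2_T : forall x, T x \in L;
  L2_TD : forall x y, (T x * T y)%g = T (x + y)%R;
  L2_TscD : forall x, (T x * D)%g = (D * T (z * x)%R)%g;
  L2_D6 : (D ^+ 6)%g = 1%g;
  L2_W2 : (W * W)%g = 1%g;
  L2_DWD : (D * W * D)%g = W;
  L2_WB4 : ((W * (D ^+ 3 * T 1%R)) ^+ 4)%g = 1%g;
  L2_T_inj : forall x, T x = 1%g -> x = 0%R;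
  L2_T_ncomm : forall x, x != 0%R -> (W * T x)%g <> (T x * W)%g;
  L2_gen : forall H : {group gT}, W \in H -> (forall x, T x \in H) -> L \subset H;
  L2_simple : forall N : {group gT}, (N <| L)%g -> N :=: 1%g \/ N :=: L }.

(** * Simplicity of L_2 and the rotations of {6,3,4} inside it *)

Section AbstractSL2.
Local Open Scope ring_scope.
Variables (F : fieldType) (gT : finGroupType) (SL : {group gT}) (gl : F -> F -> F -> F -> gT).
Hypothesis sl_in : forall a b c d, a * d - b * c = 1 -> gl a b c d \in SL.
Hypothesis slP : forall g, g \in SL -> exists a b c d, a * d - b * c = 1 /\ g = gl a b c d.
Hypothesis sl_inj : forall a b c d a' b' c' d', a * d - b * c = 1 -> a' * d' - b' * c' = 1 ->
  gl a b c d = gl a' b' c' d' -> [/\ a = a', b = b', c = c' & d = d'].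
Hypothesis sl_mul : forall a b c d a' b' c' d', a * d - b * c = 1 -> a' * d' - b' * c' = 1 ->
  (gl a b c d * gl a' b' c' d')%g =
  gl (a * a' + b * c') (a * b' + b * d') (c * a' + d * c') (c * b' + d * d').
Hypothesis gl1 : gl 1 0 0 1 = 1%g.
Notation Z := ('Z(SL))%g.

Lemma sl_inv a b c d : a * d - b * c = 1 -> (gl a b c d)^-1%g = gl d (- b) (- c) a.
Proof.
move=> h; apply/eqP; rewrite eq_invg_mul sl_mul //; last by rewrite -[RHS]h; ring.
by rewrite -gl1; apply/eqP; congr gl; rewrite -?h; ring.
Qed.

Definition up x := gl 1 x 0 1.
Definition lo x := gl 1 0 x 1.

Lemma det_up x : 1 * 1 - x * 0 = 1 :> F. Proof. by ring. Qed.
Lemma det_lo x : 1 * 1 - 0 * x = 1 :> F. Proof. by ring. Qed.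

Lemma up_in x : up x \in SL. Proof. exact/sl_in/det_up. Qed.
Lemma lo_in x : lo x \in SL. Proof. exact/sl_in/det_lo. Qed.

Lemma lo_add x y : (lo x * lo y)%g = lo (x + y).
Proof. by rewrite sl_mul ?det_lo //; congr gl; ring. Qed.

(** For c nonzero the matrix is an explicit product upper, lower, upper of elementary ones; if c =
    0, multiplication by [lo 1] on the left makes the lower left entry equal to a, which is
    nonzero. *)
Lemma sl_generated (H : {group gT}) :
  (forall x, up x \in H) -> (forall x, lo x \in H) -> SL \subset H.
Proof.
move=> uH lH.
have c_neq0 a b c d : a * d - b * c = 1 -> c != 0 -> gl a b c d \in H.
  move=> h c0.
  have -> : gl a b c d = (up ((a - 1) / c)%R * lo c * up ((d - 1) / c)%R)%g.
    rewrite /up /lo sl_mul ?det_up ?det_lo // sl_mul ?det_up //; last by field.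
    congr gl; [by field| |by field|by field].
    have -> : b = (a * d - 1) / c by rewrite -h; field.
    by field.
  by rewrite !groupM.
apply/subsetP=> g /slP[a [b [c [d [h ->]]]]].
have [c0|c0] := eqVneq c 0; last exact: c_neq0.
have a0 : a != 0 by apply: contra_eq_neq h => ->; rewrite c0 mul0r mulr0 subr0 eq_sym oner_neq0.
rewrite -(groupMl _ (lH 1)) sl_mul ?det_lo //; apply: c_neq0; last by rewrite c0 mul1r mulr0 addr0.
by rewrite -[RHS]h; ring.
Qed.

Lemma SL_center_scalar a b c d : a * d - b * c = 1 -> gl a b c d \in 'Z(SL)%g ->
  [/\ b = 0, c = 0 & a = d].
Proof.
move=> h /centerP[_ Hc].
have := Hc _ (up_in 1); have := Hc _ (lo_in 1); rewrite /commute !sl_mul ?det_up ?det_lo //.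
move=> /sl_inj[]; [by rewrite -[RHS]h; ring|by rewrite -[RHS]h; ring|].
move=> e1 _ _ _ /sl_inj[]; [by rewrite -[RHS]h; ring|by rewrite -[RHS]h; ring|].
move=> e2 e3 _ _; split.
- by have : b = (a * 1 + b * 1) - (1 * a + 0 * c) by [ring]; rewrite e1 subrr.
- by have : c = (1 * a + 1 * c) - (a * 1 + b * 0) by [ring]; rewrite -e2 subrr.
- have b0 : b = 0 by have : b = (a * 1 + b * 1) - (1 * a + 0 * c) by [ring]; rewrite e1 subrr.
  have : a - d = (a * 1 + b * 1) - (1 * b + 1 * d) by rewrite b0; ring.
  by rewrite e3 subrr => /eqP; rewrite subr_eq0 => /eqP.
Qed.

Lemma scalar_center a : a * a = 1 -> gl a 0 0 a \in 'Z(SL)%g.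
Proof.
move=> aa; have h : a * a - 0 * 0 = 1 by rewrite aa; ring.
apply/centerP; split; first exact: sl_in.
move=> g /slP[a' [b' [c' [d' [h' ->]]]]]; rewrite /commute !sl_mul //; congr gl; ring.
Qed.

Hypothesis two_neq0 : (1 + 1 : F) != 0.

Lemma center_SL : 'Z(SL)%g = [set 1%g; gl (-1) 0 0 (-1)].
Proof.
apply/setP=> g; rewrite in_set2; apply/idP/orP; last first.
  by case=> /eqP->; [exact: group1|apply: scalar_center; ring].
move=> gZ; have gS := subsetP (center_sub SL) g gZ.
have [a [b [c [d [h gE]]]]] := slP gS; rewrite gE in gZ *.
have [b0 c0 ad] := SL_center_scalar h gZ.
have /eqP : (a - 1) * (a + 1) = 0.
  by rewrite b0 c0 -ad in h; rewrite -[RHS](subrr 1) -{3}h; ring.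
rewrite mulf_eq0 subr_eq0 addr_eq0 b0 c0 -ad => /orP[]/eqP->; rewrite ?gl1 ?eqxx; by [left|right].
Qed.

Hypothesis fifteen_neq0 : (15%:R : F) != 0.

Lemma normal_SL_full (N : {group gT}) : (N <| SL)%g ->
  ~~ (N \subset 'Z(SL)%g) -> SL \subset N.
Proof.
move=> nN /subsetPn[g gN gZ].
have sN := normal_sub nN.
have conjN x h : x \in N -> h \in SL -> (h * x * h^-1)%g \in N.
  move=> xN hS; have -> : (h * x * h^-1 = x ^ h^-1)%g by rewrite conjgE invgK mulgA.
  by rewrite (memJ_norm x (groupVr (subsetP (normal_norm nN) h hS))).
have detw : 0 * 0 - 1 * -1 = 1 :> F by ring.
have wS : gl 0 1 (-1) 0 \in SL by apply: sl_in.
(* Conjugation by [gl 0 1 (-1) 0] or by [lo 1] makes the lower left entry nonzero unless the matrix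
   is scalar, hence central. *)
have [a [b [c [d [h gc c0]]]]] :
    exists a b c d, [/\ a * d - b * c = 1, gl a b c d \in N & c != 0].
  have [a [b [c [d [h gE]]]]] := slP (subsetP sN _ gN).
  rewrite gE in gN gZ.
  have [c0|c0] := eqVneq c 0; last by exists a, b, c, d.
  have [b0|b0] := eqVneq b 0; last first.
    have := conjN _ _ gN wS; rewrite sl_inv // !sl_mul; try by [ring|rewrite -[RHS]h; ring].
    move=> gN'; do 4!eexists; split; [|exact: gN'|].
      by rewrite -[RHS]h; ring.
    by rewrite (_ : _ + _ = - b) ?oppr_eq0 //; ring.
  have := conjN _ _ gN (lo_in 1).
  rewrite /lo sl_inv ?det_lo // !sl_mul; try by [ring|rewrite -[RHS]h; ring].
  move=> gN'; do 4!eexists; split; [|exact: gN'|].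
    by rewrite -[RHS]h; ring.
  rewrite (_ : _ + _ = a - d); last by rewrite b0 c0; ring.
  rewrite subr_eq0; apply: contraNneq gZ => ad; rewrite b0 c0 -ad; apply: scalar_center.
  by move: h; rewrite b0 c0 -ad => <-; ring.
pose t := a + d.
have detv : 0 * t - - c^-1 * c = 1 by field.
(* Conjugation by [up (- a / c)] clears the upper left entry and keeps c and the trace. *)
have wN : gl 0 (- c^-1) c t \in N.
  have := conjN _ _ gc (up_in (- a / c)).
  rewrite /up sl_inv ?det_up // !sl_mul; try by [ring|rewrite -[RHS]h; field].
  rewrite (_ : gl _ _ _ _ = gl 0 (- c^-1) c t) //.
  have -> : b = (a * d - 1) / c by rewrite -h; field.
  by congr gl; rewrite /t; field.
have two0 : (2%:R : F) != 0 by [].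
have four0 : (4%:R : F) != 0 by rewrite -[4%N]/(2 * 2)%N natrM mulf_neq0.
have d2 : 2%:R * 2%:R^-1 - 0 * 0 = 1 :> F by field.
have d4 u : 4%:R * 4%:R^-1 - 0 * u = 1 :> F by field.
(* The commutator of diag(2, 1/2) with the previous matrix is lower triangular, with diagonal 4 and
   1/4. *)
have yN : gl 4%:R 0 (c * t * (4%:R^-1 - 1)) 4%:R^-1 \in N.
  have := groupM (conjN _ _ wN (sl_in d2)) (groupVr wN).
  rewrite !sl_inv // !sl_mul; try by field; rewrite ?c0 ?two0.
  rewrite (_ : gl _ _ _ _ = gl 4%:R 0 (c * t * (4%:R^-1 - 1)) 4%:R^-1) //.
  by congr gl; field; rewrite ?c0 ?two0 ?four0.
(* Conjugating [lo s'] by that triangular matrix divides its parameter by 16, so the commutator is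
   [lo] of -15/16 times s'. This dictates s' and is why 15 must be invertible. *)
have loN s : lo s \in N.
  pose s' := - (16%:R / 15%:R) * s.
  have := groupM yN (conjN _ _ (groupVr yN) (lo_in s')).
  rewrite /lo !sl_inv ?det_lo // !sl_mul; try by field; rewrite ?four0.
  rewrite (_ : gl _ _ _ _ = gl 1 0 s 1) //.
  by congr gl; rewrite /s'; field; rewrite ?four0 ?fifteen_neq0.
apply: sl_generated => // s.
have := conjN _ _ (loN (- s)) wS; rewrite /lo sl_inv // !sl_mul; try by ring.
by rewrite (_ : gl _ _ _ _ = up s) //; congr gl; ring.
Qed.

Definition L2quo := (SL / Z)%G.

Variables i z mu nu : F.
Hypothesis iE : i * i = -1.
Hypothesis zE : z * z = z - 1.
Hypothesis mu_nu : mu * nu = -1.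
Hypothesis mu2 : mu * mu = -2%:R.

Definition cs (g : gT) : coset_of Z := coset Z g.

Lemma SL_norm : SL \subset 'N(Z)%g.
Proof. exact: normal_norm (center_normal _). Qed.

Lemma cs_mul g h : g \in SL -> h \in SL -> cs (g * h)%g = (cs g * cs h)%g.
Proof. by move=> gS hS; apply: morphM; apply: (subsetP SL_norm). Qed.

Lemma cs_in g : g \in SL -> cs g \in L2quo.
Proof. by move=> gS; apply: mem_quotient. Qed.

Lemma csP x : x \in L2quo -> exists2 g, g \in SL & x = cs g.
Proof. by case/morphimP=> g _ gS ->; exists g. Qed.

Lemma cs_eq a b c d a' b' c' d' : a * d - b * c = 1 -> a' * d' - b' * c' = 1 ->
  cs (gl a b c d) = cs (gl a' b' c' d') ->
  [/\ a = a', b = b', c = c' & d = d'] \/ [/\ a = - a', b = - b', c = - c' & d = - d'].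
Proof.
move=> h h' e; have gS := sl_in h; have gS' := sl_in h'.
have : (gl a b c d * (gl a' b' c' d')^-1)%g \in Z.
  have ggS := groupM gS (groupVr gS').
  apply: (coset_idr (subsetP SL_norm _ ggS)).
  rewrite -/(cs _) (cs_mul gS (groupVr gS')) e -(cs_mul gS' (groupVr gS')) mulgV.
  exact: morph1.
rewrite center_SL // => /set2P[].
  by move/eqP; rewrite -eq_mulgV1 => /eqP/sl_inj[] // -> -> -> ->; left.
move/(congr1 (fun x => x * gl a' b' c' d')%g); rewrite mulgKV.
have hm : -1 * -1 - 0 * 0 = 1 :> F by ring.
rewrite sl_mul // => /sl_inj[] //; first by rewrite -[RHS]h'; ring.
by move=> -> -> -> ->; right; split; ring.
Qed.

Lemma cs_neg a b c d : a * d - b * c = 1 ->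
  cs (gl (- a) (- b) (- c) (- d)) = cs (gl a b c d).
Proof.
move=> h; have hm : -1 * -1 - 0 * 0 = 1 :> F by ring.
have -> : gl (- a) (- b) (- c) (- d) = (gl (-1) 0%R 0%R (-1) * gl a b c d)%g.
  by rewrite sl_mul //; congr gl; ring.
rewrite cs_mul ?sl_in // {1}/cs coset_id ?mul1g //.
by apply: scalar_center; ring.
Qed.

(** A square root of z: since z ^ 3 = -1, z equals - z ^ -2, and -1 is the square of i; 1 - z is the
    inverse of z. The companion [eta'] is the inverse of [eta]. *)
Let eta := i - i * z.
Let eta' := - i * z.

Lemma det_D : eta * eta' - 0 * 0 = 1.
Proof.
rewrite /eta /eta'; transitivity (- (i * i) * (z - z * z)); first by ring.
by rewrite iE zE; ring.
Qed.

Lemma det_W : 0 * 0 - mu * nu = 1. Proof. by rewrite mu_nu; ring. Qed.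

(** Matrices act on row vectors (x, 1): [lo t] is x |-> x + t, the diagonal matrix is x |-> (eta /
    eta') x = z x, and the last one is x |-> nu / (mu x), equal to 1 / (2 x) because mu nu = -1 and
    mu ^ 2 = -2. *)
Definition cT x := cs (lo x).
Definition cD := cs (gl eta 0 0 eta').
Definition cW := cs (gl 0 mu nu 0).

Lemma D3E : (gl eta 0 0 eta' * gl eta 0 0 eta' * gl eta 0 0 eta')%g = gl i 0 0 (- i).
Proof.
rewrite !sl_mul ?det_D //; last first.
  by transitivity ((eta * eta' - 0 * 0) * (eta * eta' - 0 * 0)); [ring|rewrite det_D mulr1].
have e2 : eta * eta = z.
  transitivity ((i * i) * (1 + z * z - (1 + 1) * z)); first by rewrite /eta; ring.
  by rewrite iE zE; ring.
have e2' : eta' * eta' = 1 - z.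
  transitivity ((i * i) * (z * z)); first by rewrite /eta'; ring.
  by rewrite iE zE; ring.
congr gl; try ring.
  transitivity ((eta * eta) * eta); first by ring.
  rewrite e2 /eta; transitivity (i * (z - z * z)); first by ring.
  by rewrite zE; ring.
transitivity ((eta' * eta') * eta'); first by ring.
rewrite e2' /eta'; transitivity (- i * (z - z * z)); first by ring.
by rewrite zE; ring.
Qed.

Lemma L2quo_data : L2_data z (L2quo) cD cW cT.
Proof.
have Din := sl_in det_D; have Win := sl_in det_W.
have detD3 : i * - i - 0 * 0 = 1 by transitivity (- (i * i)); [ring|rewrite iE; ring].
have D3 : (cD ^+ 3)%g = cs (gl i 0 0 (- i)).
  by rewrite -D3E !cs_mul ?groupM // !expgS expg0 mulg1 mulgA.
have mu0 : mu != 0 by apply: contra_eq_neq mu_nu => ->; rewrite mul0r eq_sym oppr_eq0 oner_neq0.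
(* Conjugation by W turns lower unipotent matrices into upper ones, so W and the translations
   generate everything. *)
have WTW x : (cW * cT x * cW)%g = cs (up ((1 + 1) * x)).
  rewrite -!cs_mul ?groupM ?lo_in // !sl_mul ?det_lo ?det_W //; last first.
    by rewrite -[RHS]det_W; ring.
  rewrite /up -[RHS]cs_neg ?det_up //; congr (cs (gl _ _ _ _)).
  - by rewrite mulr0 add0r -[RHS]mu_nu; ring.
  - by transitivity (mu * mu * x); [ring|rewrite mu2; ring].
  - by ring.
  - by rewrite -[RHS]mu_nu; ring.
have W2 : (cW * cW)%g = 1%g.
  rewrite -cs_mul // sl_mul ?det_W // -cs_neg; last first.
    transitivity ((mu * nu) * (mu * nu)); first by ring.
    by rewrite mu_nu; ring.
  rewrite /cs (_ : gl _ _ _ _ = 1%g) ?coset_id ?group1 //.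
  by rewrite -gl1; congr gl; rewrite ?(mulrC nu) ?mu_nu; ring.
split.
- exact: cs_in.
- exact: cs_in.
- by move=> x; apply: cs_in; apply: lo_in.
- by move=> x y; rewrite -cs_mul ?lo_in // lo_add.
- move=> x; rewrite -!cs_mul ?lo_in // !sl_mul ?det_lo ?det_D //.
  congr (cs (gl _ _ _ _)); try ring.
  transitivity (x * eta); first by ring.
  transitivity (eta' * (z * x)); last by ring.
  rewrite /eta /eta'; transitivity (x * (i - i * z)); first by ring.
  transitivity (- i * (z * z) * x); last by ring.
  by rewrite zE; ring.
- rewrite -[6%N]/(3 + 3)%N expgD D3 -cs_mul ?sl_in // sl_mul //.
  rewrite -cs_neg; last by transitivity ((i * i) * (i * i)); [ring|rewrite iE; ring].
  rewrite /cs (_ : gl _ _ _ _ = 1%g) ?coset_id ?group1 //.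
  rewrite -gl1; congr gl; rewrite ?mulrNN ?iE; ring.
- exact: W2.
- rewrite -!cs_mul ?groupM // !sl_mul ?det_D ?det_W //; last first.
    transitivity ((eta * eta' - 0 * 0) * (0 * 0 - mu * nu)); first by ring.
    by rewrite det_D det_W mulr1.
  have ee : eta * eta' = 1 by rewrite -[RHS]det_D; ring.
  congr (cs (gl _ _ _ _)); try ring.
    by transitivity ((eta * eta') * mu); [ring|rewrite ee; ring].
  by transitivity ((eta * eta') * nu); [ring|rewrite ee; ring].
- have ii : i * i * (mu * mu) = (1 + 1) by rewrite iE mu2; ring.
  have im : i * i * (mu * nu) = 1 by rewrite iE mu_nu; ring.
  have detA : - (mu * i) * 0 - - (mu * i) * (nu * i) = 1 by rewrite -[RHS]im; ring.
  have detB : 1 * -1 - (1 + 1) * -1 = 1 :> F by ring.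
  have AE : (cW * (cD ^+ 3 * cT 1%R))%g = cs (gl (- (mu * i)) (- (mu * i)) (nu * i) 0).
    rewrite D3 /cT -(cs_mul (sl_in detD3) (lo_in 1)) /lo sl_mul ?det_lo //.
    rewrite -cs_mul ?sl_in ?det_W //; last by rewrite -[RHS]detD3; ring.
    rewrite sl_mul ?det_W //; last by rewrite -[RHS]detD3; ring.
    by congr (cs (gl _ _ _ _)); ring.
  rewrite AE !expgS expg0 mulg1 mulgA.
  rewrite -(cs_mul (sl_in detA) (sl_in detA)) sl_mul //.
  (* The square of W B has determinant 1 and trace 0, so it squares to -1, which is trivial in the
     quotient. *)
  have -> : cs (gl (- (mu * i) * - (mu * i) + - (mu * i) * (nu * i))
      (- (mu * i) * - (mu * i) + - (mu * i) * 0) (nu * i * - (mu * i) + 0 * (nu * i))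
      (nu * i * - (mu * i) + 0 * 0)) = cs (gl 1 (1 + 1) (-1) (-1)).
    congr (cs (gl _ _ _ _)).
    - by transitivity (i * i * (mu * mu) - i * i * (mu * nu)); [ring|rewrite ii im; ring].
    - by rewrite -[RHS]ii; ring.
    - by transitivity (- (i * i * (mu * nu))); [ring|rewrite im].
    - by transitivity (- (i * i * (mu * nu))); [ring|rewrite im].
  rewrite -(cs_mul (sl_in detB) (sl_in detB)) sl_mul // -cs_neg; last by ring.
  rewrite /cs (_ : gl _ _ _ _ = 1%g) ?coset_id ?group1 //.
  by rewrite -gl1; congr gl; ring.
- move=> x; rewrite -[1%g](_ : cs (gl 1 0 0 1) = _); last by rewrite gl1 /cs coset_id ?group1.
  have d1 : 1 * 1 - 0 * 0 = 1 :> F by ring.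
  by case/(cs_eq (det_lo x) d1) => -[_ _ -> _]; rewrite ?oppr0.
- move=> x x0; rewrite /cW /cT -!cs_mul ?lo_in // /lo !sl_mul ?det_lo ?det_W //.
  case/cs_eq => [||[e _ _ _]|[_ e _ _]]; try by rewrite -[RHS]det_W; ring.
    have /eqP : mu * x = 0 by transitivity (0 * 1 + mu * x); [ring|rewrite e; ring].
    by rewrite mulf_eq0 (negPf mu0) (negPf x0).
  have /eqP : (1 + 1) * mu = 0.
    transitivity ((0 * 0 + mu * 1) + (1 * mu + 0 * 0)); first by ring.
    by rewrite e addNr.
  by rewrite mulf_eq0 (negPf two_neq0) (negPf mu0).
- move=> H WH TH.
  have sub : SL \subset (coset Z @*^-1 H)%g.
    apply: sl_generated => x.
      have -> : x = (1 + 1) * (x / (1 + 1)) by field.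
      apply/morphpreP; split; first by apply: (subsetP SL_norm); apply: up_in.
      change (cs (up ((1 + 1) * (x / (1 + 1)))) \in H).
      by rewrite -WTW !groupM.
    apply/morphpreP; split; first by apply: (subsetP SL_norm); apply: lo_in.
    exact: TH.
  by apply/subsetP=> x /csP[g gS ->]; have /morphpreP[] := subsetP sub g gS.
move=> N nN.
pose N' := (SL :&: coset Z @*^-1 N)%G.
have nN' : (N' <| SL)%g.
  rewrite /normal subsetIl /=; apply/subsetP=> g gS; rewrite inE.
  apply/subsetP=> _ /imsetP[x /setIP[xS /morphpreP[xZ xN]] ->].
  have xgS : (x ^ g)%g \in SL by rewrite groupJ.
  apply/setIP; split=> //; apply/morphpreP; split; first exact: (subsetP SL_norm).
  have gZ := subsetP SL_norm _ gS.
  rewrite /= morphJ // memJ_norm //; apply: (subsetP (normal_norm nN)).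
  exact: cs_in.
case: (boolP (N' \subset Z)) => sub.
  left; apply/trivgP/subsetP=> x xN; have [g gS xE] := csP (subsetP (normal_sub nN) x xN).
  have gZ : g \in Z.
    apply: (subsetP sub); apply/setIP; split=> //; apply/morphpreP; split.
      exact: (subsetP SL_norm).
    by change (cs g \in N); rewrite -xE.
  by rewrite xE /cs coset_id // group1.
right; apply/eqP; rewrite eqEsubset (normal_sub nN) /=.
have full := normal_SL_full nN' sub.
by apply/subsetP=> x /csP[g gS ->]; have /setIP[_ /morphpreP[]] := subsetP full g gS.
Qed.

End AbstractSL2.

Section L2Field.
Local Open Scope ring_scope.

Section Quotient.
Variables (F : finFieldType) (SL : {group {'GL_2[F]}}).
Hypothesis SLE : SL :=: SLF F.
Hypothesis two_neq0 : (1 + 1 : F) != 0.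

Let slin a b c d : a * d - b * c = 1 -> gl a b c d \in SL.
Proof. by move=> h; rewrite SLE; apply: sl_in. Qed.

Let slp g : g \in SL -> exists a b c d, a * d - b * c = 1 /\ g = gl a b c d.
Proof. by rewrite SLE; apply: slP. Qed.

Lemma card_L2quo : (#|F| * (#|F| ^ 2 - 1) = 2 * #|L2quo SL|)%N.
Proof.
have nZ : ('Z(SL) <| SL)%g by apply: center_normal.
have cZ : #|'Z(SL)%g| = 2%N.
  have -> := center_SL slin slp (@sl_inj F) (@sl_mul F) (gl1 F).
  rewrite cards2 (_ : (1%g != _) = true) //.
  apply/eqP; rewrite -gl1 => /sl_inj[]; try ring.
  by move=> e _ _ _; move: two_neq0; rewrite {1}e addNr eqxx.
have := Lagrange (normal_sub nZ); rewrite -card_quotient ?normal_norm //.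
have cS : #|SL| = #|SLF F| by rewrite SLE.
rewrite cZ cS card_SLF => e; rewrite -[#|L2quo SL|]/#|(SL / 'Z(SL))%g| e.
by have := finField_gt1 F; case: #|F| => // q _; rewrite -subn1 !expnS expn0; nia.
Qed.

(** The primitive eighth root of unity e supplies both square roots: e ^ 2 for -1 and e + e ^ 3 for
    -2. *)
Lemma L2quo_ex (e z : F) : (15%:R : F) != 0 -> e ^+ 4 = -1 -> z * z = z - 1 ->
  exists D W T, L2_data z (L2quo SL) D W T.
Proof.
move=> f0 e4 zE.
have e4' : e * e * (e * e) = -1 by rewrite -e4; ring.
have mu2 : (e + e * e * e) * (e + e * e * e) = -2%:R.
  transitivity (e * e + 2%:R * (e * e * (e * e)) + (e * e) * (e * e * (e * e))); first by ring.
  by rewrite e4'; ring.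
have mu0 : e + e * e * e != 0.
  apply: contra_eq_neq mu2 => ->; rewrite mul0r eq_sym oppr_eq0; exact: two_neq0.
have mn : (e + e * e * e) * - (e + e * e * e)^-1 = -1 by field.
exists (cD SL (@gl F) (e * e) z), (cW SL (@gl F) (e + e * e * e) (- (e + e * e * e)^-1)).
exists (cT SL (@gl F)).
exact: (L2quo_data slin slp (@sl_inj F) (@sl_mul F) (gl1 F)).
Qed.
End Quotient.

Lemma root8_ex (p : nat) : prime p -> (p = 1 %[mod 24])%N -> exists e : 'F_p, e ^+ 4 = -1.
Proof.
move=> p_pr p24.
pose F : finFieldType := 'F_p.
have cF : #|F| = p by rewrite card_Fp.
have p8 : (p.-1 = 8 * (p.-1 %/ 8))%N by move: p24 (prime_gt1 p_pr); lia.
have p1 : (0 < p.-1)%N by have := prime_gt1 p_pr; lia.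
suff [e eP] : exists e : F, e ^+ 4 = -1 by exists e.
have /hasP[w _ wP] : has (p.-1).-primitive_root (enum [set~ (0 : F)]).
  apply: has_prim_root => //.
  - apply/allP=> x; rewrite mem_enum !inE => x0; rewrite unity_rootE -cF.
    rewrite -(inj_eq (mulfI x0)) -exprS mulr1 prednK; first by rewrite expf_card.
    by rewrite cF prime_gt0.
  - exact: enum_uniq.
  - by rewrite -cardE cardsC1 cF.
have := prim_expr_order wP; rewrite p8 => w8.
exists (w ^+ (p.-1 %/ 8)); rewrite -exprM.
have /eqP : (w ^+ (p.-1 %/ 8 * 4) - 1) * (w ^+ (p.-1 %/ 8 * 4) + 1) = 0.
  have -> : (w ^+ (p.-1 %/ 8 * 4) - 1) * (w ^+ (p.-1 %/ 8 * 4) + 1) = w ^+ (p.-1 %/ 8 * 4) ^+ 2 - 1 by ring.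
  by rewrite -exprM (_ : (_ * 2 = 8 * (p.-1 %/ 8))%N) ?w8 ?subrr //; lia.
rewrite mulf_eq0 subr_eq0 addr_eq0 => /orP[|/eqP //].
rewrite -(prim_order_dvd wP) => /dvdn_leq; lia.
Qed.

End L2Field.

(** * The action of words on L_2(p) *)

Section LSystem.
Variables (F : fieldType) (z : F) (gT : finGroupType) (L : {group gT}).
Variables (D W : gT) (T : F -> gT).
Hypothesis LD : L2_data z L D W T.
Hypothesis zE : (z * z = z - 1)%R.

(** The ring homomorphism from Z[zeta] to F that sends zeta to z. *)
Definition zmap (a : hexlattice) : F := (a.1%:~R + a.2%:~R * z)%R.

Lemma zmapD a b : zmap (a + b)%R = (zmap a + zmap b)%R.
Proof.
by case: a b => [a1 a2] [b1 b2]; rewrite /zmap /= !rmorphD /=; ring.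
Qed.

Lemma z3 : (z ^+ 3 = -1)%R.
Proof.
by transitivity (z * (z * z))%R; [ring|rewrite zE mulrBr zE; ring].
Qed.

Lemma zmap_unit k : k < 6 -> zmap (unit6 k) = (z ^+ k)%R.
Proof.
have z2 : (z ^+ 2 = z - 1)%R by rewrite -zE; ring.
have z4 : (z ^+ 4 = - z)%R by rewrite exprS z3; ring.
have z5 : (z ^+ 5 = 1 - z)%R.
  by transitivity (z * z ^+ 4)%R; [rewrite -exprS|rewrite z4 mulrN zE; ring].
by move: k; apply: k6_ind; rewrite /zmap /= ?z2 ?z3 ?z4 ?z5 ?rmorphN ?rmorph1 ?rmorph0; ring.
Qed.

(** [Lel j] is the value of the rotation r_j r_1 on an even point; on an odd one, marked [true], the
    same rotation gives the inverse. The entry for 3 is x |-> 1 - x. *)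
Definition Lel (j : nat) : gT :=
  match j with 2 => D^-1 | 3 => D ^+ 3 * T 1%R | 4 => W | _ => 1 end%g.

Definition Lr (j : nat) (y : gT * bool) : gT * bool :=
  if y.2 then (Lel j * y.1, false)%g else ((Lel j)^-1 * y.1, true)%g.

Definition rm (y : gT * bool) (h : gT) : gT * bool := (y.1 * h, y.2)%g.

Lemma LrK j y : Lr j (Lr j y) = y.
Proof. by case: y => g [] /=; rewrite /Lr /= ?mulKg ?mulKVg. Qed.

Lemma Lr_col j y : (Lr j y).2 = ~~ y.2.
Proof. by rewrite /Lr; case: y.2. Qed.

Lemma Lr_rm j y h : Lr j (rm y h) = rm (Lr j y) h.
Proof. by rewrite /Lr /rm /=; case: y.2; rewrite /= mulgA. Qed.

Lemma act_Lr_rm w y h : act Lr w (rm y h) = rm (act Lr w y) h.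
Proof. by elim: w => //= j w ->; rewrite Lr_rm. Qed.

Lemma Lel_in j : Lel j \in L.
Proof.
case: j => [|[|[|[|[|j]]]]]; rewrite /Lel ?group1 ?groupV //.
- exact: L2_D LD.
- by rewrite groupM ?groupX ?(L2_D LD) ?(L2_T LD).
- exact: L2_W LD.
Qed.

Lemma act_Lr_in w y : y.1 \in L -> (act Lr w y).1 \in L.
Proof.
move=> yL; elim: w => //= j w; rewrite {2}/Lr; case: (act Lr w y).2 => /= H.
  by rewrite groupM ?Lel_in.
by rewrite groupM ?groupV ?Lel_in.
Qed.

Lemma TDn x k : (T x * D ^+ k = D ^+ k * T (z ^+ k * x)%R)%g.
Proof.
elim: k => [|k IH]; first by rewrite !expg0 mul1g mulg1 GRing.expr0 mul1r.
rewrite expgSr mulgA IH -mulgA (L2_TscD LD) mulgA; congr (_ * T _)%g.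
by rewrite GRing.exprS mulrA.
Qed.

Lemma T0 : T 0%R = 1%g.
Proof. by apply: (mulgI (T 0%R)); rewrite (L2_TD LD) addr0 mulg1. Qed.

Local Notation B := (D ^+ 3 * T 1%R)%g.

Lemma B2 : (B * B = 1)%g.
Proof.
rewrite -mulgA [(T 1%R * _)%g]mulgA TDn -!mulgA (L2_TD LD) z3 mulr1 addNr T0 mulg1.
by rewrite -[RHS](L2_D6 LD) !expgS expg0 mulg1.
Qed.

Lemma B_inv : (B^-1 = B)%g. Proof. by apply/eqP; rewrite eq_invg_mul B2. Qed.

Lemma W_inv : (W^-1 = W)%g. Proof. by apply/eqP; rewrite eq_invg_mul (L2_W2 LD). Qed.

Lemma braid3_of_rel (x b : gT) : (x * b * (x * b * x) = b)%g -> (b * b = 1)%g ->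
  (x * b * x = b * x^-1 * b)%g.
Proof.
move=> e bb; apply: (mulgI (x * b)%g); rewrite e -!mulgA.
by rewrite (mulgA b b) bb mul1g mulKVg.
Qed.

(** The product D B is x |-> z ^ 4 x + 1, of order 3 because z ^ 4 is a nontrivial cube root of
    unity: a rotation about a vertex of the tessellation. *)
Lemma DBD : (D * B * D = B * D^-1 * B)%g.
Proof.
have z5 : (z ^+ 5 + z = 1)%R.
  transitivity (z ^+ 3 * (z * z) + z)%R; first by ring.
  by rewrite z3 zE; ring.
have DB : (D * B = D ^+ 4 * T 1%R)%g by rewrite mulgA -expgS.
have DBD5 : (D * B * D = D ^+ 5 * T z)%g.
  by rewrite DB -(mulgA (D ^+ 4)%g) (L2_TscD LD) mulr1 (mulgA (D ^+ 4)%g) -expgSr.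
apply: braid3_of_rel B2; rewrite DBD5 DB -(mulgA (D ^+ 4)%g) (mulgA (T 1%R)) TDn mulr1.
rewrite -(mulgA (D ^+ 5)%g) (L2_TD LD) z5 (mulgA (D ^+ 4)%g) -expgnDr.
by rewrite -[4 + 5]/(6 + 3) expgnDr (L2_D6 LD) mul1g.
Qed.

Lemma Lr1 y : Lr 1 y = (y.1, ~~ y.2).
Proof. by rewrite /Lr /=; case: y.2; rewrite ?invg1 mul1g. Qed.

Lemma Lr3 y : Lr 3 y = (B * y.1, ~~ y.2)%g.
Proof. by rewrite /Lr [Lel 3]/=; case: y.2; rewrite ?B_inv. Qed.

Lemma Lr4 y : Lr 4 y = (W * y.1, ~~ y.2)%g.
Proof. by rewrite /Lr [Lel 4]/=; case: y.2; rewrite ?W_inv. Qed.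

Lemma Lr2 y : Lr 2 y = ((if y.2 then D^-1 else D) * y.1, ~~ y.2)%g.
Proof. by rewrite /Lr [Lel 2]/=; case: y.2; rewrite ?invgK. Qed.

Lemma WD : (W * D = D^-1 * W)%g.
Proof. by apply: (mulgI D); rewrite mulgA (L2_DWD LD) mulKVg. Qed.

Lemma WDi : (W * D^-1 = D * W)%g.
Proof. by apply: (mulIg D); rewrite mulgKV (L2_DWD LD). Qed.

Lemma Lr_b3 : b3rel (fun j => Lr j.+1).
Proof.
split=> [j y _|y|y|y]; first exact: LrK.
- rewrite !(Lr2, Lr4) /=; case: y => g [] /=; congr pair; rewrite !mulgA ?WD ?WDi //.
- rewrite !(Lr2, Lr3); move: DBD B_inv; move: (D ^+ 3 * T 1%R)%g => b e bi.
  case: y => g [] /=; congr pair; rewrite !mulgA; congr (_ * g)%g; last by rewrite e.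
  by have := congr1 invg e; rewrite !invMg invgK bi !mulgA.
rewrite !(Lr3, Lr4); move: (L2_WB4 LD) B_inv; move: (D ^+ 3 * T 1%R)%g => b b4 bi.
rewrite /= !negbK; congr pair; rewrite !mulgA; congr (_ * y.1)%g.
have e : (W * b * (W * b) = (W * b * (W * b))^-1)%g.
  apply/eqP; rewrite eq_sym eq_invg_mul; apply/eqP; rewrite -[RHS]b4.
  by rewrite !expgS expg0 mulg1 !mulgA.
by move: e; rewrite !invMg bi W_inv !mulgA.
Qed.

Lemma Lr_comm i j y : 0 < i -> i.+1 < j -> j <= 4 -> Lr i (Lr j y) = Lr j (Lr i y).
Proof.
move=> i0 ij j4; have : i = 1 /\ j = 3 \/ (i = 1 /\ j = 4 \/ i = 2 /\ j = 4) by lia.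
case=> [|[]] [-> ->].
- by rewrite !(Lr1, Lr3).
- by rewrite !(Lr1, Lr4).
- exact: esym (b3_comm Lr_b3 y).
Qed.

(** The flag (a, k, e) arises from a base flag of its orientation by k turns about the origin
    followed by the translation a; its image applies the same motions in L. Equivariance of this map
    ([hexL_r]) reduces words in r_1, r_2, r_3 to the geometry of the plane. *)
Definition hexL (x : hexflag) : gT * bool := (D ^+ x.1.2 * T (zmap x.1.1), x.2)%g.

Lemma hexL_r j x : 0 < j <= 3 -> hexS x -> hexL (hexr j x) = Lr j (hexL x).
Proof.
case: x => [[a k] e]; rewrite /hexS /= => jn k6; rewrite /hexL.
case: j jn => [|[|[|[|j]]]] // _.
- by rewrite Lr1.
- rewrite Lr2 /=; congr pair; rewrite (expg_mod _ (L2_D6 LD)) mulgA; congr (_ * _)%g.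
  case: e; last by rewrite addn1 expgS.
  by apply: (mulgI D); rewrite mulKVg -expgS -addnS expgnDr (L2_D6 LD) mulg1.
rewrite Lr3 /=; congr pair; rewrite (expg_mod _ (L2_D6 LD)).
rewrite zmapD zmap_unit // -(mulgA (D ^+ 3)%g) (mulgA (T _)) TDn mulr1.
by rewrite -(mulgA (D ^+ k)%g) (L2_TD LD) (mulgA (D ^+ 3)%g) -expgnDr addnC addrC.
Qed.

Lemma hexL_act w x : word 3 w -> hexS x -> act Lr w (hexL x) = hexL (act hexr w x).
Proof.
move=> ww Sx; elim: w ww => //= j w IH /andP[/and3P[j0 jn _] ww].
by rewrite IH // hexL_r ?j0 //; apply: hex_actS.
Qed.

Hypothesis F_surj : forall x : F, exists m : nat, x = m%:R%R.

Lemma word34 w : word 3 w -> word 4 w.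
Proof. by apply: sub_all => j /and3P[j0 j3 _]; apply/and3P; split=> //; apply: leq_trans j3 _. Qed.

Lemma Lr_gen h : h \in L -> exists2 w, word 4 w & act Lr w (1%g, false) = (h, false).
Proof.
pose H := [set h | `[< exists2 w, word 4 w & act Lr w (1%g, false) = (h, false) >]].
have HP x : reflect (exists2 w, word 4 w & act Lr w (1%g, false) = (x, false)) (x \in H).
  by rewrite inE; apply: asboolP.
have gH : group_set H.
  apply/group_setP; split; first by apply/HP; exists [::].
  move=> x y /HP[w ww wE] /HP[u wu uE]; apply/HP; exists (w ++ u).
    by rewrite /word all_cat -!/(word 4 _) ww.
  by rewrite act_cat uE; have := act_Lr_rm w (1%g, false) y; rewrite /rm /= mul1g wE => ->.
have WH : W \in Group gH.
  by apply/HP; exists [:: 1; 4] => //; rewrite /act /= Lr4 Lr1 /= mulg1.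
have TH x : T x \in Group gH.
  (* As F is a prime field, [T x] is the image of the translation by a multiple of (1, 0). *)
  have [m xm] := F_surj x.
  have [w ww wE] := @hex_reach_all hex0 ((Posz m, 0%R), 0, false) isT isT.
  apply/HP; exists w; first exact: word34.
  have <- : hexL hex0 = (1%g, false) by rewrite /hexL /= /zmap /= !mulr0z mul0r addr0 T0 expg0 mulg1.
  rewrite hexL_act // wE /hexL /= expg0 mul1g /zmap /= mulr0z mul0r addr0.
  by rewrite xm.
move=> hL; apply/HP; exact: (subsetP (L2_gen LD WH TH)).
Qed.

End LSystem.

(** * Parity of flags in a directly regular polytope *)

Section RegularSystem.
Variables (d : Order.disp_t) (Q : finPOrderType d) (n : nat) (q0 : Q) (Phi : {set Q}).
Hypothesis regQ : regular Q n.
Hypothesis fPhi : Phi \in flags Q.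

Local Notation rQ := (flip n q0).
Local Notation fQ := (face q0).

Lemma regular_rep : flagrep n (fun A => A \in flags Q) rQ fQ.
Proof. by case: regQ => pQ _; apply: polytope_rep. Qed.

Let R := regular_rep.

Lemma flag_sep A B : A \in flags Q -> B \in flags Q -> eqf n fQ A B -> A = B.
Proof. by case: regQ => pQ _ fA fB e; apply: (flag_eq pQ fA fB e). Qed.

Lemma flag_stab w A B : word n w -> A \in flags Q -> B \in flags Q ->
  act rQ w A = A -> act rQ w B = B.
Proof.
move=> ww fA fB e; apply: flag_sep => //; first exact: (rep_actS R).
apply/(regular_stab R regQ fA fB ww) => k kn; by rewrite e.
Qed.

Lemma aut_flag_in s A : s \in autgroup Q -> A \in flags Q -> s @: A \in flags Q.
Proof.
move=> sA fA; have [B fB c] := aut_corr R sA fA; have := corr_fl c.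
by case: regQ => pQ _; rewrite !(fl_face q0 pQ) // => ->.
Qed.

Lemma aut_flag_corr s A : s \in autgroup Q -> A \in flags Q -> corr n fQ fQ s A (s @: A).
Proof.
move=> sA fA; have [B fB c] := aut_corr R sA fA; have := corr_fl c.
by case: regQ => pQ _; rewrite !(fl_face q0 pQ) // => ->.
Qed.

Lemma aut_act s w A : s \in autgroup Q -> word n w -> A \in flags Q ->
  s @: act rQ w A = act rQ w (s @: A).
Proof.
move=> sA ww fA; have fw := rep_actS R ww fA; have fsA := aut_flag_in sA fA.
apply: flag_sep; [exact: aut_flag_in|exact: (rep_actS R)|].
have c := rep_iso_act R R (autP _ sA) ww fA fsA (aut_flag_corr sA fA).
by move=> k kn; rewrite -c // (aut_flag_corr sA fw).
Qed.

Lemma aut_flip s j A : s \in autgroup Q -> 0 < j <= n -> A \in flags Q ->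
  s @: rQ j A = rQ j (s @: A).
Proof.
move=> sA /andP[j0 jn] fA; apply: (aut_act (w := [:: j]) sA _ fA).
by rewrite /word /= andbT; apply/and3P.
Qed.

Lemma aut_free s t : s \in autgroup Q -> t \in autgroup Q -> s @: Phi = t @: Phi -> s = t.
Proof.
move=> sA tA e; apply: (corr_aut_inj R fPhi sA tA (aut_flag_in sA fPhi)).
  exact: aut_flag_corr.
by rewrite e; apply: aut_flag_corr.
Qed.

Lemma aut_trans A : A \in flags Q -> exists2 s, s \in autgroup Q & s @: Phi = A.
Proof.
case: regQ => _ tr fA; have := atransP2 tr fPhi fA.
by case=> s sA ->; exists s.
Qed.

Lemma imset_permM (s t : {perm Q}) (A : {set Q}) : (s * t)%g @: A = t @: (s @: A).
Proof.
by rewrite -imset_comp; apply: eq_imset => x; rewrite /= permM.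
Qed.

Lemma imset_perm1 (A : {set Q}) : (1%g : {perm Q}) @: A = A.
Proof. by rewrite -[RHS]imset_id; apply: eq_imset => x; rewrite perm1. Qed.

Lemma rhoP i : i < n -> rho Phi i \in autgroup Q /\ rho Phi i @: Phi = rQ i.+1 Phi.
Proof.
move=> iN; have [pQ _] := regQ; have iP : 0 < i.+1 <= n by lia.
have flE A : A \in flags Q -> fl n fQ A = A by apply: fl_face.
have adjP A : A \in flags Q -> i_adjacent i Phi A <-> rQ i.+1 Phi = A.
  move=> fA; have := i_adjacentP R iN fPhi fA; rewrite !flE // => H.
  split=> [/H e|<-]; first by apply: flag_sep => //; apply: (rep_S R).
  by have := i_adjacentP R iN fPhi (rep_S R iP fPhi); rewrite !flE //; [case=> _; apply|apply: (rep_S R)].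
rewrite /rho; case: pickP => [s /andP[sA]|no].
  by move=> /(adjP _ (aut_flag_in sA fPhi)) ->.
have [s sA sE] := aut_trans (rep_S R iP fPhi).
have := no s; rewrite /= sA (_ : i_adjacent _ _ _) //.
by apply/adjP; rewrite ?aut_flag_in ?sE.
Qed.

Definition even_flag A := [exists s in rotgroup n Phi, A == s @: Phi].

Hypothesis index2 : #|autgroup Q : rotgroup n Phi|%g = 2.

(** The product telescopes into products of consecutive involutions, which are the generators or
    their inverses. *)
Lemma rho_rho_rot i j : i < n -> j < n -> (rho Phi i * rho Phi j)%g \in rotgroup n Phi.
Proof.
have rr k : k < n -> (rho Phi k * rho Phi k = 1)%g.
  move=> kN; have [kA kE] := rhoP kN; have kP : 0 < k.+1 <= n by lia.
  apply: aut_free; rewrite ?groupM ?group1 // imset_permM kE.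
  rewrite aut_flip ?kE ?(rep_inv R) //.
  by rewrite imset_perm1.
have step k : k.+1 < n -> (rho Phi k * rho Phi k.+1)%g \in rotgroup n Phi.
  by move=> kN; apply: mem_gen; apply/imsetP; exists (Ordinal kN); rewrite ?inE.
have rV k : k < n -> ((rho Phi k)^-1 = rho Phi k)%g.
  by move=> /rr kk; apply/eqP; rewrite eq_invg_mul kk.
have up m k : k + m < n -> (rho Phi k * rho Phi (k + m))%g \in rotgroup n Phi.
  elim: m => [|m IH] km; first by rewrite addn0 rr ?group1 //; lia.
  rewrite addnS in km *.
  have := groupM (IH (ltnW km)) (step (k + m) km).
  by rewrite -mulgA (mulgA (rho Phi (k + m))) rr ?mul1g //; lia.
move=> iN jN; have [ij|ji] := leqP i j; first by rewrite -(subnKC ij); apply: up; rewrite subnKC.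
have := up (i - j) j; rewrite subnKC; last exact: ltnW.
by move=> /(_ iN); rewrite -groupV invMg !rV.
Qed.

Lemma rot_aut s : s \in rotgroup n Phi -> s \in autgroup Q.
Proof.
apply: subsetP; rewrite gen_subG; apply/subsetP=> _ /imsetP[i i0 ->].
have iN := ltn_ord i; rewrite groupM //; apply: (proj1 (rhoP _)) => //.
by apply: leq_ltn_trans (leq_pred _) iN.
Qed.

Lemma rho_mul s j A : s \in autgroup Q -> A = s @: Phi -> j < n ->
  rQ j.+1 A = (rho Phi j * s)%g @: Phi.
Proof.
move=> sA -> jN; have [jA jE] := rhoP jN.
by rewrite imset_permM jE aut_flip.
Qed.

(** If one [rho] were a rotation, all would be by [rho_rho_rot], and the index would be 1. *)
Lemma rho_notin i : i < n -> rho Phi i \notin rotgroup n Phi.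
Proof.
move=> iN; apply/negP=> iR.
have allR j : j < n -> rho Phi j \in rotgroup n Phi.
  by move=> jN; rewrite -(groupMl _ iR) rho_rho_rot.
suff sub : autgroup Q \subset rotgroup n Phi.
  by move: index2; have /eqP-> : #|autgroup Q : rotgroup n Phi|%g == 1 by rewrite indexg_eq1.
apply/subsetP=> s sA.
have [w ww e] := rep_reach R fPhi (aut_flag_in sA fPhi).
have {}e := flag_sep (rep_actS R ww fPhi) (aut_flag_in sA fPhi) e.
have [t tR tE] : exists2 t, t \in rotgroup n Phi & act rQ w Phi = t @: Phi.
  elim: w ww {e} => [_|j w IH /= /andP[/and3P[j0 jn _] ww]].
    by exists 1%g; rewrite ?group1 ?imset_perm1.
  have [t tR tE] := IH ww; have jE : j = j.-1.+1 by lia.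
  rewrite jE in jn *.
  by exists (rho Phi j.-1 * t)%g; [rewrite groupM ?allR|rewrite (rho_mul (rot_aut tR) tE)].
by rewrite (aut_free sA (rot_aut tR)) // -tE e.
Qed.

Lemma even_flagP A : reflect (exists2 s, s \in rotgroup n Phi & A = s @: Phi) (even_flag A).
Proof.
apply: (iffP existsP) => [[s /andP[sR /eqP->]]|[s sR ->]]; first by exists s.
by exists s; rewrite sR eqxx.
Qed.

Lemma even_Phi : even_flag Phi.
Proof.
by apply/even_flagP; exists 1%g; rewrite ?group1 ?imset_perm1.
Qed.

Lemma even_flip j A : 0 < j <= n -> A \in flags Q -> even_flag (rQ j A) = ~~ even_flag A.
Proof.
move=> jP fA; have jE : j = j.-1.+1 by lia.
have jN : j.-1 < n by lia.
have n0 : 0 < n by lia.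
rewrite jE; case: (boolP (even_flag A)) => /=.
  case/even_flagP=> t tR tE; apply/negbTE/negP => /even_flagP[t' tR' tE'].
  have tA := rot_aut tR; have [jA _] := rhoP jN.
  rewrite (rho_mul tA tE jN) in tE'.
  have e := aut_free (groupM jA tA) (rot_aut tR') tE'.
  by case/negP: (rho_notin jN); rewrite -(groupMr _ tR) e.
move=> nA.
have [s sA sE] := aut_trans fA.
have [w ww e] := rep_reach R fPhi fA.
have {}e := flag_sep (rep_actS R ww fPhi) fA e.
(* Along a word, every flag is the image of [Phi] under a rotation t or under [rho Phi 0 * t]. *)
have [eA|[t tR tE]] : even_flag A \/ exists2 t, t \in rotgroup n Phi & A = (rho Phi 0 * t)%g @: Phi.
- rewrite -e; elim: w ww {e} => [_|i w IH /= /andP[/and3P[i0 iN _] ww]].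
    by left; apply: even_Phi.
  have iE : i = i.-1.+1 by lia.
  have iN' : i.-1 < n by lia.
  have [A0 _] := rhoP n0; have [Ai _] := rhoP iN'.
  rewrite iE; case: (IH ww) => [/even_flagP[t tR tE]|[t tR tE]].
    right; exists (rho Phi 0 * rho Phi i.-1 * t)%g; first by rewrite groupM ?rho_rho_rot.
    rewrite (rho_mul (rot_aut tR) tE iN') !mulgA.
    have -> : (rho Phi 0 * rho Phi 0 = 1)%g; last by rewrite mul1g.
    have := rhoP n0 => -[A0' E0]; have P1 : 0 < 1 <= n by rewrite n0.
    apply: aut_free; rewrite ?groupM ?group1 // imset_permM E0 aut_flip ?E0 ?(rep_inv R) //.
    by rewrite imset_perm1.
  left; apply/even_flagP; exists (rho Phi i.-1 * rho Phi 0 * t)%g.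
    by rewrite groupM ?rho_rho_rot.
  by rewrite (rho_mul _ tE iN') ?mulgA // groupM // rot_aut.
- by rewrite eA in nA.
apply/even_flagP; exists (rho Phi j.-1 * rho Phi 0 * t)%g; first by rewrite groupM ?rho_rho_rot.
have [A0 _] := rhoP n0.
by rewrite (rho_mul _ tE jN) ?mulgA // groupM // rot_aut.
Qed.

End RegularSystem.

(** * Goursat's lemma and the mix of Q with L_2(p) *)

(** The l with (l, 1) in G form a normal subgroup of L. If it is trivial, G maps bijectively onto M
    and, having L as a quotient, forces the order of L to divide that of M. Otherwise it is L, so G
    contains L x 1 and hence everything. *)
Lemma goursat_simple (aT bT : finGroupType) (L : {group aT}) (M : {group bT})
    (G : {group aT * bT}) :
  (forall N : {group aT}, (N <| L)%g -> N :=: 1%g \/ N :=: L) ->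
  ~~ (#|L| %| #|M|) -> G \subset setX L M ->
  (forall l, l \in L -> exists s, (l, s) \in G) ->
  (forall s, s \in M -> exists l, (l, s) \in G) ->
  setX L M \subset G.
Proof.
move=> simL ndvd /subsetP sub ex1 ex2.
pose N := [set l | (l, 1%g) \in G].
have gN : group_set N.
  apply/group_setP; split; first by rewrite inE; apply: (group1 G).
  move=> x y; rewrite !inE => xG yG; have := groupM xG yG.
  by rewrite -[((x, 1) * (y, 1))%g]/((x * y)%g, (1 * 1)%g) mulg1.
have NL : Group gN \subset L.
  by apply/subsetP=> l; rewrite inE => /sub/setXP[].
have nN : (Group gN <| L)%g.
  rewrite /normal NL; apply/subsetP=> h hL; rewrite inE; apply/subsetP=> _ /imsetP[l lN ->].
  have [s sG] := ex1 h hL; move: lN; rewrite !inE => lG.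
  have := groupJ lG sG; rewrite -[((l, 1) ^ (h, s))%g]/((l ^ h)%g, (1 ^ s)%g) conj1g //.
case: (simL _ nN) => NE.
  case/negP: ndvd.
  have inj : {in G &, injective snd}.
    move=> [x s] [y t] xG yG /= st; rewrite st in xG *; congr pair.
    have := groupM xG (groupVr yG).
    rewrite -[((x, t) * (y, t)^-1)%g]/((x * y^-1)%g, (t * t^-1)%g) mulgV => xyG.
    have : (x * y^-1)%g \in Group gN by rewrite inE.
    by rewrite NE => /set1P/eqP; rewrite -eq_mulgV1 => /eqP.
  have <- : snd @: G = M.
    apply/setP=> s; apply/imsetP/idP => [[[x t] /sub/setXP[_ tM] -> //]|sM].
    by have [l lG] := ex2 s sM; exists (l, s).
  rewrite card_in_imset //.
  pose f := @fst aT bT.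
  have fM : {in G &, {morph f : x y / (x * y)%g}} by move=> [x s] [y t].
  have -> : L :=: (Morphism fM @* G)%g.
    apply/setP=> l; rewrite morphimEdom; apply/idP/imsetP => [lL|[[x s] /sub/setXP[xL _] ->] //].
    by have [s sG] := ex1 l lL; exists (l, s).
  exact: dvdn_morphim.
apply/subsetP=> -[l s] /setXP[lL sM]; have [l' lG] := ex2 s sM.
have [/= l'L _] := setXP (sub _ lG).
have : (l * l'^-1)%g \in Group gN by rewrite NE groupM ?groupV.
rewrite inE => H; have := groupM H lG.
by rewrite -[((_, 1) * (l', s))%g]/((l * l'^-1 * l')%g, (1 * s)%g) mulgKV mul1g.
Qed.

Lemma shift_word n u : all (letters n.+1 (pred1 1)) u ->
  word n (map predn u) /\ u = map succn (map predn u).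
Proof.
move=> au; split.
  rewrite /word all_map; apply: sub_all au => j /and3P[j0 jn j1].
  by change (letters n pred0 j.-1); rewrite /letters /= in j1 *; lia.
rewrite -map_comp -[LHS]map_id; apply/eq_in_map => j /(allP au)/and3P[j0 _ _] /=.
by rewrite prednK.
Qed.

Section XSystem.
Variables (F : fieldType) (z : F) (gT : finGroupType) (L : {group gT}).
Variables (D W : gT) (T : F -> gT).
Hypothesis LD : L2_data z L D W T.
Hypothesis zE : (z * z = z - 1)%R.
Hypothesis F_surj : forall x : F, exists m : nat, x = m%:R%R.
Variables (d : Order.disp_t) (Q : finPOrderType d) (q0 : Q) (Phi : {set Q}).
Hypothesis regQ : regular Q 4.
Hypothesis fPhi : Phi \in flags Q.
Hypothesis index2 : #|autgroup Q : rotgroup 4 Phi|%g = 2.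
Hypothesis order_ndvd : ~~ (2 * #|L| %| #|autgroup Q|).

Local Notation rQ := (flip 4 q0).
Local Notation fQ := (face q0).
Local Notation Lr := (Lr D W T).
Local Notation rot := (rotgroup 4 Phi).

Hypothesis vert : forall w, word 3 w -> act rQ (map succn w) Phi = Phi -> weq w [::].

Definition ec (A : {set Q}) := ~~ even_flag 4 Phi A.

Definition xflag := (gT * {set Q})%type.
Definition xS (x : xflag) := (x.1 \in L) && (x.2 \in flags Q).
Definition xr (j : nat) (x : xflag) : xflag := ((Lr j (x.1, ec x.2)).1, rQ j x.2).
Definition xto (x : xflag) (g : gT * {perm Q}) : xflag := (x.1 * g.1, g.2 @: x.2)%g.
Definition x0 : xflag := (1%g, Phi).

Let RQ := regular_rep q0 regQ.

Lemma xS0 : xS x0. Proof. by rewrite /xS group1. Qed.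

Lemma ec_flip j A : 0 < j <= 4 -> A \in flags Q -> ec (rQ j A) = ~~ ec A.
Proof. by move=> jn fA; rewrite /ec (even_flip q0 regQ fPhi index2). Qed.

Lemma ec_Phi : ec Phi = false. Proof. by rewrite /ec even_Phi. Qed.

Lemma xact w l A : word 4 w -> A \in flags Q ->
  act xr w (l, A) = ((act Lr w (l, ec A)).1, act rQ w A) /\
  (act Lr w (l, ec A)).2 = ec (act rQ w A).
Proof.
move=> ww fA; elim: w ww => //= j w IH /andP[/and3P[j0 jn _] ww].
have jP : 0 < j <= 4 by rewrite j0.
have [-> e2] := IH ww; have fw := rep_actS RQ ww fA.
rewrite ec_flip // -e2 Lr_col; split=> //.
by rewrite /xr /= -e2; case: (act Lr w _).
Qed.

Lemma xS_r j x : 0 < j <= 4 -> xS x -> xS (xr j x).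
Proof.
case: x => l A jn /andP[/= lL fA]; apply/andP; split; last exact: (rep_S RQ).
exact: (act_Lr_in LD [:: j]).
Qed.

Lemma xrK j x : 0 < j <= 4 -> xS x -> xr j (xr j x) = x.
Proof.
case: x => l A jn /andP[/= lL fA]; rewrite /xr /= (rep_inv RQ) // ec_flip //; congr pair.
have := LrK D W T j (l, ec A); have := Lr_col D W T j (l, ec A).
by case: (Lr j _) => g e /= -> ->.
Qed.

Lemma xr_neq j x : 0 < j <= 4 -> xS x -> xr j x <> x.
Proof.
case: x => l A jn /andP[/= lL fA] [_ e]; apply: (rep_mov RQ jn fA).
by rewrite e.
Qed.

Lemma xrC i j x : 0 < i -> i.+1 < j -> j <= 4 -> xS x -> xr i (xr j x) = xr j (xr i x).
Proof.
case: x => l A i0 ij j4 /andP[/= lL fA].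
have iP : 0 < i <= 4 by lia.
have jP : 0 < j <= 4 by lia.
rewrite /xr /= !ec_flip //; congr pair; last first.
  apply: (flag_sep regQ); [do 2!apply: (rep_S RQ) => //|do 2!apply: (rep_S RQ) => //|].
  exact: (rep_comm RQ).
have := Lr_comm LD zE (l, ec A) i0 ij j4.
have := Lr_col D W T j (l, ec A); have := Lr_col D W T i (l, ec A).
by case: (Lr j (l, _)) => g e; case: (Lr i (l, _)) => g' e' /= -> -> ->.
Qed.

Lemma xto_S x g : xS x -> g \in setX L rot -> xS (xto x g).
Proof.
case: x g => l A [h s] /andP[/= lL fA] /setXP[hL sR].
rewrite /xS /= groupM //=; apply: (aut_flag_in q0 regQ) => //.
exact: (rot_aut q0 regQ fPhi).
Qed.

Lemma ec_to s A : s \in rot -> A \in flags Q -> ec (s @: A) = ec A.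
Proof.
move=> sR fA; congr negb; apply/even_flagP/even_flagP => -[t tR tE].
  exists (t * s^-1)%g; first by rewrite groupM ?groupV.
  by rewrite imset_permM -tE -imset_permM mulgV imset_perm1.
by exists (t * s)%g; [rewrite groupM|rewrite imset_permM -tE].
Qed.

Lemma xto_r j x g : 0 < j <= 4 -> xS x -> g \in setX L rot -> xto (xr j x) g = xr j (xto x g).
Proof.
case: x g => l A [h s] jn /andP[/= lL fA] /setXP[hL sR].
rewrite /xto /xr /= (aut_flip q0 regQ) ?(rot_aut q0 regQ fPhi sR) // ec_to //; congr pair.
by have := Lr_rm D W T j (l, ec A) h; rewrite /rm /= => ->.
Qed.

Lemma xtoM x g h : xto x (g * h)%g = xto (xto x g) h.
Proof.
by case: x g h => l A [g s] [h t]; rewrite /xto /= mulgA imset_permM.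
Qed.

Lemma xto_act w x g : word 4 w -> xS x -> g \in setX L rot ->
  xto (act xr w x) g = act xr w (xto x g).
Proof.
move=> ww Sx gG; elim: w ww => //= j w IH /andP[/and3P[j0 jn _] ww].
by rewrite xto_r ?j0 ?IH //; apply: (actS xS_r ww Sx).
Qed.

(** The g whose translate of [x0] is reachable form a subgroup, because the action commutes with
    words; it projects onto each factor because L_2(p) and Q are connected separately. *)
Lemma xreach0 g : g \in setX L rot -> reach 4 xr pred0 x0 (xto x0 g).
Proof.
pose G := [set g in setX L rot | `[< reach 4 xr pred0 x0 (xto x0 g) >]].
have GP y : reflect (y \in setX L rot /\ reach 4 xr pred0 x0 (xto x0 y)) (y \in G).
  rewrite /G [X in reflect _ X]in_set; apply: (iffP idP) => [/andP[yX /asboolP yR]|[yX yR]]; first by [].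
  by apply/andP; split=> //; apply/asboolP.
have gG : group_set G.
  apply/group_setP; split.
    apply/GP; split; first exact: group1.
    by exists [::] => //; rewrite /xto /= mulg1 imset_perm1.
  move=> x y /GP[xX [w ww wE]] /GP[yX [u wu uE]]; apply/GP; split; first exact: groupM.
  exists (w ++ u); first by rewrite all_cat ww.
  by rewrite act_cat uE xtoM -wE xto_act ?xS0.
suff sub : setX L rot \subset Group gG by move/(subsetP sub)/GP=> [].
have ww0 j w : word j w -> all (letters j pred0) w by [].
apply: (goursat_simple (L2_simple LD)).
(* The order of the automorphism group of Q is twice that of [rot], which cancels the factor 2 in
   the hypothesis. *)
- apply: contraNN order_ndvd => dv.
  have sR : rot \subset autgroup Q by apply/subsetP=> s; apply: (rot_aut q0 regQ fPhi).
  by rewrite -(Lagrange sR) index2 mulnC dvdn_mul.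
- by apply/subsetP=> y /GP[].
- move=> l lL; have [w ww wE] := Lr_gen LD zE F_surj lL.
  have [e1 e2] := xact 1%g ww fPhi; rewrite ec_Phi wE in e1 e2.
  have /even_flagP[s sR sE] : even_flag 4 Phi (act rQ w Phi).
    by move: e2; rewrite /ec /=; case: even_flag.
  exists s; apply/GP; split; first by apply/setXP.
  by exists w => //; rewrite e1 sE /xto /= mul1g.
move=> s sR; have fs := aut_flag_in q0 regQ (rot_aut q0 regQ fPhi sR) fPhi.
have [w ww e] := rep_reach RQ fPhi fs.
have {}e := flag_sep regQ (rep_actS RQ ww fPhi) fs e.
have [e1 _] := xact 1%g ww fPhi.
exists (act Lr w (1%g, ec Phi)).1; apply/GP; split.
  by apply/setXP; split=> //; apply: (act_Lr_in LD); apply: group1.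
by exists w => //; rewrite e1 e /xto /= mul1g.
Qed.

Lemma xcol0 x : xS x -> ec x.2 = false -> exists2 g, g \in setX L rot & x = xto x0 g.
Proof.
case: x => l A /andP[/= lL fA] /negbFE/even_flagP[s sR sE].
by exists (l, s); [apply/setXP|rewrite /xto /= mul1g -sE].
Qed.

Lemma xreach x y : xS x -> xS y -> reach 4 xr pred0 x y.
Proof.
have H u : xS u -> reach 4 xr pred0 x0 u.
  move=> Su; case e: (ec u.2); last first.
    by have [g gG ->] := xcol0 Su e; apply: xreach0.
  have S1 : xS (xr 1 u) by apply: xS_r.
  have e1 : ec (xr 1 u).2 = false by rewrite ec_flip ?e //; case/andP: Su.
  have [g gG E] := xcol0 S1 e1.
  rewrite -(xrK (j := 1) _ Su) // E; apply: reach_trans (xreach0 gG) _.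
  exact: reach_r.
move=> Sx Sy; apply: reach_trans (H y Sy).
by apply: (reach_sym xS_r xrK xS0); apply: H.
Qed.

(** A word avoiding [K] exists in Q. In P its end differs from y at most in the first component, and
    the two are joined by a word avoiding 1 that fixes a flag of Q. Such a word is trivial in B3,
    hence on L_2(p), and the difference vanishes. *)
Lemma xmeet1 (K : pred nat) x y : xS x -> xS y -> K 1 ->
  (forall k, 0 < k <= 4 -> K k -> reach 4 xr (pred1 k) x y) -> reach 4 xr K x y.
Proof.
case: x y => l A [l' A'] Sx Sy K1 H.
have [/= lL fA] := andP Sx; have [/= lL' fA'] := andP Sy.
have [k kn Kk|w aw wE] := rep_conn RQ (K := K) fA fA' _.
  have [w aw wE] := H k kn Kk; have [e _] := xact l (letters_word aw) fA.
  have -> : A' = act rQ w A by move: wE; rewrite e => -[].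
  have [k0 k4] := andP kn.
  by rewrite (rep_act_fix RQ aw (leqW k4) _ fA) // /letters /= eqxx !andbF.
have ww := letters_word aw.
have {}wE := flag_sep regQ (rep_actS RQ ww fA) fA' wE.
have [e _] := xact l ww fA; exists w => //; rewrite e wE.
set l1 := (act Lr w _).1.
have Sx' : xS (l1, A') by rewrite /xS /= fA' andbT; apply: (act_Lr_in LD).
have xx' : reach 4 xr (pred1 1) (l, A) (l1, A').
  exists w; last by rewrite e wE.
  by apply: sub_all aw => j; apply: letters_sub => i /eqP->.
have [u au uE] := reach_trans (reach_sym xS_r xrK Sx xx') (H 1 isT K1).
have [wu' uu'] := shift_word au; set u' := map predn u in wu' uu'.
have wu := letters_word au.
have [e' _] := xact l1 wu fA'; rewrite e' in uE; case: uE => uE1 uE2.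
have uP : act rQ u Phi = Phi by apply: (flag_stab regQ wu fA' fPhi).
rewrite uu' in uP uE1.
have e0 := vert wu' uP (Lr_b3 LD zE) (l1, ec A').
by rewrite -uE1 -(act_shift Lr) e0.
Qed.

Lemma xrep_ex : exists (d' : Order.disp_t) (P : finPOrderType d') (f : nat -> xflag -> P),
  flagrep 4 xS xr f /\ forall x y, xS x -> xS y -> eqf 4 f x y -> x = y.
Proof.
apply: flagrep_ex.
- by exists x0; apply: xS0.
- exact: xS_r.
- exact: xrK.
- exact: xr_neq.
- exact: xrC.
- exact: xreach.
- exact: xmeet1.
Qed.

(** Right multiplication in L and regularity of Q remove the dependence on the point, except for its
    parity. *)
Lemma xstab w x : word 4 w -> xS x -> act xr w x = x <->
  (act Lr w (1%g, ec x.2)).1 = 1%g /\ act rQ w Phi = Phi.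
Proof.
case: x => l A ww /andP[/= lL fA]; have [-> _] := xact l ww fA.
have := act_Lr_rm D W T w (1%g, ec A) l; rewrite {1}/rm /= mul1g => ->.
split=> [[e1 e2]|[e1 e2]].
  split; last exact: (flag_stab regQ ww fA fPhi).
  by apply: (mulIg l); rewrite mul1g.
by rewrite /= e1 mul1g (flag_stab regQ ww fPhi fA).
Qed.

Definition conjv (t : hexlattice) : hexlattice := (t.1 + t.2, - t.2)%R.

(** The odd point (1, true) is the image of the mirrored flag [conjf hex0], and words commute with
    the reflection; so there the same word gives the mirrored translation. *)
Lemma hexLr w t : word 3 w -> act hexr w hex0 = (t, 0, false) ->
  act Lr w (1%g, false) = (T (zmap z t), false) /\
  act Lr w (1%g, true) = (T (zmap z (conjv t)), true).
Proof.
move=> ww e.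
have z0 : T (zmap z (0, 0)%R) = 1%g by rewrite /zmap /= mulr0z mul0r addr0 (T0 LD).
have e0 : hexL z D T hex0 = (1%g, false) by rewrite /hexL /= expg0 mul1g z0.
have e1 : hexL z D T (conjf hex0) = (1%g, true).
  by rewrite /hexL /conjf /= expg0 mul1g addr0 oppr0 z0.
split.
  by rewrite -e0 (hexL_act LD zE) // e /hexL /= expg0 mul1g.
rewrite -e1 (hexL_act LD zE) // conjf_act // e /hexL /conjf /=.
by rewrite (_ : (6 - 0) %% 6 = 0) // expg0 mul1g.
Qed.

Lemma act_Lr_rev w y : act Lr (rev w) (act Lr w y) = y.
Proof.
by elim: w => //= j w IH; rewrite rev_cons -cats1 act_cat /= LrK.
Qed.

Variable v : hexlattice.
Hypothesis v0 : zmap z v = 0%R.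
Hypothesis cv0 : zmap z (conjv v) != 0%R.

(* The commutator of a word u with trivial value in L but whose mirror image is
   the nontrivial translation T t, and of a word u' acting trivially on Q whose
   mirror image has the value W in L, which does not commute with T t. *)
Lemma chiral_word : exists w, [/\ word 4 w, (act Lr w (1%g, false)).1 = 1%g,
  act rQ w Phi = Phi & (act Lr w (1%g, true)).1 <> 1%g].
Proof.
have [u wu uE] := @hex_reach_all hex0 (v, 0, false) isT isT.
have [uf ut] := hexLr wu uE; rewrite v0 (T0 LD) in uf.
have {}wu : word 4 u := word34 wu.
have P1 : 0 < 1 <= 4 by [].
have f1 := rep_S RQ P1 fPhi.
have e1 : ec (rQ 1 Phi) by rewrite ec_flip // ec_Phi.
have SA : xS (1%g, rQ 1 Phi) by rewrite /xS /= group1.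
have SB : xS (W, rQ 1 Phi) by rewrite /xS /= (L2_W LD).
have [u' wu' u'E] := xreach SA SB.
have {}wu' : word 4 u' := wu'.
have [x1 x2] := xact 1%g wu' f1; rewrite x1 e1 in u'E; case: u'E => u'1 u'2.
have u't : act Lr u' (1%g, true) = (W, true).
  by move: x2; rewrite e1 u'2 e1; move: u'1; case: (act Lr u' _) => g e /= -> ->.
have u'Q A : A \in flags Q -> act rQ u' A = A.
  by move=> fA; apply: (flag_stab regQ wu' f1 fA).
have [_ x2'] := xact 1%g wu' fPhi; rewrite u'Q // ec_Phi in x2'.
have wr : word 4 (rev u) by rewrite /word all_rev.
have wr' : word 4 (rev u') by rewrite /word all_rev.
have uL g e : act Lr u (g, e) = rm (act Lr u (1%g, e)) g.
  by have := act_Lr_rm D W T u (1%g, e) g; rewrite {1}/rm /= mul1g.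
have u'L g e : act Lr u' (g, e) = rm (act Lr u' (1%g, e)) g.
  by have := act_Lr_rm D W T u' (1%g, e) g; rewrite {1}/rm /= mul1g.
exists (rev u' ++ rev u ++ u' ++ u); split.
- by rewrite /word !all_cat -!/(word 4 _) wr wr' wu wu'.
- rewrite !act_cat uf.
  have [h h'] : exists h, act Lr u' (1%g, false) = (h, false).
    by exists (act Lr u' (1%g, false)).1; move: x2'; case: (act Lr u' _) => g e /= ->.
  have hu : act Lr u (h, false) = (h, false) by rewrite uL uf /rm /= mul1g.
  have hr : act Lr (rev u) (h, false) = (h, false) by rewrite -{1}hu act_Lr_rev.
  by rewrite h' hr -h' act_Lr_rev.
- rewrite !act_cat u'Q; last exact: (rep_actS RQ).
  by rewrite (rep_act_rev RQ) // -{1}(u'Q _ fPhi) (rep_act_rev RQ).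
rewrite !act_cat ut (u'L _ true) u't {1}/rm /=; set y := act Lr (rev u) _ => e.
have ww : word 4 (rev u' ++ rev u ++ u' ++ u).
  by rewrite /word !all_cat -!/(word 4 _) wr wr' wu wu'.
have e2 : (act Lr (rev u') y).2 = true.
  have [_] := xact 1%g ww f1; rewrite e1 !act_cat ut (u'L _ true) u't {1}/rm /= -/y => ->.
  rewrite u'Q; last exact: (rep_actS RQ).
  by rewrite (rep_act_rev RQ) // -{1}(u'Q _ f1) (rep_act_rev RQ).
have e3 : act Lr (rev u') y = (1%g, true) by move: e e2; case: (act Lr (rev u') y) => g b /= -> ->.
have y1 : y = (W, true).
  by rewrite -u't -e3; have := act_Lr_rev (rev u') y; rewrite revK => ->.
have : act Lr u y = (W * T (zmap z (conjv v)), true)%g.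
  by rewrite /y; have := act_Lr_rev (rev u); rewrite revK => ->.
rewrite y1 uL ut /rm /= => -[e4].
exact: (L2_T_ncomm LD cv0 (esym e4)).
Qed.

Variables (d' : Order.disp_t) (P : finPOrderType d') (f : nat -> xflag -> P).
Hypothesis R : flagrep 4 xS xr f.
Hypothesis sep : forall x y, xS x -> xS y -> eqf 4 f x y -> x = y.

Lemma xstabE w x : word 4 w -> xS x -> stab 4 xr f x w <->
  (act Lr w (1%g, ec x.2)).1 = 1%g /\ act rQ w Phi = Phi.
Proof.
move=> ww Sx; rewrite -xstab //; split=> [st|st k kn]; last by rewrite st.
by apply: sep => //; apply: (rep_actS R).
Qed.

Lemma xr1_col x : xS x -> xS (xr 1 x) /\ ec (xr 1 x).2 = ~~ ec x.2.
Proof.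
by move=> Sx; split; [apply: xS_r|rewrite ec_flip //; case/andP: Sx].
Qed.

Lemma xP_chiral : chiral P 4.
Proof.
have [w [ww w1 w2 w3]] := chiral_word.
apply: (rep_chiral R (col := fun x => ec x.2)) => //.
- by move=> j [l A] jn /andP[_ fA]; apply: ec_flip.
- by move=> x y Sx Sy e u wu; rewrite !xstabE // e.
have [S1 c1] := xr1_col xS0.
exists x0, (xr 1 x0); split=> [||st]; [exact: xS0|exact: S1|].
have := st w ww; rewrite !xstabE ?xS0 // c1 /= ec_Phi /=.
by case=> H _; case: (H (conj w1 w2)).
Qed.

Lemma xP_isog : autgroup P \isog setX L rot.
Proof.
apply: (rep_isog R (x0 := x0) (to := xto)) => //.
- exact: xS0.
- exact: xto_S.
- exact: xtoM.
- exact: xto_r.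
- move=> [h s] /setXP[hL sR] [e1 e2]; rewrite mul1g in e1; rewrite e1; congr pair.
  apply: (aut_free q0 regQ fPhi); rewrite ?group1 ?(rot_aut q0 regQ fPhi) //.
  by rewrite e2 imset_perm1.
- move=> [l A] [l' A'] [h s] _ _ _ [/mulIg-> e]; congr pair.
  by apply: imset_inj e; apply: perm_inj.
move=> s sA; have [y Sy c] := aut_corr R sA xS0.
have cy : ec y.2 = false.
  (* Automorphisms preserve stabilisers, and the word from [chiral_word] fixes [x0] but no odd flag;
     so parity is preserved. *)
  apply/negbTE/negP=> ey; have [w [ww w1 w2 w3]] := chiral_word; apply: w3.
  have sm := elimT (autP s) sA.
  have := corr_stab R R sm ww xS0 Sy c; rewrite !xstabE ?xS0 // ec_Phi ey.
  by case=> H _; case: (H (conj w1 w2)).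
by have [g gG yE] := xcol0 Sy cy; exists g => //; rewrite -yE.
Qed.

Variable LatQ : hexlattice -> Prop.
Hypothesis hexQ : forall w, word 3 w -> act rQ w Phi = Phi <->
  exists2 t, LatQ t & act hexr w hex0 = (t, 0, false).

Lemma facet_of_rank (G : P) : Defs.rank G = (4%:Z - 1)%R ->
  exists x, [/\ xS x, f 4 x = G & ec x.2 = false].
Proof.
have [k [x [kn Sx <-]]] := rep_surj R G; rewrite (rank_f R) // => e.
have k4 : k = 4 by clear -e; lia.
rewrite k4; case ex: (ec x.2); last by exists x.
have [S1 c1] := xr1_col Sx; exists (xr 1 x); rewrite c1 ex; split=> //.
exact: (rep_fix R).
Qed.

Lemma vertex_of_rank (V : P) : Defs.rank V = 0%R ->
  exists x, [/\ xS x, f 1 x = V & ec x.2 = false].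
Proof.
have [k [x [kn Sx <-]]] := rep_surj R V; rewrite (rank_f R) // => e.
have k1 : k = 1 by clear -e; lia.
rewrite k1; case ex: (ec x.2); last by exists x.
(* Here r_2 changes the parity, as r_1 would move the vertex. *)
have S2 : xS (xr 2 x) by apply: xS_r.
exists (xr 2 x); split=> //; first exact: (rep_fix R).
by rewrite ec_flip ?ex //; case/andP: Sx.
Qed.

Section Facets.
Variable G : P.
Hypothesis G_facet : exists2 x, xS x & f 4 x = G.

Lemma xfacet_rep : flagrep 3 (facet_flags 3 xS f G) xr (facet_face f G).
Proof. exact: (facet_rep R). Qed.

Lemma xfacet_stab w x : word 3 w -> facet_flags 3 xS f G x ->
  stab 3 xr (facet_face f G) x w <->
  (act Lr w (1%g, ec x.2)).1 = 1%g /\ act rQ w Phi = Phi.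
Proof.
move=> ww Sx; have [Sx' _] := Sx; rewrite -xstab //; last exact: word34.
split=> [st|st k kn]; last by rewrite st.
have Sw := rep_actS xfacet_rep ww Sx; have [Sw' _] := Sw.
apply: sep => // k; rewrite leq_eqVlt => /orP[/eqP->|]; first exact: (rep_top R).
by rewrite ltnS => kn; apply/(facet_face_eq R kn Sw Sx)/st.
Qed.

(** A word in r_1, r_2, r_3 trivial on Q is a translation t in [LatQ], and on L_2(p) it acts as
    [T (zmap z t)]; the lattice of the facet is the part of [LatQ] that [zmap z] kills. *)
Lemma xfacet_stab0 w x : word 3 w -> facet_flags 3 xS f G x -> ec x.2 = false ->
  stab 3 xr (facet_face f G) x w <->
  exists2 t, LatQ t /\ zmap z t = 0%R & act hexr w hex0 = (t, 0, false).
Proof.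
move=> ww Sx ex; rewrite xfacet_stab // ex hexQ //; split=> [[e [t Lt tE]]|[t [Lt t0] tE]].
  have [e' _] := hexLr ww tE; exists t => //; split=> //.
  by apply: (L2_T_inj LD); rewrite -e e'.
have [-> _] := hexLr ww tE; rewrite t0 (T0 LD); split=> //.
by exists t.
Qed.

Lemma xfacet_regular : (forall t, LatQ t -> zmap z t = 0%R /\ zmap z (conjv t) = 0%R) ->
  regular (facet_section G) 3.
Proof.
move=> H; apply: (rep_regular xfacet_rep) => x y Sx Sy w ww.
suff E u : facet_flags 3 xS f G u ->
    stab 3 xr (facet_face f G) u w <-> act rQ w Phi = Phi by rewrite !E.
move=> Su; rewrite xfacet_stab //; split=> [[]//|e]; split=> //.
have /(hexQ ww)[t Lt tE] := e; have [e1 e2] := hexLr ww tE; have [t0 ct0] := H t Lt.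
by case: (ec u.2); rewrite ?e1 ?e2 /= ?t0 ?ct0 (T0 LD).
Qed.

Lemma xfacet_chiral t : LatQ t -> zmap z t = 0%R -> zmap z (conjv t) <> 0%R ->
  chiral (facet_section G) 3.
Proof.
move=> Lt t0 ct0; apply: (rep_chiral xfacet_rep (col := fun x => ec x.2)) => //.
- by move=> j [l A] /andP[j0 j3] [/andP[_ fA] _]; apply: ec_flip; rewrite // j0 leqW.
- by move=> x y Sx Sy e u wu; rewrite !xfacet_stab // e.
have [x Sx xG] := G_facet; have [S1 c1] := xr1_col Sx.
have F0 : facet_flags 3 xS f G x by [].
have F1 : facet_flags 3 xS f G (xr 1 x) by split=> //; rewrite (rep_fix R).
have [w ww wE] := @hex_reach_all hex0 (t, 0, false) isT isT.
have {}ww : word 3 w := ww.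
have [e1 e2] := hexLr ww wE.
have wQ : act rQ w Phi = Phi by apply/hexQ => //; exists t.
have nst : ~ same_stab 3 xr (facet_face f G) x (xr 1 x).
  move/(_ w ww); rewrite !xfacet_stab // c1 wQ.
  case: (ec x.2); rewrite /= e1 e2 /= t0 (T0 LD) => -[H1 H2]; apply: ct0; apply: (L2_T_inj LD).
    by case: (H2 (conj erefl erefl)).
  by case: (H1 (conj erefl erefl)).
by exists x, (xr 1 x).
Qed.
End Facets.

Lemma xfacet_torus (b c : int) (G : P) : ~ translation_lattice b c (1, 0)%R ->
  (forall t, LatQ t /\ zmap z t = 0%R <-> translation_lattice b c t) ->
  Defs.rank G = (4%:Z - 1)%R -> poset_iso (facet_section G) (torus63 b c).
Proof.
move=> nL H /facet_of_rank[x [Sx xG ex]].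
have G_facet : exists2 x, xS x & f 4 x = G by exists x.
have Fx : facet_flags 3 xS f G x by [].
have [w ww|g [gb gm _]] := same_stab_iso (xfacet_rep G_facet) (torus_rep nL) Fx (isT : hexS hex0) _.
  rewrite xfacet_stab0 // torus_stab0 //; split=> -[t Lt tE]; exists t => //; exact/H.
by exists g.
Qed.

(** A word on the vertex-figure that is trivial in Q satisfies the B3 relations and is trivial on
    L_2(p) too, so P and Q have the same stabilisers there. *)
Lemma xvertex_iso (d2 : Order.disp_t) (P2 : porderType d2) (V : P) :
  poset_iso (vertex_figure (fQ 1 Phi)) P2 -> Defs.rank V = 0%R ->
  poset_iso (vertex_figure V) P2.
Proof.
move=> [g gb gm] /vertex_of_rank[x [Sx xV ex]].
have RV := vertex_rep R (ex_intro2 _ _ x Sx xV).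
have RQ' := vertex_rep RQ (ex_intro2 _ _ Phi fPhi erefl).
have Vx : vertex_flags xS f V x by [].
have QPhi : vertex_flags (fun A => A \in flags Q) fQ (fQ 1 Phi) Phi by [].
have wS w : word 3 w -> word 4 (map succn w).
  by move=> ww; rewrite /word all_map; apply: sub_all ww => j /and3P[j0 j3 _]; apply/and3P.
have [w ww|h [hb hm _]] := same_stab_iso RV RQ' Vx QPhi _.
  have Sw := rep_actS RV ww Vx; have Qw := rep_actS RQ' ww QPhi.
  have eP : stab 3 (fun j => xr j.+1) (vertex_face f V) x w <-> act xr (map succn w) x = x.
    rewrite /stab; rewrite act_shift in Sw *; split=> [st|-> //].
    apply: sep => //; first by case: Sw.
    by case=> [|k] kn; [apply: (rep_bot R) => //; case: Sw|apply/(vertex_face_eq R kn Sw Vx)/st].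
  have eQ : stab 3 (fun j => rQ j.+1) (vertex_face fQ (fQ 1 Phi)) Phi w <->
      act rQ (map succn w) Phi = Phi.
    rewrite /stab; rewrite act_shift in Qw *; split=> [st|-> //].
    apply: (flag_sep regQ) => //; first by case: Qw.
    by case=> [|k] kn; [apply: (rep_bot RQ) => //; case: Qw|apply/(vertex_face_eq RQ kn Qw QPhi)/st].
  rewrite eP eQ xstab ?wS // ex; split=> [[]//|e]; split=> //.
  by rewrite -(act_shift Lr) (vert ww e (Lr_b3 LD zE)).
exists (g \o h); first exact: bij_comp.
by move=> p q; rewrite /= gm hm.
Qed.

End XSystem.

(** * The type of Q in terms of words *)

Section TypeOfQ.
Variables (d : Order.disp_t) (Q : finPOrderType d) (q0 : Q) (Phi : {set Q}).
Hypothesis regQ : regular Q 4.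
Hypothesis fPhi : Phi \in flags Q.
Local Notation rQ := (flip 4 q0).
Local Notation fQ := (face q0).
Let RQ := regular_rep q0 regQ.

Lemma regular_octahedron_word w : poset_iso (vertex_figure (fQ 1 Phi)) octahedron ->
  word 3 w -> act rQ (map succn w) Phi = Phi -> weq w [::].
Proof.
move=> [g gb gm] ww e.
have RV := vertex_rep RQ (ex_intro2 _ _ Phi fPhi erefl).
have VPhi : vertex_flags (fun A => A \in flags Q) fQ (fQ 1 Phi) Phi by [].
have [y Sy c] := rep_iso_flag RV oct_rep gm VPhi.
apply: (oct_stab ww Sy); apply/(corr_stab RV oct_rep gm ww VPhi Sy c).
by rewrite /stab act_shift e.
Qed.

Lemma regular_torus_word (b c : int) w : ~ translation_lattice b c (1, 0)%R ->
  poset_iso (facet_section (fQ 4 Phi)) (torus63 b c) -> word 3 w ->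
  act rQ w Phi = Phi <->
  exists2 t, translation_lattice b c t & act hexr w hex0 = (t, 0, false).
Proof.
move=> nL [g gb gm] ww; have RT := torus_rep nL.
have RF := facet_rep RQ (ex_intro2 _ _ Phi fPhi erefl).
have FPhi : facet_flags 3 (fun A => A \in flags Q) fQ (fQ 4 Phi) Phi by [].
(* The isomorphism may send [Phi] to a torus flag of the wrong orientation; one application of r_1
   on both sides corrects it, and regularity of Q allows the change of base flag. *)
have [A [y [FA Sy cA y2]]] : exists A y, [/\
    facet_flags 3 (fun A => A \in flags Q) fQ (fQ 4 Phi) A, hexS y,
    corr 3 (facet_face fQ (fQ 4 Phi)) (torf b c) g A y & y.2 = false].
  have [y Sy cy] := rep_iso_flag RF RT gm FPhi.
  case y2: (y.2); last by exists Phi, y.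
  exists (act rQ [:: 1] Phi), (act hexr [:: 1] y); split.
  - exact: (rep_actS RF).
  - exact: hex_actS.
  - exact: (rep_iso_act RF RT gm).
  - by case: y y2 {Sy cy} => [[a i] e] /= ->.
have [fA _] := FA.
have -> : act rQ w Phi = Phi <-> act rQ w A = A.
  by split; apply: (flag_stab regQ (word34 ww)).
have -> : act rQ w A = A <-> stab 3 rQ (facet_face fQ (fQ 4 Phi)) A w.
  have Fw := rep_actS RF ww FA; have [fw _] := Fw.
  split=> [e k kn|st]; first by rewrite e.
  apply: (flag_sep regQ) => // k; rewrite leq_eqVlt => /orP[/eqP->|]; first exact: (rep_top RQ).
  by rewrite ltnS => kn; apply/(facet_face_eq RQ kn Fw FA)/st.
by rewrite (corr_stab RF RT gm ww FA Sy cA) torus_stab // torus_stab0.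
Qed.
End TypeOfQ.

(** * Eisenstein integers modulo p *)

Section EisensteinModP.
Local Open Scope ring_scope.
Variables (p b c : nat).
Hypothesis p_pr : prime p.
Hypothesis b_gt0 : (0 < b)%N.
Hypothesis c_gt0 : (0 < c)%N.
Hypothesis p_norm : p = (b ^ 2 + b * c + c ^ 2)%N.

Lemma Fp_nat_eq0 (k : nat) : (k%:R == 0 :> 'F_p) = (p %| k)%N.
Proof. by rewrite (dvdn_pcharf (pchar_Fp p_pr)). Qed.

Lemma Fp_int_eq0 (k : int) : k%:~R = 0 :> 'F_p <-> exists q : int, k = p%:Z * q.
Proof.
split=> [|[q ->]]; last first.
  by rewrite rmorphM /= -pmulrn (eqP (_ : p%:R == 0 :> 'F_p)) ?mul0r // Fp_nat_eq0.
case: k => k.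
  rewrite -pmulrn => /eqP; rewrite Fp_nat_eq0 => /dvdnP[q ->].
  by exists q%:Z; rewrite PoszM mulrC.
rewrite NegzE rmorphN /= -pmulrn => /eqP; rewrite oppr_eq0 Fp_nat_eq0 => /dvdnP[q ->].
by exists (- q%:Z); rewrite mulrN PoszM mulrC.
Qed.

Definition zroot : 'F_p := - b%:R / c%:R.

Lemma c_Fp_neq0 : (c%:R : 'F_p) != 0.
Proof. by rewrite Fp_nat_eq0; apply/negP=> /dvdn_leq; rewrite c_gt0 => /(_ isT); nia. Qed.

Lemma czroot : c%:R * zroot = - b%:R.
Proof. by rewrite /zroot mulrC divfK ?c_Fp_neq0. Qed.

Lemma p_Fp : b%:R * b%:R + b%:R * c%:R + c%:R * c%:R = 0 :> 'F_p.
Proof.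
rewrite -!natrM -!natrD; apply/eqP; rewrite Fp_nat_eq0 p_norm.
by rewrite !expnS !expn0 !muln1.
Qed.

Lemma zrootE : zroot * zroot = zroot - 1.
Proof.
have c0 := c_Fp_neq0.
apply: (mulfI c0); apply: (mulfI c0).
transitivity ((c%:R * zroot) * (c%:R * zroot)); first by ring.
transitivity (c%:R * (c%:R * zroot) - c%:R * c%:R); last by ring.
rewrite czroot; apply/eqP; rewrite -subr_eq0; apply/eqP.
by rewrite -[RHS]p_Fp; ring.
Qed.

Lemma zmap_zroot (s1 s2 : int) : c%:R * zmap zroot (s1, s2) = (c%:Z * s1 - b%:Z * s2)%:~R.
Proof.
rewrite /zmap /=; transitivity (c%:R * s1%:~R + s2%:~R * (c%:R * zroot)); first by ring.
by rewrite czroot rmorphB !rmorphM /= -!pmulrn; ring.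
Qed.

(** The kernel is the ideal of b + c zeta. Multiplying s by the conjugate (b + c) - c zeta gives the
    coordinates s1 (b + c) + c s2 and b s2 - c s1; both are divisible by p, and the quotients k and
    -q are the coefficients sought. *)
Lemma zmap_eq0 (s1 s2 : int) : zmap zroot (s1, s2) = 0 <-> translation_lattice b c (s1, s2).
Proof.
have c0 := c_Fp_neq0.
have pE : p%:Z = b%:Z * b%:Z + b%:Z * c%:Z + c%:Z * c%:Z.
  by rewrite p_norm !PoszD !PoszM.
have p0 : p%:Z != 0 by have := prime_gt0 p_pr; lia.
rewrite LatE; split=> [e|[k [l [-> ->]]]]; last first.
  apply: (mulfI c0); rewrite mulr0 zmap_zroot; apply/Fp_int_eq0; exists (- l).
  by rewrite pE; ring.
have /Fp_int_eq0[q qE] : (c%:Z * s1 - b%:Z * s2)%:~R = 0 :> 'F_p by rewrite -zmap_zroot e mulr0.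
have /Fp_int_eq0[k kE] : (s1 * (b%:Z + c%:Z) + c%:Z * s2)%:~R = 0 :> 'F_p.
  apply: (mulfI c0); rewrite mulr0 pmulrn -rmorphM /=; apply/Fp_int_eq0.
  exists (q * (b%:Z + c%:Z) + s2).
  transitivity ((c%:Z * s1 - b%:Z * s2) * (b%:Z + c%:Z) +
                (b%:Z * b%:Z + b%:Z * c%:Z + c%:Z * c%:Z) * s2); first by ring.
  by rewrite qE -pE; ring.
exists k, (- q); split; apply: (mulfI p0).
  transitivity (b%:Z * (p%:Z * k) + c%:Z * (p%:Z * q)); last by ring.
  by rewrite -kE -qE pE; ring.
transitivity (c%:Z * (p%:Z * k) - (b%:Z + c%:Z) * (p%:Z * q)); last by ring.
by rewrite -kE -qE pE; ring.
Qed.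

Lemma zmapZ (k : int) (t : hexlattice) :
  zmap zroot (k * t.1, k * t.2) = k%:~R * zmap zroot t.
Proof. by rewrite /zmap /= !rmorphM /=; ring. Qed.

(** The value is 2 b + c modulo p. If it vanished, 4 p = (2 b + c) ^ 2 + 3 c ^ 2 would make p divide
    3 c ^ 2, impossible as p > 3 and p does not divide c. *)
Lemma conj_neq0 : (p %% 24 = 1)%N -> zmap zroot (conjv (b%:Z, c%:Z)) != 0.
Proof.
move=> p24; have c0 := c_Fp_neq0; apply/eqP=> e.
have : (4 * p = (2 * b + c) ^ 2 + 3 * c ^ 2)%N by rewrite p_norm; ring.
move=> E; have e' : ((2 * b + c)%N%:R : 'F_p) = 0.
  rewrite natrD mul2n -addnn natrD -[RHS]e /conjv /zmap [_.1]/= [_.2]/=.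
  transitivity (b%:R + c%:R - (c%:R * zroot)); first by rewrite czroot; ring.
  by rewrite rmorphN rmorphD /= -!pmulrn; ring.
have d1 : (p %| 2 * b + c)%N by rewrite -Fp_nat_eq0 e'.
have : (p %| 3 * c ^ 2)%N.
  by rewrite -(dvdn_addr _ (dvdn_exp (isT : (0 < 2)%N) d1)) -E dvdn_mull.
rewrite Euclid_dvdM // Euclid_dvdX // andbT => /orP[|pc]; last by move: c0; rewrite Fp_nat_eq0 pc.
by move/dvdn_leq => /(_ isT) p3; have := prime_gt1 p_pr; lia.
Qed.

End EisensteinModP.

Theorem theorem7p6 (p b c m : nat) (d : Order.disp_t) (Q : finPOrderType d)
    (Phi : {set Q})
    (p_prime : prime p)
    (p_mod24 : p = 1 %[mod 24])
    (b_gt0 : 0 < b)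
    (c_gt0 : 0 < c)
    (p_norm : p = b ^ 2 + b * c + c ^ 2)
    (m_ge2 : 2 <= m)
    (Phi_base_flag : Phi \in flags Q)
    (Q_directly_regular : directly_regular 4 Phi)
    (Q_type : of_type 4 Q (torus63 (Posz m) (Posz 0)) octahedron)
    (Q_order : ~~ (p * (p ^ 2 - 1) %| #|autgroup Q|)) :
  exists (d' : Order.disp_t) (P : finPOrderType d'),
    [/\ chiral P 4,
        autgroup P \isog setX (L2 p) (rotgroup 4 Phi),
        p %| m ->
          of_type 4 P (torus63 (Posz m) (Posz 0)) octahedron /\
          regular_facets 4 P
      & ~~ (p %| m) ->
          of_type 4 P (torus63 (Posz (m * b)) (Posz (m * c))) octahedron /\
          chiral_facets 4 P].
Proof.
have [regQ index2] := Q_directly_regular; have [Q_facet Q_vertex] := Q_type.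
have p24 : p %% 24 = 1 by rewrite p_mod24.
(* This makes 2 and 15 invertible modulo p, as the proof of simplicity requires. *)
have p_gt15 : 15 < p by have := prime_gt1 p_prime; clear -p24; lia.
have [q0 _] : exists q0, q0 \in Phi.
  apply/set0Pn; rewrite -card_gt0; have [[_ cF _ _] _] := regQ.
  by rewrite (cF _ Phi_base_flag).
have RQ := regular_rep q0 regQ.
pose z := zroot p b c.
have zE : (z * z = z - 1)%R := zrootE p_prime b_gt0 c_gt0 p_norm.
have small k : 0 < k -> k < p -> (k%:R != 0 :> 'F_p)%R.
  move=> k0 kp; rewrite Fp_nat_eq0 //; apply/negP=> /dvdn_leq => /(_ k0).
  by rewrite leqNgt kp.
have two0 : (1 + 1 != 0 :> 'F_p)%R.
  by apply: (small 2) => //; apply: leq_trans p_gt15.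
have fif0 : (15%:R != 0 :> 'F_p)%R by apply: small.
have [e e4] := root8_ex p_prime p_mod24.
have SLE : SL2_group p :=: SLF 'F_p by [].
have [D [W [T LD]]] := L2quo_ex SLE two0 fif0 e4 zE.
have {}LD : L2_data z (L2 p) D W T := LD.
have cardL : p * (p ^ 2 - 1) = 2 * #|L2 p| by have := card_L2quo SLE two0; rewrite card_Fp.
have order_ndvd : ~~ (2 * #|L2 p| %| #|autgroup Q|) by rewrite -cardL.
have F_surj (x : 'F_p) : exists k : nat, (x = k%:R)%R.
  by exists x; rewrite natr_Zp.
(* This is where m >= 2 enters: for m = 1 neighbouring hexagons would be identified. *)
have nLm : ~ translation_lattice m 0 (1, 0)%R.
  move/LatE=> [k [l [e1 _]]]; move/(congr1 absz): e1; rewrite mul0r subr0 abszM.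
  by move=> /esym/eqP; rewrite muln_eq1 => /andP[/eqP e1 _]; have em : m = 1 := e1; rewrite em in m_ge2.
have vert w : word 3 w -> act (flip 4 q0) (map succn w) Phi = Phi -> weq w [::].
  apply: (regular_octahedron_word regQ Phi_base_flag); apply: Q_vertex.
  by rewrite (rank_f RQ).
have hexQ w : word 3 w -> act (flip 4 q0) w Phi = Phi <->
    exists2 t, translation_lattice m 0 t & act hexr w hex0 = (t, 0, false).
  apply: (regular_torus_word regQ Phi_base_flag nLm); apply: Q_facet.
  by rewrite (rank_f RQ).
have [d' [P [f [R sep]]]] := xrep_ex LD zE F_surj regQ Phi_base_flag index2 order_ndvd vert.
have v0 : zmap z (Posz b, Posz c)%R = 0%R.
  by apply/(zmap_eq0 p_prime b_gt0 c_gt0 p_norm)/LatE; exists 1%R, 0%R; lia.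
have cv0 := conj_neq0 p_prime b_gt0 c_gt0 p_norm p24.
have vertP (V : P) : Defs.rank V = 0%R -> poset_iso (vertex_figure V) octahedron.
  apply: (xvertex_iso LD zE regQ Phi_base_flag index2 vert R sep).
  by apply: Q_vertex; rewrite (rank_f RQ).
have LatQ t : translation_lattice m 0 t <-> exists s : hexlattice, t = (Posz m * s.1, Posz m * s.2)%R.
  case: t => t1 t2; rewrite LatE; split=> [[k [l [-> ->]]]|[[s1 s2] [-> ->]]].
    by exists (k, l); congr pair => /=; ring.
  by exists s1, s2; split=> /=; ring.
exists d', P; split.
- exact: (xP_chiral LD zE F_surj regQ Phi_base_flag index2 order_ndvd v0 cv0 R sep).
- exact: (xP_isog LD zE F_surj regQ Phi_base_flag index2 order_ndvd v0 cv0 R sep).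
- move=> pm; have m0 : ((Posz m)%:~R = 0 :> 'F_p)%R by apply/eqP; rewrite -pmulrn Fp_nat_eq0.
  (* When p divides m, all of m Z[zeta] is killed, mirror images included; the facets keep their
     lattice and are regular. *)
  have Lz t : translation_lattice m 0 t -> zmap z t = 0%R /\ zmap z (conjv t) = 0%R.
    move=> /LatQ[s ->]; rewrite /conjv /= -mulrDr -mulrN.
    have := zmapZ p b c (Posz m) (conjv s); rewrite /conjv /= => ->.
    by rewrite zmapZ m0 !mul0r.
  split; first split=> // G rG.
    apply: (xfacet_torus LD zE regQ Phi_base_flag index2 R sep hexQ nLm _ rG) => t.
    by split=> [[]//|Lt]; split=> //; case: (Lz t Lt).
  move=> G rG; have [x [Sx xG _]] := facet_of_rank LD regQ Phi_base_flag index2 R rG.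
  exact: (xfacet_regular LD zE regQ Phi_base_flag index2 R sep hexQ (ex_intro2 _ _ x Sx xG)).
move=> pm.
have m0 : ((Posz m)%:~R != 0 :> 'F_p)%R by rewrite -pmulrn Fp_nat_eq0.
(* When p does not divide m, a vector m s is killed exactly if s lies in the ideal of b + c zeta,
   and m times this ideal is the lattice of (m b, m c). *)
have LE t : translation_lattice m 0 t /\ zmap z t = 0%R <-> translation_lattice (m * b)%N (m * c)%N t.
  case: t => t1 t2; split.
    move=> [/LatQ[[s1 s2] /= ->]]; rewrite (zmapZ p b c (Posz m) (s1, s2)) => /eqP.
    rewrite mulf_eq0 (negPf m0) /= => /eqP/(zmap_eq0 p_prime b_gt0 c_gt0 p_norm)/LatE[k [l [-> ->]]].
    by apply/LatE; exists k, l; rewrite !PoszM; split; ring.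
  move/LatE=> [k [l [-> ->]]]; rewrite !PoszM.
  pose s : hexlattice := (Posz b * k - Posz c * l, Posz c * k + (Posz b + Posz c) * l)%R.
  rewrite (_ : (_, _) = (Posz m * s.1, Posz m * s.2)%R); last by rewrite /s /=; congr pair; ring.
  split; first by apply/LatQ; exists s.
  rewrite zmapZ (_ : zmap z s = 0%R) ?mulr0 //.
  by apply/(zmap_eq0 p_prime b_gt0 c_gt0 p_norm)/LatE; exists k, l.
have nLmb : ~ translation_lattice (m * b)%N (m * c)%N (1, 0)%R.
  by move/LE=> [].
split; first split=> // G rG.
  exact: (xfacet_torus LD zE regQ Phi_base_flag index2 R sep hexQ nLmb LE rG).
move=> G rG; have [x [Sx xG _]] := facet_of_rank LD regQ Phi_base_flag index2 R rG.
have mE : (Posz m * (Posz b, Posz c).1, Posz m * (Posz b, Posz c).2)%R = (Posz (m * b)%N, Posz (m * c)%N)%R by rewrite !PoszM.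
(* The witness is m (b + c zeta): it is killed, while its mirror image has value m (2 b + c), which
   is nonzero modulo p. *)
apply: (xfacet_chiral LD zE regQ Phi_base_flag index2 R sep hexQ (ex_intro2 _ _ x Sx xG)
  (t := (Posz m * Posz b, Posz m * Posz c)%R)).
- by apply/LatQ; exists (Posz b, Posz c)%R.
- by rewrite (zmapZ p b c (Posz m) (Posz b, Posz c)%R) -/z v0 mulr0.
rewrite /conjv /= -mulrDr -mulrN (zmapZ p b c (Posz m) (conjv (Posz b, Posz c)%R)).
by apply/eqP; rewrite mulf_neq0.
Qed.
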